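(* Let $\Pi_\Sigma$ be the toric Poisson structure on $\mathbb{CP}^1=(\mathbb C^2\setminus\{0\})/\mathbb C^*$, i.e. the Poisson structure coinduced by the quotient map from $\Pi=\sum_{\ell=1}^2 i|z_\ell|^2\partial_{\bar z_\ell}\wedge\partial_{z_\ell}$ on $\mathbb C^2\setminus\{0\}$. The Poisson cohomology of $(\mathbb{CP}^1,\Pi_\Sigma)$ is finite dimensional, and as real vector spaces (i) $H^0(\mathbb{CP}^1,\Pi_\Sigma)\cong\mathbb R$, (ii) $H^1(\mathbb{CP}^1,\Pi_\Sigma)\cong\mathbb R^3$, and (iii) $H^2(\mathbb{CP}^1,\Pi_\Sigma)\cong\mathbb R^4$.
   Context: Here $\mathbb C^*$ acts diagonally on $\mathbb C^2\setminus\{0\}$, $\partial_z=\frac12(\partial_x-i\partial_y)$, $\partial_{\bar z}=\frac12(\partial_x+i\partial_y)$. The bivector field $\Pi$ is a real Poisson structure invariant under $(\mathbb C^* )^2$, and $\Pi_\Sigma$ is the unique Poisson structure on $\mathbb{CP}^1$ making the quotient map $(\mathbb C^2\setminus\{0\},\Pi)\to(\mathbb{CP}^1,\Pi_\Sigma)$ a Poisson map. For a Poisson manifold $(M,\pi)$, the Poisson cohomology $H^\bullet(M,\pi)$ is the cohomology of the complex of smooth real multivector fields on $M$ with differential $W\mapsto[W,\pi]$ (Schouten bracket). *)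

(* Defs.v *)
From HB Require Import structures.
From mathcomp Require Import all_boot all_order all_algebra perm complex.
From mathcomp Require Import generic_quotient ring_quotient.
From mathcomp Require Import all_classical all_reals all_analysis.
From mathcomp Require Import ring lra.

Set Implicit Arguments.
Unset Strict Implicit.
Unset Printing Implicit Defensive.

Import Order.TTheory GRing.Theory Num.Theory.
Import numFieldNormedType.Exports.

Local Open Scope ring_scope.
Local Open Scope quotient_scope.
Local Open Scope complex_scope.

Section LmodQuotient.
Variables (R : pzRingType) (V : lmodType R) (B : zmodClosed V).
Variable BZ : GRing.scaler_closed B.

Definition lquot of GRing.scaler_closed B : Type := Quotient.quot B.
Local Notation Q := (lquot BZ).

HB.instance Definition _ := GRing.Zmodule.on Q.

Definition lquot_scale (a : R) (q : Q) : Q := \pi_(Quotient.quot B) (a *: repr q).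

Lemma lquot_scale_pi a (v : V) :
  lquot_scale a (\pi_(Quotient.quot B) v) = \pi_(Quotient.quot B) (a *: v).
Proof.
apply/eqP; rewrite /lquot_scale -Quotient.idealrBE -scalerBr BZ //.
by rewrite Quotient.idealrBE reprK.
Qed.

Lemma lquotW (q : Q) : exists v, q = \pi_(Quotient.quot B) v.
Proof. by exists (repr (q : Quotient.quot B)); rewrite reprK. Qed.

Lemma lquot_scaleA a b q :
  lquot_scale a (lquot_scale b q) = lquot_scale (a * b) q.
Proof. by have [v ->] := lquotW q; rewrite !lquot_scale_pi scalerA. Qed.

Lemma lquot_scale1 : left_id 1 lquot_scale.
Proof. by move=> q; have [v ->] := lquotW q; rewrite lquot_scale_pi scale1r. Qed.

Lemma lquot_scaleDr : right_distributive lquot_scale +%R.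
Proof.
move=> a q r; have [v ->] := lquotW q; have [w ->] := lquotW r.
by rewrite -[_ + _]Quotient.pi_add !lquot_scale_pi scalerDr Quotient.pi_add.
Qed.

Lemma lquot_scaleDl q : {morph lquot_scale^~ q : a b / a + b}.
Proof.
move=> a b; have [v ->] := lquotW q.
by rewrite !lquot_scale_pi scalerDl Quotient.pi_add.
Qed.

HB.instance Definition _ := GRing.Zmodule_isLmodule.Build R Q
  lquot_scaleA lquot_scale1 lquot_scaleDr lquot_scaleDl.
End LmodQuotient.

Definition isom_Rn (R : pzRingType) (V : lmodType R) (n : nat) : Prop :=
  exists f : {linear V -> 'rV[R]_n}, bijective f.

Section LocalMultivectors.
Variable R : realType.

Definition partial n (i : 'I_n) (f : 'rV[R]_n -> R) : 'rV[R]_n -> R :=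
  fun x => 'D_('e_i) f x.

Definition smooth n (f : 'rV[R]_n -> R) : Prop :=
  forall s : seq 'I_n, let g := foldr (@partial n) f s in
    continuous g /\ forall x i, derivable g x 'e_i.

(* [P [:: i1; ...; ik] x] is the component P^{i1...ik}(x) of a contravariant
   tensor field on R^n; degrees are tracked by the length of the index list. *)
Definition tensor n : Type := seq 'I_n -> 'rV[R]_n -> R.

HB.instance Definition _ n := GRing.Lmodule.on (tensor n).

Definition permute T (K : seq T) (s : 'S_(size K)) : seq T :=
  [seq tnth (in_tuple K) (s i) | i <- enum 'I_(size K)].

(* P = (1/k!) \sum P^{i1...ik} \partial_{i1} /\ ... /\ \partial_{ik}, with
   smooth skew-symmetric components. *)
Definition multivector n (k : nat) (P : tensor n) : Prop :=
  [/\ forall K, size K != k -> P K = 0,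
      forall K (s : 'S_(size K)) x, P (permute s) x = (-1) ^+ s * P K x
    & forall K, smooth (P K)].

(* P at x is mapped to Q at f x by the differential of f. *)
Definition related m n (f : 'rV[R]_m -> 'rV[R]_n)
    (P : tensor m) (Q : tensor n) (x : 'rV[R]_m) : Prop :=
  forall K : seq 'I_n,
    Q K (f x) = \sum_(b : (size K).-tuple 'I_m)
      (\prod_(l < size K)
         partial (tnth b l) (fun y => f y 0 (tnth (in_tuple K) l)) x)
      * P b x.

(* Components of the Schouten bracket of P of degree p and Q of degree q:
   [P,Q]^K = 1/((p-1)! q!) eps^K_{IJ} P^{uI} d_u Q^J
             + (-1)^p/(p! (q-1)!) eps^K_{IJ} Q^{uJ} d_u P^I
   (summation over u and over all splittings of permutations of K in a list I
   followed by a list J).  If p = 0 (resp. q = 0) the first (resp. second)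
   term vanishes, since P (resp. Q) is zero on nonempty lists. *)
Definition schouten n (p q : nat) (P Q : tensor n) : tensor n := fun K x =>
  if (size K).+1 == (p + q)%N then
    ((p.-1)`! * q`!)%:R^-1 * \sum_(s : 'S_(size K)) (-1) ^+ s *
      \sum_(u < n) P (u :: take p.-1 (permute s)) x
                   * partial u (Q (drop p.-1 (permute s))) x
    + (-1) ^+ p * (p`! * (q.-1)`!)%:R^-1 * \sum_(s : 'S_(size K)) (-1) ^+ s *
      \sum_(u < n) Q (u :: drop p (permute s)) x
                   * partial u (P (take p (permute s))) x
  else 0.

End LocalMultivectors.

Section ProjectiveLine.
Variable R : realType.

Definition toC (w : 'rV[R]_2) : R[i] := w 0 0 +i* w 0 1.
Definition ofC (z : R[i]) : 'rV[R]_2 :=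
  \row_(a < 2) if a == 0 then complex.Re z else complex.Im z.

(* C^2 is R^4 with real coordinates (x_0, y_0, x_1, y_1), z_l = x_l + i y_l. *)
Definition xind (l : 'I_2) : 'I_4 := inord l.*2.
Definition yind (l : 'I_2) : 'I_4 := inord l.*2.+1.

Definition zcoord (l : 'I_2) (v : 'rV[R]_4) : R[i] :=
  v 0 (xind l) +i* v 0 (yind l).

Definition ofC2 (z : 'I_2 -> R[i]) : 'rV[R]_4 :=
  \row_(a < 4) if odd a then complex.Im (z (inord a./2)) else complex.Re (z (inord a./2)).

(* The quotient map C^2 \ {0} -> CP^1 read in the affine chart z_j != 0 of CP^1,
   whose coordinate is z_{1-j} / z_j; every chart is onto C = R^2. *)
Definition quotient_map (j : 'I_2) (v : 'rV[R]_4) : 'rV[R]_2 :=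
  ofC (zcoord (rev_ord j) v / zcoord j v).

(* Homogeneous coordinates of the point of coordinate w in chart j. *)
Definition homog (j : 'I_2) (w : 'rV[R]_2) : 'rV[R]_4 :=
  ofC2 (fun l => if l == j then 1 else toC w).

(* The change of charts i -> j, on the w such that zcoord j (homog i w) != 0. *)
Definition transition (i j : 'I_2) : 'rV[R]_2 -> 'rV[R]_2 :=
  quotient_map j \o homog i.

(* A tensor field on CP^1 is given by its expressions in the two charts. *)
Definition cp1_tensor : Type := 'I_2 -> tensor R 2.

HB.instance Definition _ := GRing.Lmodule.on cp1_tensor.

Definition cp1_multivector (k : nat) (W : cp1_tensor) : Prop :=
  (forall j, multivector k (W j)) /\
  (forall i j w, zcoord j (homog i w) != 0 ->
     related (transition i j) (W i) (W j) w).

Definition cp1_schouten (p q : nat) (P Q : cp1_tensor) : cp1_tensor :=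
  fun j => schouten p q (P j) (Q j).

Definition cp1_poisson (P : cp1_tensor) : Prop :=
  cp1_multivector 2 P /\ cp1_schouten 2 2 P P = 0.

(* d/dz_l and d/d\bar z_l in the frame (d/dx_0, d/dy_0, d/dx_1, d/dy_1). *)
Definition dz (l : 'I_2) (a : 'I_4) : R[i] :=
  2^-1 * ((a == xind l)%:R - 'i * (a == yind l)%:R).
Definition dzbar (l : 'I_2) (a : 'I_4) : R[i] :=
  2^-1 * ((a == xind l)%:R + 'i * (a == yind l)%:R).

Definition PiC (K : seq 'I_4) (v : 'rV[R]_4) : R[i] :=
  if K is [:: a; b] then
    \sum_(l < 2) 'i * `|zcoord l v| ^+ 2
      * (dzbar l a * dz l b - dzbar l b * dz l a)
  else 0.

Definition Pi : tensor R 4 := fun K v => complex.Re (PiC K v).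

Definition coinduced (P : cp1_tensor) : Prop :=
  cp1_poisson P /\
  forall j v, zcoord j v != 0 -> related (quotient_map j) Pi (P j) v.

End ProjectiveLine.

Section Linearity.
Variable R : realType.

Lemma foldr_partial_lin n (f g : 'rV[R]_n -> R) a (s : seq 'I_n) :
  smooth f -> smooth g ->
  foldr (@partial R n) (a *: f + g) s
  = a *: foldr (@partial R n) f s + foldr (@partial R n) g s.
Proof.
move=> sf sg; elim: s => //= i s ->; apply/funext => x.
rewrite /partial deriveD ?deriveZ //.
- by apply: (sf s).2.
- by apply: derivableZ; apply: (sf s).2.
- by apply: (sg s).2.
Qed.

Lemma partial_lin n (f g : 'rV[R]_n -> R) a i x : smooth f -> smooth g ->
  partial i (a *: f + g) x = a * partial i f x + partial i g x.
Proof. by move=> sf sg; have /= -> := foldr_partial_lin a [:: i] sf sg. Qed.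

Lemma smooth_lin n (f g : 'rV[R]_n -> R) a :
  smooth f -> smooth g -> smooth (a *: f + g).
Proof.
move=> sf sg s /=; rewrite foldr_partial_lin //; split=> [x|x i].
  apply: continuousD; last exact: (sg s).1.
  by apply: continuousZl_tmp; apply: (sf s).1.
by apply: derivableD; [apply: derivableZ; apply: (sf s).2 | apply: (sg s).2].
Qed.

Lemma foldr_partial0 n (s : seq 'I_n) :
  foldr (@partial R n) (0 : 'rV[R]_n -> R) s = 0.
Proof.
elim: s => //= i s ->; apply/funext => x; rewrite /partial.
exact: derive_cst.
Qed.

Lemma smooth0 n : smooth (0 : 'rV[R]_n -> R).
Proof.
move=> s /=; rewrite foldr_partial0; split=> [x|x i]; first exact: cst_continuous.
exact: derivable_cst.
Qed.

Lemma multivector0 n k : multivector k (0 : tensor R n).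
Proof. by split=> // [K s x|K]; [rewrite mulr0 | exact: smooth0]. Qed.

Lemma multivector_lin n k a (P Q : tensor R n) :
  multivector k P -> multivector k Q -> multivector k (a *: P + Q).
Proof.
move=> [P0 Ps Pr] [Q0 Qs Qr]; split=> [K kK|K s x|K].
- have -> : (a *: P + Q) K = a *: P K + Q K by [].
  by rewrite P0 // Q0 // scaler0 addr0.
- have E L : (a *: P + Q) L x = a * P L x + Q L x by [].
  by rewrite !E Ps Qs mulrDr mulrCA.
- exact: smooth_lin.
Qed.

Lemma related_lin m n (f : 'rV[R]_m -> 'rV[R]_n) a P Q P' Q' x :
  related f P Q x -> related f P' Q' x ->
  related f (a *: P + P') (a *: Q + Q') x.
Proof.
move=> r r' K; have -> : (a *: Q + Q') K (f x) = a * Q K (f x) + Q' K (f x) by [].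
rewrite r r' mulr_sumr -big_split /=; apply: eq_bigr => b _.
have -> : (a *: P + P') b x = a * P b x + P' b x by [].
by rewrite mulrDr mulrCA.
Qed.

Lemma cp1_multivector0 k : cp1_multivector k (0 : cp1_tensor R).
Proof.
split=> [j|i j w _ K]; first exact: multivector0.
by rewrite big1 // => b _; rewrite mulr0.
Qed.

Lemma cp1_multivector_lin k a (P Q : cp1_tensor R) :
  cp1_multivector k P -> cp1_multivector k Q -> cp1_multivector k (a *: P + Q).
Proof.
move=> [P1 P2] [Q1 Q2]; split=> [j|i j w w0]; first exact: multivector_lin.
by apply: related_lin; [exact: P2 | exact: Q2].
Qed.

Lemma cp1_schouten_lin p q a (P P' Q : cp1_tensor R) :
  cp1_multivector p P -> cp1_multivector p P' ->
  cp1_schouten p q (a *: P + P') Q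
  = a *: cp1_schouten p q P Q + cp1_schouten p q P' Q.
Proof.
move=> [P1 _] [Q1 _]; apply/funext => j; apply/funext => K; apply/funext => x.
have -> : (a *: cp1_schouten p q P Q + cp1_schouten p q P' Q) j K x
  = a * schouten p q (P j) (Q j) K x + schouten p q (P' j) (Q j) K x by [].
rewrite /cp1_schouten /schouten; case: ifP => _; last by rewrite mulr0 addr0.
rewrite mulrDr addrACA; congr (_ + _).
  rewrite mulrCA -mulrDr; congr (_ * _).
  rewrite mulr_sumr -big_split; apply: eq_bigr => s _ /=.
  rewrite mulrCA -mulrDr; congr (_ * _).
  rewrite mulr_sumr -big_split; apply: eq_bigr => u _ /=.
  by rewrite mulrA -mulrDl.
rewrite mulrCA -mulrDr; congr (_ * _).
rewrite mulr_sumr -big_split; apply: eq_bigr => s _ /=.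
rewrite mulrCA -mulrDr; congr (_ * _).
rewrite mulr_sumr -big_split; apply: eq_bigr => u _ /=.
have -> : (a *: P + P') j (take p (permute s))
  = a *: P j (take p (permute s)) + P' j (take p (permute s)) by [].
have [_ _ sP] := P1 j; have [_ _ sQ] := Q1 j.
by rewrite partial_lin // mulrDr [in RHS]mulrCA.
Qed.

End Linearity.

Section Cohomology.
Variables (R : realType) (P : cp1_tensor R) (k : nat).

Definition poisson_diff (k : nat) (W : cp1_tensor R) : cp1_tensor R :=
  cp1_schouten k 2 W P.

Lemma poisson_diff_lin l a (W W' : cp1_tensor R) :
  cp1_multivector l W -> cp1_multivector l W' ->
  poisson_diff l (a *: W + W') = a *: poisson_diff l W + poisson_diff l W'.
Proof. exact: cp1_schouten_lin. Qed.

Lemma poisson_diff0 l : poisson_diff l 0 = 0.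
Proof.
have h := cp1_multivector0 R l.
by have := poisson_diff_lin (-1) h h; rewrite scaler0 add0r scaleN1r addNr.
Qed.

Definition cocycle : {pred cp1_tensor R} :=
  fun W => `[< cp1_multivector k W /\ poisson_diff k W = 0 >].

Lemma cocycle_closed : submod_closed cocycle.
Proof.
split=> [|a W W' /asboolP[mW dW] /asboolP[mW' dW']]; apply/asboolP; split.
- exact: cp1_multivector0.
- exact: poisson_diff0.
- exact: cp1_multivector_lin.
- by rewrite poisson_diff_lin // dW dW' scaler0 addr0.
Qed.

HB.instance Definition _ := GRing.isSubmodClosed.Build R (cp1_tensor R) cocycle
  cocycle_closed.

Definition cocycles : Type := {W : cp1_tensor R | W \in cocycle}.

HB.instance Definition _ := SubChoice.on cocycles.
HB.instance Definition _ := [SubChoice_isSubLmodule of cocycles by <:].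

Definition coboundary : {pred cocycles} := fun W =>
  `[< if k is l.+1
      then exists2 Y, cp1_multivector l Y & val W = poisson_diff l Y
      else W = 0 >].

Lemma coboundary_closed : submod_closed coboundary.
Proof.
rewrite /coboundary; split=> [|a W W' /asboolP hW /asboolP hW']; apply/asboolP.
  case: (k) => // l; exists 0; first exact: cp1_multivector0.
  by rewrite poisson_diff0.
case: (k) hW hW' => [->->|l [Y mY dY] [Y' mY' dY']]; first by rewrite scaler0 addr0.
exists (a *: Y + Y'); first exact: cp1_multivector_lin.
by rewrite poisson_diff_lin // -dY -dY'.
Qed.

HB.instance Definition _ := GRing.isSubmodClosed.Build R cocycles coboundary
  coboundary_closed.

Lemma coboundaryZ : GRing.scaler_closed coboundary.
Proof. by move=> a W; apply: rpredZ. Qed.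

Definition poisson_cohomology : lmodType R := lquot coboundaryZ.

End Cohomology.

Local Open Scope classical_set_scope.

Section CoinducedExists.
Variable R : realType.

Lemma cvg_coord n (i : 'I_n) (x v : 'rV[R]_n) :
  (fun h : R => h^-1 *: (((fun y : 'rV[R]_n => y 0 i : R) \o shift x) (h *: v) - x 0 i))
    @ (0 : R)^' --> (v 0 i : R).
Proof.
apply: (cvg_trans _ (cvg_cst (v 0 i))).
apply: near_eq_cvg; near=> h; rewrite /= !mxE /GRing.scale/= addrK mulKf //.
by near: h; exact: nbhs_dnbhs_neq.
Unshelve. all: try end_near. all: exact: dnbhs_filter. Qed.

Lemma is_derive_coord n (i : 'I_n) (x v : 'rV[R]_n) :
  is_derive x v (fun y : 'rV[R]_n => y 0 i : R) (v 0 i).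
Proof.
have H := @cvg_coord n i x v.
apply: DeriveDef; first exact: cvgP H.
exact: (cvg_lim _ H).
Qed.

Lemma sum_tuple2 (T : finType) (F : 2.-tuple T -> R) :
  \sum_b F b = \sum_i \sum_j F [tuple i; j].
Proof.
rewrite pair_bigA /= (reindex (fun p : T * T => [tuple p.1; p.2])) //=.
exists (fun b => (tnth b 0, tnth b 1)) => [[i j] _|b _] //=.
by apply: val_inj; case: b => [[|a [|b [|c s]]] h].
Qed.

Lemma PiCE (a b : 'I_4) (v : 'rV[R]_4) : PiC [:: a; b] v =
  (2^-1 * \sum_(l < 2) (v 0 (xind l) ^+ 2 + v 0 (yind l) ^+ 2)
   * ((a == xind l)%:R * (b == yind l)%:R - (a == yind l)%:R * (b == xind l)%:R))%:C.
Proof.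
rewrite rmorphM rmorph_sum mulr_sumr; apply: eq_bigr => l _ /=.
rewrite normc_def -rmorphXn sqr_sqrtr ?addr_ge0 ?sqr_ge0 //=.
rewrite /dz /dzbar; set N := (_ + _)%:C.
rewrite fmorphV !rmorphM rmorphB !rmorphM !rmorph_nat.
set A := (a == _)%:R; set B := (b == _)%:R; set C := (a == _)%:R; set D := (b == _)%:R.
have i2 : 'i * 'i = -1 :> R[i] by rewrite -expr2 sqr_i.
have i3 : 'i * 'i * 'i = -'i :> R[i] by rewrite i2 mulN1r.
transitivity (2^-1 * 2^-1 * N * ('i * 'i) * 2 * (C * B - A * D)); first by ring.
by rewrite i2; field.
Qed.

Lemma Pi_real (K : seq 'I_4) (v : 'rV[R]_4) : PiC K v = (Pi K v)%:C.
Proof. by case: K => [|a [|b [|c K]]] //; rewrite /Pi PiCE. Qed.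

Lemma xindE l m : (xind l == xind m) = (l == m).
Proof. by rewrite -val_eqE /= !inordK; move: l m => [[|[|]]//= ?] [[|[|]]//= ?]. Qed.
Lemma yindE l m : (yind l == yind m) = (l == m).
Proof. by rewrite -val_eqE /= !inordK; move: l m => [[|[|]]//= ?] [[|[|]]//= ?]. Qed.
Lemma xyindE l m : (xind l == yind m) = false.
Proof. by rewrite -val_eqE /= !inordK; move: l m => [[|[|]]//= ?] [[|[|]]//= ?]. Qed.
Lemma yxindE l m : (yind l == xind m) = false.
Proof. by rewrite eq_sym xyindE. Qed.

Lemma rev_ord2 (j : 'I_2) : (j == rev_ord j = false) * (rev_ord j == j = false).
Proof. by split; rewrite -val_eqE; move: j => [[|[|]]//= ?]. Qed.

Lemma sum_ord2 (F : 'I_2 -> R) j : \sum_(l < 2) F l = F j + F (rev_ord j).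
Proof.
rewrite !big_ord_recl big_ord0 addr0; move: j => [[|[|]]//= h].
  by congr (F _ + F _); apply: val_inj.
by rewrite addrC; congr (F _ + F _); apply: val_inj.
Qed.

Lemma sum_delta n (A : 'I_n -> R) x : \sum_c A c * (c == x)%:R = A x.
Proof.
rewrite (bigD1 x) //= eqxx mulr1 big1 ?addr0 // => c /negPf ->.
by rewrite mulr0.
Qed.

Lemma sum_Pi (A B : 'I_4 -> R) v :
  \sum_c \sum_d A c * B d * Pi [:: c; d] v = 2^-1 * \sum_(l < 2)
    (v 0 (xind l) ^+ 2 + v 0 (yind l) ^+ 2)
    * (A (xind l) * B (yind l) - A (yind l) * B (xind l)).
Proof.
rewrite mulr_sumr.
under eq_bigr => c _ do under eq_bigr => d _ do
  rewrite /Pi PiCE /= mulr_sumr mulr_sumr.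
under eq_bigr => c _ do rewrite exchange_big.
rewrite exchange_big; apply: eq_bigr => l _ /=.
rewrite -(sum_delta A (xind l)) -(sum_delta A (yind l)).
rewrite -(sum_delta B (xind l)) -(sum_delta B (yind l)).
rewrite !big_distrlr /= -sumrB !mulr_sumr; apply: eq_bigr => c _.
rewrite -sumrB !mulr_sumr; apply: eq_bigr => d _; ring.
Qed.

Lemma is_deriveV n (f : 'rV[R]_n -> R) (x v : 'rV[R]_n) (df : R) :
  f x != 0 -> is_derive x v f df ->
  is_derive x v (fun y => (f y)^-1) (- (f x) ^- 2 * df).
Proof.
move=> fx0 fdf; apply: DeriveDef; first exact: derivableV.
by rewrite deriveV // derive_val.
Qed.

Lemma partial_frac n (p q r s i : 'I_n) (e : R) (v : 'rV[R]_n) :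
  v 0 q ^+ 2 + v 0 s ^+ 2 != 0 ->
  partial i (fun y => (y 0 p * y 0 q + e * (y 0 r * y 0 s))
                      / (y 0 q ^+ 2 + y 0 s ^+ 2)) v =
  ((p == i)%:R * v 0 q + v 0 p * (q == i)%:R
    + e * ((r == i)%:R * v 0 s + v 0 r * (s == i)%:R))
      / (v 0 q ^+ 2 + v 0 s ^+ 2)
  - (v 0 p * v 0 q + e * (v 0 r * v 0 s))
      * (2 * (v 0 q * (q == i)%:R + v 0 s * (s == i)%:R))
      / (v 0 q ^+ 2 + v 0 s ^+ 2) ^+ 2.
Proof.
move=> N0.
have co c : is_derive v ('e_i : 'rV[R]_n) (fun y : 'rV[R]_n => y 0 c : R) (c == i)%:R.
  by apply: is_derive_eq (is_derive_coord c v _) _; rewrite mxE eqxx.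
have dN := is_deriveD (is_deriveM (co q) (co q)) (is_deriveM (co s) (co s)).
have N0' : ((fun y : 'rV[R]_n => y 0 q : R) * (fun y : 'rV[R]_n => y 0 q : R)
  + (fun y : 'rV[R]_n => y 0 s : R) * (fun y : 'rV[R]_n => y 0 s : R)) v != 0.
  by rewrite !expr2 in N0.
have dnum := is_deriveD (is_deriveM (co p) (co q)) (is_deriveZ e (is_deriveM (co r) (co s))).
have dtot := is_deriveM dnum (is_deriveV N0' dN).
have dE := @derive_val _ _ _ _ _ _ _ dtot.
rewrite /partial; transitivity
 ('D_'e_i (((fun y : 'rV[R]_n => y 0 p : R) * (fun y : 'rV[R]_n => y 0 q : R)
   + e \*: ((fun y : 'rV[R]_n => y 0 r : R) * (fun y : 'rV[R]_n => y 0 s : R))) *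
   (fun y : 'rV[R]_n => (((fun y : 'rV[R]_n => y 0 q : R) * (fun y : 'rV[R]_n => y 0 q : R)
  + (fun y : 'rV[R]_n => y 0 s : R) * (fun y : 'rV[R]_n => y 0 s : R)) y)^-1)) v).
  by [].
rewrite dE /GRing.scale /=.
have E1 : ((fun y : 'rV[R]_n => y 0 q : R) * (fun y : 'rV[R]_n => y 0 q : R)
  + (fun y : 'rV[R]_n => y 0 s : R) * (fun y : 'rV[R]_n => y 0 s : R)) v = v 0 q ^+ 2 + v 0 s ^+ 2 by [].
have E2 : ((fun y : 'rV[R]_n => y 0 p : R) * (fun y : 'rV[R]_n => y 0 q : R)
   + e \*: ((fun y : 'rV[R]_n => y 0 r : R) * (fun y : 'rV[R]_n => y 0 s : R))) v =
   v 0 p * v 0 q + e * (v 0 r * v 0 s) by [].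
rewrite E1 E2; field; exact: N0.
Qed.

Lemma quotient_mapE j (a : 'I_2) v : quotient_map j v 0 a =
  (if a == 0 then
    v 0 (xind (rev_ord j)) * v 0 (xind j) + 1 * (v 0 (yind (rev_ord j)) * v 0 (yind j))
   else v 0 (yind (rev_ord j)) * v 0 (xind j) + - 1 * (v 0 (xind (rev_ord j)) * v 0 (yind j)))
   / (v 0 (xind j) ^+ 2 + v 0 (yind j) ^+ 2) :> R.
Proof.
rewrite /quotient_map /ofC mxE.
have -> : zcoord (rev_ord j) v / zcoord j v =
  (v 0 (xind (rev_ord j)) +i* v 0 (yind (rev_ord j))) *
  ((v 0 (xind j) / (v 0 (xind j) ^+ 2 + v 0 (yind j) ^+ 2))
   -i* (v 0 (yind j) / (v 0 (xind j) ^+ 2 + v 0 (yind j) ^+ 2))) by [].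
case: ifP => _ /=; ring.
Qed.

Lemma zcoord_neq0 j (v : 'rV[R]_4) : zcoord j v != 0 ->
  v 0 (xind j) ^+ 2 + v 0 (yind j) ^+ 2 != 0.
Proof.
by apply: contra; rewrite paddr_eq0 ?sqr_ge0 // !sqrf_eq0 eq_complex.
Qed.

(* PiSigma is |w|^2 d/dx /\ d/dy in both affine charts, w = x + i y. *)
Definition eps (a b : 'I_2) : R := (a < b)%N%:R - (b < a)%N%:R.
Definition affine_Pi : tensor R 2 := fun K w =>
  if K is [:: a; b] then eps a b * (w 0 0 ^+ 2 + w 0 1 ^+ 2) else 0.

Lemma quotient_map_related : forall j v, zcoord j v != 0 -> related (quotient_map j) (@Pi R) affine_Pi v.
Proof.
move=> j v /zcoord_neq0 N0 [|a [|b [|c K]]].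
1,2,4: by rewrite big1 //= => -[[|x [|y [|z s]]] //= h] _; rewrite /Pi /= mulr0.
rewrite sum_tuple2.
under eq_bigr => c _ do under eq_bigr => d _ do
  rewrite !big_ord_recl big_ord0 mulr1 /= /tnth /=.
rewrite sum_Pi (sum_ord2 _ j).
have Q (k : 'I_2) : (fun y => quotient_map j y 0 k) = fun y =>  (if k == 0 then
    y 0 (xind (rev_ord j)) * y 0 (xind j) + 1 * (y 0 (yind (rev_ord j)) * y 0 (yind j))
   else y 0 (yind (rev_ord j)) * y 0 (xind j) + - 1 * (y 0 (xind (rev_ord j)) * y 0 (yind j)))
   / (y 0 (xind j) ^+ 2 + y 0 (yind j) ^+ 2) :> R.
  by apply/funext => y; rewrite quotient_mapE.
rewrite !Q /affine_Pi /= !quotient_mapE /=.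
by case: a b => [[|[|]]//= ha] [[|[|]]//= hb]; rewrite /eps /=;
  rewrite !partial_frac // !xindE !yindE !xyindE !yxindE !eqxx !rev_ord2 /=; field.
Qed.

Lemma partial_frac1 n (p q s i : 'I_n) (e : R) (v : 'rV[R]_n) :
  v 0 q ^+ 2 + v 0 s ^+ 2 != 0 ->
  partial i (fun y => (e * y 0 p) / (y 0 q ^+ 2 + y 0 s ^+ 2)) v =
  (e * (p == i)%:R) / (v 0 q ^+ 2 + v 0 s ^+ 2)
  - (e * v 0 p) * (2 * (v 0 q * (q == i)%:R + v 0 s * (s == i)%:R))
      / (v 0 q ^+ 2 + v 0 s ^+ 2) ^+ 2.
Proof.
move=> N0.
have co c : is_derive v ('e_i : 'rV[R]_n) (fun y : 'rV[R]_n => y 0 c : R) (c == i)%:R.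
  by apply: is_derive_eq (is_derive_coord c v _) _; rewrite mxE eqxx.
have dN := is_deriveD (is_deriveM (co q) (co q)) (is_deriveM (co s) (co s)).
have N0' : ((fun y : 'rV[R]_n => y 0 q : R) * (fun y : 'rV[R]_n => y 0 q : R)
  + (fun y : 'rV[R]_n => y 0 s : R) * (fun y : 'rV[R]_n => y 0 s : R)) v != 0.
  by rewrite !expr2 in N0.
have dtot := is_deriveM (is_deriveZ e (co p)) (is_deriveV N0' dN).
have dE := @derive_val _ _ _ _ _ _ _ dtot.
rewrite /partial; transitivity
 ('D_'e_i ((e \*: (fun y : 'rV[R]_n => y 0 p : R)) *
   (fun y : 'rV[R]_n => (((fun y : 'rV[R]_n => y 0 q : R) * (fun y : 'rV[R]_n => y 0 q : R)
  + (fun y : 'rV[R]_n => y 0 s : R) * (fun y : 'rV[R]_n => y 0 s : R)) y)^-1)) v).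
  by [].
rewrite dE; set N := v 0 q ^+ 2 + v 0 s ^+ 2.
transitivity ((e * v 0 p) * (- N ^- 2 *
  (v 0 q * (q == i)%:R + v 0 q * (q == i)%:R
   + (v 0 s * (s == i)%:R + v 0 s * (s == i)%:R))) + N^-1 * (e * (p == i)%:R)).
  by [].
by field.
Qed.

Lemma homogE i l (w : 'rV[R]_2) :
  (homog i w 0 (xind l) = if l == i then 1 else w 0 0)
  * (homog i w 0 (yind l) = if l == i then 0 else w 0 1).
Proof.
have h : (inord l : 'I_2) = l by apply: val_inj; rewrite /= inordK.
split; rewrite mxE /= /xind /yind inordK ?oddS ?odd_double /=;
  try by move: l {h} => [[|[|]]//= ?].
  by rewrite doubleK h; case: eqP.
by rewrite uphalf_double h; case: eqP.
Qed.

Lemma related_affine_Pi (T : 'rV[R]_2 -> 'rV[R]_2) w (t : 'I_2 -> R) (J : 'I_2 -> 'I_2 -> R) :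
  (forall k, T w 0 k = t k) ->
  (forall k c, partial c (fun y => T y 0 k) w = J k c) ->
  t 0 ^+ 2 + t 1 ^+ 2 = (J 0 0 * J 1 1 - J 0 1 * J 1 0) * (w 0 0 ^+ 2 + w 0 1 ^+ 2) ->
  related T affine_Pi affine_Pi w.
Proof.
move=> Tt TJ tJ [|a [|b [|c K]]].
1,2,4: by rewrite big1 //= => -[[|x [|y [|z s]]] //= h] _; rewrite mulr0.
rewrite sum_tuple2.
under eq_bigr => c _ do under eq_bigr => d _ do
  rewrite !big_ord_recl big_ord0 mulr1 /= /tnth /= !TJ.
rewrite /affine_Pi /= !Tt tJ !big_ord_recl !big_ord0.
have -> : lift ord0 ord0 = 1 :> 'I_2 by apply: val_inj.
have -> : ord0 = 0 :> 'I_2 by apply: val_inj.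
have o2 (k : 'I_2) : k = 0 \/ k = 1.
  by case: k => [[|[|]]//= h]; [left|right]; apply: val_inj.
by case: (o2 a) (o2 b) => -> [] ->; rewrite /eps /=; ring.
Qed.

Lemma transition_related i j (w : 'rV[R]_2) : zcoord j (homog i w) != 0 ->
  related (transition i j) affine_Pi affine_Pi w.
Proof.
move=> /zcoord_neq0 N0.
have [ji|ji] := eqVneq j i.
  have Q (k : 'I_2) : (fun y => transition i j y 0 k) = fun y => y 0 k :> R.
    apply/funext => y; rewrite /transition /= quotient_mapE !homogE ji !eqxx.
    rewrite !rev_ord2; case: k => [[|[|]]//= h];
    rewrite !(mul0r, mulr0, mulr1, mul1r, addr0, expr0n, expr1n, divr1) /=;
    rewrite ?addr0 ?divr1;
    by congr (y _ _); apply: val_inj.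
  apply: (@related_affine_Pi _ _ (fun k => w 0 k) (fun k c => (k == c)%:R)).
  - by move=> k; have /(congr1 (fun f => f w)) := Q k.
  - move=> k c.
    rewrite Q /partial (@derive_val _ _ _ _ _ _ _ (is_derive_coord k w _)).
    by rewrite mxE eqxx.
  - by rewrite /=; ring.
have Q (k : 'I_2) : (fun y => transition i j y 0 k) =
   fun y => ((-1) ^+ k * y 0 k) / (y 0 0 ^+ 2 + y 0 1 ^+ 2) :> R.
  have ri : rev_ord j = i.
    by apply: val_inj; move: i j ji {N0} => [[|[|]]//= ?] [[|[|]]//= ?].
  apply/funext => y; rewrite /transition /= quotient_mapE !homogE ri !eqxx.
  rewrite (negPf ji); congr (_ / _); case: k => [[|[|]]//= h].
    have -> : Ordinal h = 0 by apply: val_inj.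
    ring.
  have -> : Ordinal h = 1 by apply: val_inj.
  ring.
rewrite !homogE (negPf ji) in N0.
apply: (@related_affine_Pi _ _ (fun k => (-1) ^+ k * w 0 k / (w 0 0 ^+ 2 + w 0 1 ^+ 2))).
- by move=> k; have /(congr1 (fun f => f w)) := Q k.
- by move=> k c; rewrite Q partial_frac1 //; reflexivity.
- by rewrite /=; field.
Qed.

Lemma smooth_stable (S : set ('rV[R]_2 -> R)) :
  (forall f, S f -> continuous f /\
     forall i, S (partial i f) /\ forall x, derivable f x 'e_i) ->
  forall f, S f -> smooth f.
Proof.
move=> H f Sf s /=.
have : S (foldr (@partial R 2) f s) by elim: s => //= i s /H [_] /(_ i) [].
by move=> /H [cs ds]; split=> // x i; apply: (ds i).2.
Qed.

Lemma permute_tperm0 T (K : seq T) p q (F : seq T -> R) : p != q ->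
  tnth (in_tuple K) p = tnth (in_tuple K) q ->
  \sum_(s : 'S_(size K)) (-1) ^+ s * F (permute s) = 0.
Proof.
move=> pq Kpq; set S := \sum_s _; suff : S = - S by move=> h; lra.
rewrite {1}/S (reindex_inj (mulIg (tperm p q))) /= -sumrN.
apply: eq_bigr => s _; rewrite odd_permM odd_tperm pq signr_addb /= expr1.
have -> : permute (s * tperm p q) = permute s.
  by apply: eq_map => i; rewrite permM; case: tpermP => // ->.
by rewrite mulrN1 mulNr.
Qed.

Lemma pigeon3 (K : seq 'I_2) : size K = 3%N -> exists p q : 'I_(size K),
  p != q /\ tnth (in_tuple K) p = tnth (in_tuple K) q.
Proof.
move=> K3; have : ~~ injectiveb (tnth (in_tuple K)).
  apply/negP => /injectiveP /leq_card; by rewrite !card_ord K3.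
by move=> /injectivePn [p [q pq e]]; exists p, q.
Qed.

Lemma schouten_affine_Pi : schouten 2 2 affine_Pi affine_Pi = 0.
Proof.
apply/funext => K; apply/funext => x; rewrite /schouten; case: eqP => // -[K3].
have [p [q [pq Kpq]]] := pigeon3 K3.
rewrite (@permute_tperm0 _ _ p q (fun L => \sum_(u < 2) affine_Pi (u :: take 1 L) x
   * partial u (affine_Pi (drop 1 L)) x)) //.
rewrite (@permute_tperm0 _ _ p q (fun L => \sum_(u < 2) affine_Pi (u :: drop 2 L) x
   * partial u (affine_Pi (take 2 L)) x)) //.
by rewrite !mulr0 addr0.
Qed.

Let X (i : 'I_2) : 'rV[R]_2 -> R := fun w => w 0 i.
Let quad a b c d := a *: (X 0 * X 0 + X 1 * X 1) + (b *: X 0 + c *: X 1) + cst d.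

Lemma is_derive_quad a b c d x i : is_derive x ('e_i : 'rV[R]_2) (quad a b c d)
  (a * (2 * (x 0 0 * (0 == i)%:R + x 0 1 * (1 == i)%:R))
    + (b * (0 == i)%:R + c * (1 == i)%:R)).
Proof.
have co k : is_derive x ('e_i : 'rV[R]_2) (X k) (k == i)%:R.
  by apply: is_derive_eq (is_derive_coord k x _) _; rewrite mxE eqxx.
have := is_deriveD (is_deriveD (is_deriveZ a (is_deriveD (is_deriveM (co 0) (co 0))
  (is_deriveM (co 1) (co 1)))) (is_deriveD (is_deriveZ b (co 0)) (is_deriveZ c (co 1))))
  (is_derive_cst d x ('e_i : 'rV[R]_2)).
move=> h; apply: is_derive_eq h _.
transitivity (a * (x 0 0 * (0 == i)%:R + x 0 0 * (0 == i)%:R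
  + (x 0 1 * (1 == i)%:R + x 0 1 * (1 == i)%:R)) + (b * (0 == i)%:R + c * (1 == i)%:R) + 0 : R).
  by [].
ring.
Qed.

Lemma smooth_quad a b c d : smooth (quad a b c d).
Proof.
apply: (@smooth_stable [set f | exists a b c d, f = quad a b c d]); last by exists a, b, c, d.
move=> f [{}a [{}b [{}c [{}d ->]]]]; split=> [|i].
  have cX k : continuous (X k) by move=> x; apply: coord_continuous.
  move=> x; apply: continuousD; last exact: cst_continuous.
  apply: continuousD; last by apply: continuousD; apply: continuousZl_tmp; apply: cX.
  by apply: continuousZl_tmp; apply: continuousD; apply: continuousM; apply: cX.
split=> [|x]; last exact: (@ex_derive _ _ _ _ _ _ _ (is_derive_quad a b c d x i)).
exists 0, (a * (2 * (0 == i)%:R)), (a * (2 * (1 == i)%:R)), (b * (0 == i)%:R + c * (1 == i)%:R).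
apply/funext => x; rewrite /partial (@derive_val _ _ _ _ _ _ _ (is_derive_quad a b c d x i)).
transitivity (0 * (x 0 0 * x 0 0 + x 0 1 * x 0 1) + ((a * (2 * (0 == i)%:R)) * x 0 0
  + (a * (2 * (1 == i)%:R)) * x 0 1) + (b * (0 == i)%:R + c * (1 == i)%:R)); last by [].
ring.
Qed.

Lemma perm_ord2 (s : 'S_2) : s = 1%g \/ s = tperm 0 1.
Proof.
have o2 (k : 'I_2) : k = 0 \/ k = 1.
  by case: k => [[|[|]]//= h]; [left|right]; apply: val_inj.
have s01 : s 0 != s 1 by rewrite (inj_eq perm_inj).
case: (o2 (s 0)) (o2 (s 1)) s01 => s0 [] s1; rewrite s0 s1 // => _; [left|right];
  by apply/permP => k; case: (o2 k) => ->; rewrite ?perm1 ?tpermL ?tpermR.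
Qed.

Lemma multivector_affine_Pi : multivector 2 affine_Pi.
Proof.
split=> [K K2|K s x|K].
- by apply/funext => x; case: K K2 => [|a [|b [|c K]]].
- have [K2|K2] := eqVneq (size K) 2%N; last first.
    have Pi0 L : size L != 2%N -> affine_Pi L x = 0 by case: L => [|? [|? [|? ?]]].
    by rewrite !Pi0 ?mulr0 // size_map size_enum_ord.
  case: K K2 s => [|a [|b [|c K]]] //= _ s.
  have -> : permute (K:=[:: a; b]) s = [:: tnth [tuple a; b] (s 0); tnth [tuple a; b] (s 1)].
    rewrite /permute /= enum_ordSl /= enum_ordSl /= (_ : enum 'I_0 = [::]) /=; last first.
      by apply/size0nil; rewrite size_enum_ord.
    congr [:: _; _]; first by congr (tnth _ (s _)); apply: val_inj.
    by congr (tnth _ (s _)); apply: val_inj.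
  case: (perm_ord2 s) => ->.
    by rewrite !perm1 odd_perm1 expr0 mul1r.
  by rewrite tpermL tpermR odd_tperm /= expr1 mulN1r /eps; ring.
- case: K => [|a [|b [|c K]]]; try exact: smooth0.
  have -> : affine_Pi [:: a; b] = quad (eps a b) 0 0 0; last exact: smooth_quad.
  apply/funext => w; transitivity (eps a b * (w 0 0 * w 0 0 + w 0 1 * w 0 1)
    + (0 * w 0 0 + 0 * w 0 1) + 0); last by [].
  by rewrite /affine_Pi; ring.
Qed.

Lemma coinduced_exists : exists P : cp1_tensor R, coinduced P.
Proof.
exists (fun=> affine_Pi); split; last exact: quotient_map_related.
split; last by apply/funext => j; apply: schouten_affine_Pi.
split=> [j|i j w]; first exact: multivector_affine_Pi.
exact: transition_related.
Qed.

Lemma coinduced_unique (P Q : cp1_tensor R) : coinduced P -> coinduced Q -> P = Q.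
Proof.
move=> [_ hP] [_ hQ]; apply/funext => j; apply/funext => K; apply/funext => w.
have h : zcoord j (homog j w) != 0.
  by rewrite /zcoord !homogE eqxx eq_complex /= oner_eq0.
have -> : w = quotient_map j (homog j w).
  apply/rowP => k; rewrite quotient_mapE !homogE eqxx !rev_ord2.
  have [->|->] : k = 0 \/ k = 1; last 2 first.
  - by rewrite /=; field.
  - by rewrite /=; field.
  by case: k => [[|[|]]//= hk]; [left|right]; apply: val_inj.
by rewrite hP // hQ.
Qed.

End CoinducedExists.

(* Main.v *)
(* In both affine charts the Poisson structure is |w|^2 d/dx /\ d/dy, and the change of
   charts is w |-> 1/w. The Hamiltonian field of f is |w|^2 (- f_y, f_x), and the
   differential of the field X = (a, b) is 2 (x a + y b) - |w|^2 div X.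

   The classes are detected at the two zeros of the structure: by the value of f in
   degree 0, by div X at the origin of one chart and curl X at both origins in degree 1,
   and by g and its Laplacian at both origins for a bivector g d/dx /\ d/dy.

   That these invariants are complete is proved by averaging over the circle action.
   With th = x d/dy - y d/dx, the operator L f (w) = int_0^1 2 pi t f(e^{2 pi i t} w) dt
   solves th (L f) = f - M f, where M f is the circle average of f; this disposes of the
   parts of zero average. A circle invariant function vanishing at the origin is |w|^2
   times a smooth invariant function, so x h_x + y h_y = l has a smooth invariant
   solution h as soon as l is invariant and l(0) = 0. If l changes sign under w |-> 1/w,
   the solutions found in the two charts differ by a constant on C^*, and therefore can be
   chosen to define a function on the projective line. *)
Require Import Defs.
From HB Require Import structures.
From mathcomp Require Import all_boot all_order all_algebra perm complex.
From mathcomp Require Import generic_quotient ring_quotient.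
From mathcomp Require Import all_classical all_reals all_analysis.
From mathcomp Require Import ring lra.

Set Implicit Arguments.
Unset Strict Implicit.
Unset Printing Implicit Defensive.

Import Order.TTheory GRing.Theory Num.Theory.
Import numFieldNormedType.Exports.

Local Open Scope classical_set_scope.
Local Open Scope ring_scope.

(** * Differential calculus of smooth functions on the plane: mean values, chain rule, symmetry of
    second derivatives *)

Section PlaneCalculus.
Variable R : realType.
Local Notation V := 'rV[R]_2.
Implicit Types (f g : V -> R) (v w : V) (i : 'I_2).

(** The equations decouple in the components [rho] and [tau] of a field along the Euler field and
    along the rotation field. The Hamiltonian field of [f] has [rho] equal to [- r2 * th f] and
    [tau] equal to [r2 * Ed f], so a primitive comes from one angular and one radial equation, and
    the change of charts acts on each component separately. One divergence is enough in degree 1: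
    for a closed field the divergence changes sign under inversion, and its circle average is
    constant, because [r2 * Ed] of half the divergence is a [th]-derivative and averages to zero.
    The analytic obstacle is smoothness of the primitives, in particular across the origin, where
    one divides by [x] or by |w|^2. Every quotient and every average is therefore written as an
    integral over [0,1] of a smooth function composed with a family of linear maps; differentiating
    such an integral gives a sum of integrals of the same kind. Smooth functions are then bundled
    into a commutative ring, so that differential identities become polynomial identities in
    finitely many derivatives. *)

Definition pt (x y : R) : V := \row_(i < 2) if i == 0 then x else y.

Lemma pt0 x y : pt x y 0 0 = x. Proof. by rewrite mxE. Qed.
Lemma pt1 x y : pt x y 0 1 = y. Proof. by rewrite mxE. Qed.

Lemma ord2P i : i = 0 \/ i = 1.
Proof. by case: i => [[|[|]]//= h]; [left|right]; apply: val_inj. Qed.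

Lemma rV2P v w : v 0 0 = w 0 0 -> v 0 1 = w 0 1 -> v = w.
Proof. by move=> h0 h1; apply/rowP => i; have [->|->] := ord2P i. Qed.

Lemma ptE w : pt (w 0 0) (w 0 1) = w.
Proof. by apply: rV2P; rewrite ?pt0 ?pt1. Qed.

Lemma smooth_continuous f : smooth f -> continuous f.
Proof. by move=> /(_ [::]) []. Qed.

Lemma smooth_derivable f x i : smooth f -> derivable f x 'e_i.
Proof. by move=> /(_ [::]) [_]; apply. Qed.

Lemma smooth_partial f i : smooth f -> smooth (partial i f).
Proof.
move=> sf s; have := sf (rcons s i).
by rewrite -cats1 foldr_cat.
Qed.

Arguments smooth_continuous {f} _ x.
Arguments smooth_derivable {f} x i.
Arguments smooth_partial {f} i.

Lemma is_derive_line f w v (t : R) : derivable f (w + t *: v) v ->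
  is_derive t 1 (fun s : R => f (w + s *: v)) ('D_v f (w + t *: v)).
Proof.
move=> df; have E : (fun h : R => h^-1 *: (((fun s : R => f (w + s *: v)) \o shift t) (h *: 1) - f (w + t *: v)))
  = (fun h => h^-1 *: ((f \o shift (w + t *: v)) (h *: v) - f (w + t *: v))).
  apply/funext => h /=; congr (_ *: (f _ - _)).
  by rewrite [h *: 1]mulr1 scalerDl addrCA.
by split; rewrite /derivable /derive E.
Qed.

Lemma MVT_line f i w (s : R) : (forall x, derivable f x 'e_i) ->
  exists2 c : R, `|c| <= `|s| &
    f (w + s *: 'e_i) - f w = partial i f (w + c *: 'e_i) * s.
Proof.
move=> sf.
have D (t : R) : is_derive t 1 (fun s : R => f (w + s *: 'e_i)) (partial i f (w + t *: 'e_i)).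
  exact: is_derive_line.
have C : continuous (fun s : R => f (w + s *: 'e_i)).
  move=> t; apply/differentiable_continuous/derivable1_diffP.
  exact: (@ex_derive _ _ _ _ _ _ _ (D t)).
have [s0|/ltW s0] := leP 0 s.
  have [|c + E] := @MVT_segment R _ _ 0 s s0 (fun x _ => D x).
    exact: continuous_subspaceT.
  rewrite in_itv/= => /andP[c0 cs]; exists c; first by rewrite !ger0_norm.
  by move: E; rewrite scale0r addr0 subr0.
have [|c + E] := @MVT_segment R _ _ s 0 s0 (fun x _ => D x).
  exact: continuous_subspaceT.
rewrite in_itv/= => /andP[c0 cs]; exists c.
  by rewrite !ler0_norm // lerN2.
by move: E; rewrite scale0r addr0 sub0r mulrN => /(congr1 -%R); rewrite opprB opprK.
Qed.

Lemma rV2_norm_lt w (e : R) : 0 < e -> `|w 0 0| < e -> `|w 0 1| < e -> `|w| < e.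
Proof.
move=> e0 h0 h1; rewrite [`|w|]mx_normrE; apply/bigmax_ltP; split => //.
by move=> [i j] _ /=; rewrite (ord1 i); have [->|->] := ord2P j.
Qed.

Lemma coord_norm_le w i : `|w 0 i| <= `|w|.
Proof.
rewrite [`|w|]mx_normrE.
by apply: (@le_bigmax _ R _ 0 (fun ij : 'I_1 * 'I_2 => `|w ij.1 ij.2|) (ord0, i)).
Qed.

(** Joining [w] to [w'] by a horizontal and then a vertical segment, the mean value theorem on each
    gives the coefficients as partial derivatives at intermediate points. These points tend to [w],
    and the partial derivatives are continuous. *)
Lemma caratheodory f w : smooth f -> exists A : 'I_2 -> V -> R,
  (forall w', f w' - f w = A 0 w' * (w' 0 0 - w 0 0) + A 1 w' * (w' 0 1 - w 0 1)) /\
  (forall i, A i w' @[w' --> w] --> partial i f w).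
Proof.
move=> sf.
have H w' : exists pq : V * V,
   [/\ f w' - f w = partial 0 f pq.1 * (w' 0 0 - w 0 0) + partial 1 f pq.2 * (w' 0 1 - w 0 1),
     forall i, `|pq.1 0 i - w 0 i| <= `|w' - w| & forall i, `|pq.2 0 i - w 0 i| <= `|w' - w|].
  pose u := w + (w' 0 0 - w 0 0) *: 'e_0.
  have [c cs Ec] := MVT_line w (w' 0 0 - w 0 0) (fun x => smooth_derivable x 0 sf).
  have [d ds Ed] := MVT_line u (w' 0 1 - w 0 1) (fun x => smooth_derivable x 1 sf).
  have Eu : u + (w' 0 1 - w 0 1) *: 'e_1 = w'.
    by apply: rV2P; rewrite /u !mxE /=; ring.
  have n0 : `|w' 0 0 - w 0 0| <= `|w' - w|.
    by have := coord_norm_le (w' - w) 0; rewrite !mxE.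
  have n1 : `|w' 0 1 - w 0 1| <= `|w' - w|.
    by have := coord_norm_le (w' - w) 1; rewrite !mxE.
  exists (w + c *: 'e_0, u + d *: 'e_1); split => /=.
  - rewrite -Ec -Ed Eu; ring.
  - move=> i; have [->|->] := ord2P i; rewrite !mxE /= ?mulr1 ?mulr0 [w _ _ + _]addrC addrK.
      exact: le_trans n0.
    by rewrite normr0.
  - move=> i; have [->|->] := ord2P i; rewrite /u !mxE /= ?mulr1 ?mulr0 ?addr0 [w _ _ + _]addrC addrK //.
    exact: le_trans n1.
have [pq /all_and3[E b0 b1]] := choice H.
exists (fun i w' => partial i f (if i == 0 then (pq w').1 else (pq w').2)); split => //.
move=> i; have cf := smooth_continuous (smooth_partial i sf) w.
suff cpq : (if i == 0 then (pq w').1 else (pq w').2) @[w' --> w] --> w.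
  exact: (cvg_comp _ (partial i f) cpq cf).
apply/(@cvgrPdist_lt _ _ _ _ (nbhs_filter w)) => e e0.
have Hn : \forall w' \near w, `|w' - w| < e.
  by apply/nbhs_ballP; exists e => //= w'; rewrite -ball_normE /= distrC.
near=> w'; have h : `|w' - w| < e by near: w'.
apply: rV2_norm_lt => //; rewrite !mxE distrC; (apply: le_lt_trans h);
  by case: ifP => _; rewrite ?b0 ?b1.
Unshelve. all: by end_near. Qed.

Lemma is_derive_curve f (g h : R -> R) (t dg dh : R) : smooth f ->
  is_derive t 1 g dg -> is_derive t 1 h dh ->
  is_derive t 1 (fun s : R => f (pt (g s) (h s)))
    (partial 0 f (pt (g t) (h t)) * dg + partial 1 f (pt (g t) (h t)) * dh).
Proof.
move=> sf [dg1 dg2] [dh1 dh2].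
have [A [E cA]] := caratheodory (pt (g t) (h t)) sf.
have cg : {for t, continuous g} by apply: differentiable_continuous; apply/derivable1_diffP.
have ch : {for t, continuous h} by apply: differentiable_continuous; apply/derivable1_diffP.
have cp : pt (g s) (h s) @[s --> t] --> pt (g t) (h t).
  apply/cvgrPdist_lt => e e0; near=> s; apply: rV2_norm_lt => //.
    by rewrite !mxE /=; near: s; move/cvgrPdist_lt : cg; exact.
  by rewrite !mxE /=; near: s; move/cvgrPdist_lt : ch; exact.
have cA' i : A i (pt (g (s + t)) (h (s + t))) @[s --> 0^'] --> partial i f (pt (g t) (h t)).
  apply: cvg_comp (cA i); apply: cvg_comp cp.
  apply: cvg_trans (_ : s + t @[s --> (0:R)] --> t); first exact: cvg_app (@nbhs_dnbhs _ _).
  by rewrite -[X in _ --> X]add0r; apply: cvgD; [exact: cvg_id | exact: cvg_cst].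
have H : (fun s : R => s^-1 *: (((fun s : R => f (pt (g s) (h s))) \o shift t) (s *: 1) - f (pt (g t) (h t)))) @ 0^' -->
  partial 0 f (pt (g t) (h t)) * dg + partial 1 f (pt (g t) (h t)) * dh.
  have -> : (fun s : R => s^-1 *: (((fun s : R => f (pt (g s) (h s))) \o shift t) (s *: 1) - f (pt (g t) (h t)))) =
   (fun s : R => A 0 (pt (g (s + t)) (h (s + t))) * (s^-1 *: ((g \o shift t) (s *: 1) - g t)) +
     A 1 (pt (g (s + t)) (h (s + t))) * (s^-1 *: ((h \o shift t) (s *: 1) - h t))).
    apply/funext => s /=; rewrite [s *: 1]mulr1 E !pt0 !pt1 /GRing.scale /=; ring.
  apply: cvgD; (apply: cvgM; first exact: cA').
    by rewrite -dg2; exact: dg1.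
  by rewrite -dh2; exact: dh1.
by split; [exact: cvgP H | exact: (cvg_lim _ H)].
Unshelve. all: by end_near. Qed.

Lemma is_derive_translate f x u v : derivable f (x + u) v ->
  is_derive x v (fun y => f (y + u)) ('D_v f (x + u)).
Proof.
move=> df; have E : (fun h : R => h^-1 *: (((fun y => f (y + u)) \o shift x) (h *: v) - f (x + u)))
  = (fun h => h^-1 *: ((f \o shift (x + u)) (h *: v) - f (x + u))).
  by apply/funext => h /=; rewrite addrA.
by split; rewrite /derivable /derive E.
Qed.

(* Exchanging [i] and [j] does not change the left-hand side, whence Schwarz' theorem. *)
Lemma second_difference f w i j (h : R) : smooth f ->
  exists2 p, `|p - w| <= `|h| *+ 2 &
    f (w + h *: 'e_i + h *: 'e_j) - f (w + h *: 'e_i) - (f (w + h *: 'e_j) - f w)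
    = partial j (partial i f) p * h * h.
Proof.
(* The double difference is the increment of [G] along ['e_i]; the mean value theorem is applied to
   [G], then to [partial i f] along ['e_j]. *)
move=> sf; pose G : V -> R := (fun v => f (v + h *: 'e_j)) - f.
have dG x : is_derive x 'e_i G (partial i f (x + h *: 'e_j) - partial i f x).
  apply: is_deriveB; first exact/is_derive_translate/smooth_derivable.
  exact/derivableP/smooth_derivable.
have [c ch Ec] := MVT_line w h (fun x => @ex_derive _ _ _ _ _ _ _ (dG x)).
have [d dh Ed] := MVT_line (w + c *: 'e_i) h
  (fun x => smooth_derivable x j (smooth_partial i sf)).
exists (w + c *: 'e_i + d *: 'e_j).
  have n1 k : `|'e_k : V| <= 1.
    rewrite [leLHS]mx_normrE; apply/bigmax_leP; split => // -[a b] _ /=.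
    by rewrite !mxE; case: (_ && _); rewrite ?normr1 ?normr0.
  rewrite -[w + _ + _]addrA [w + _]addrC addrK (le_trans (ler_normD _ _)) // !normrZ mulr2n.
  by apply: lerD; rewrite -[leRHS]mulr1 ler_pM.
rewrite -Ed; transitivity (G (w + h *: 'e_i) - G w) => //.
by rewrite Ec /partial (@derive_val _ _ _ _ _ _ _ (dG _)).
Qed.

Lemma dist_lt_half (a b c e : R) :
  `|a - c| < e / 2 -> `|b - c| < e / 2 -> `|a - b| <= e.
Proof.
move=> h1 h2; have -> : a - b = (a - c) - (b - c) by ring.
by have := ler_normB (a - c) (b - c); lra.
Qed.

Lemma second_difference_sym (a b c d h P Q : R) : h != 0 ->
  a - b - (c - d) = P * h * h -> a - c - (b - d) = Q * h * h -> P = Q.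
Proof.
move=> h0 E1 E2; have hh : h * h != 0 by rewrite mulf_neq0.
by apply: (mulIf hh); rewrite !mulrA -E1 -E2; ring.
Qed.

Lemma schwarz f w : smooth f ->
  partial 1 (partial 0 f) w = partial 0 (partial 1 f) w.
Proof.
move=> sf; apply/eqP; rewrite -subr_eq0 -normr_le0; apply/ler_addgt0Pl => e e0; rewrite addr0.
have c10 := smooth_continuous (smooth_partial 1 (smooth_partial 0 sf)) w.
have c01 := smooth_continuous (smooth_partial 0 (smooth_partial 1 sf)) w.
have e2 : 0 < e / 2 by rewrite divr_gt0.
have /nbhs_ballP[d1 /= d10 H1] := iffLR (@cvgrPdist_lt _ _ _ _ (nbhs_filter w) _ _) c10 _ e2.
have /nbhs_ballP[d2 /= d20 H2] := iffLR (@cvgrPdist_lt _ _ _ _ (nbhs_filter w) _ _) c01 _ e2.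
(* A single step [h] serves both orders of differentiation, so that both intermediate points fall
   where the mixed derivatives are within e/2 of their values at [w]. *)
have [h h0 [hb1 hb2]] : exists2 h : R, 0 < h & `|h| *+ 2 < d1 /\ `|h| *+ 2 < d2.
  have m0 : 0 < Num.min d1 d2 by rewrite lt_min d10.
  have h0 : 0 < Num.min d1 d2 / 4 by rewrite divr_gt0.
  exists (Num.min d1 d2 / 4) => //; rewrite gtr0_norm //.
  by rewrite mulr2n; split; case: (leP d1 d2) m0 h0 => *; lra.
have [p pw Ep] := second_difference w 0 1 h sf.
have [q qw Eq] := second_difference w 1 0 h sf.
have pq : partial 1 (partial 0 f) p = partial 0 (partial 1 f) q.
  rewrite [w + h *: 'e_1 + _]addrAC in Eq.
  exact: second_difference_sym (lt0r_neq0 h0) Ep Eq.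
have /H1 B1 : ball w d1 p.
  by rewrite -ball_normE /= distrC (le_lt_trans pw).
have /H2 B2 : ball w d2 q.
  by rewrite -ball_normE /= distrC (le_lt_trans qw).
exact: dist_lt_half B1 (eq_ind_r (fun c => `|_ - c| < e / 2) B2 pq).
Qed.
End PlaneCalculus.

(** * Integrals of continuous functions over the unit interval *)

Section UnitIntegral.
Variable R : realType.
Local Notation mu := (@lebesgue_measure R).
Implicit Types F G : R -> R.

Definition int01 F : R := \int[mu]_(t in `[0, 1]) F t.

Lemma continuous_integrable01 F : continuous F -> mu.-integrable `[0, 1] (EFin \o F).
Proof.
move=> cF; apply: continuous_compact_integrable; first exact: segment_compact.
exact: continuous_subspaceT.
Qed.

Lemma int01D F G : continuous F -> continuous G ->
  int01 (fun t => F t + G t) = int01 F + int01 G.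
Proof. by move=> cF cG; apply: RintegralD => //; exact: continuous_integrable01. Qed.

Lemma int01B F G : continuous F -> continuous G ->
  int01 (fun t => F t - G t) = int01 F - int01 G.
Proof. by move=> cF cG; apply: RintegralB => //; exact: continuous_integrable01. Qed.

Lemma int01Z a F : continuous F -> int01 (fun t => a * F t) = a * int01 F.
Proof. by move=> cF; apply: RintegralZl => //; exact: continuous_integrable01. Qed.

Lemma int01_cst a : int01 (fun=> a) = a.
Proof.
rewrite /int01 Rintegral_cst //= lebesgue_measure_itv /= lte_fin ltr01.
by rewrite oppr0 adde0 mulr1.
Qed.

Lemma int01_norm_le F (e : R) : continuous F ->
  (forall t, 0 <= t <= 1 -> `|F t| <= e) -> `|int01 F| <= e.
Proof.
move=> cF Fe; apply: le_trans (le_normr_Rintegral _ (continuous_integrable01 cF)) _ => //.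
rewrite -[leRHS](int01_cst e); apply: le_Rintegral => //.
- by apply: continuous_integrable01 => t; apply: cvg_norm; exact: cF.
- by apply: continuous_integrable01; exact: cst_continuous.
Qed.

Lemma int01_FTC (F f : R -> R) : continuous f -> (forall t : R, is_derive t 1 F (f t)) ->
  int01 f = F 1 - F 0.
Proof.
move=> cf dF; have cF : continuous F.
  move=> t; apply: differentiable_continuous; apply/derivable1_diffP.
  exact: (@ex_derive _ _ _ _ _ _ _ (dF t)).
rewrite /int01 /Rintegral (@continuous_FTC2 R f F 0 1) //.
- exact: continuous_subspaceT.
- split => [t _||].
  + exact: (@ex_derive _ _ _ _ _ _ _ (dF t)).
  + exact/cvg_at_right_filter/cF.
  + exact/cvg_at_left_filter/cF.
- by move=> t _; rewrite derive1E (@derive_val _ _ _ _ _ _ _ (dF t)).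
Qed.

End UnitIntegral.

(** * Integrals along a family of linear maps: continuity *)

Section LinearFamily.
Variable R : realType.
Local Notation V := 'rV[R]_2.

Lemma pt_continuous (T : topologicalType) (a b : T -> R) (z : T) :
  {for z, continuous a} -> {for z, continuous b} ->
  {for z, continuous (fun z => pt (a z) (b z))}.
Proof.
move=> ca cb; apply/(@cvgrPdist_lt _ _ _ _ (nbhs_filter z)) => e e0.
have /(@cvgrPdist_lt _ _ _ _ (nbhs_filter z)) Ha := ca.
have /(@cvgrPdist_lt _ _ _ _ (nbhs_filter z)) Hb := cb.
near=> s; apply: rV2_norm_lt => //; rewrite !mxE /=; near: s; [exact: Ha | exact: Hb].
Unshelve. all: by end_near. Qed.

Variables p A B C D : R -> R.
Hypotheses (cp : continuous p) (cA : continuous A) (cB : continuous B)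
  (cC : continuous C) (cD : continuous D).

(** Dilations, rotations and the horizontal stretch are all of this shape. Since M(t) is linear in
    [w], differentiating f(M(t) w) only multiplies the weight by an entry of M(t). *)
Definition linfam (w : V) (t : R) : V :=
  pt (A t * w 0 0 + B t * w 0 1) (C t * w 0 0 + D t * w 0 1).

Let Phi (f : V -> R) (w : V) (t : R) : R := p t * f (linfam w t).

(* [linint p A B C D f w] is the integral over [0,1] of [p(t) f(M(t) w)] where
   [M(t)] has rows [(A(t), B(t))] and [(C(t), D(t))]. *)
Definition linint (f : V -> R) (w : V) : R := int01 (Phi f w).

Lemma linfam_continuous2 : continuous (fun wt : V * R => linfam wt.1 wt.2).
Proof.
have c2 (F : R -> R) : continuous F -> continuous (fun wt : V * R => F wt.2).
  move=> cF wt; apply: (@cvg_comp _ _ _ snd F); [exact: cvg_snd | exact: cF].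
have cc i : continuous (fun wt : V * R => wt.1 0 i).
  move=> wt; apply: (@cvg_comp _ _ _ fst (fun w : V => w 0 i)); first exact: cvg_fst.
  exact: coord_continuous.
move=> wt; apply: (@pt_continuous _
  (fun wt : V * R => A wt.2 * wt.1 0 0 + B wt.2 * wt.1 0 1)
  (fun wt : V * R => C wt.2 * wt.1 0 0 + D wt.2 * wt.1 0 1));
  by apply: cvgD; apply: cvgM; (apply: c2 || apply: cc).
Qed.

Lemma Phi_continuous2 f : continuous f -> continuous (fun wt : V * R => Phi f wt.1 wt.2).
Proof.
move=> cf wt; apply: cvgM.
  by apply: (@cvg_comp _ _ _ snd p); [exact: cvg_snd | exact: cp].
by apply: (@cvg_comp _ _ _ (fun wt : V * R => linfam wt.1 wt.2) f);
  [exact: linfam_continuous2 | exact: cf].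
Qed.

Lemma Phi_continuous f w : continuous f -> continuous (Phi f w).
Proof.
move=> cf t; have c : (w, s) @[s --> t] --> (w, t).
  by apply: (@cvg_pair _ _ _ (nbhs t) (nbhs w) (nbhs t) _ _ _ (fun=> w) id); [exact: cvg_cst | exact: cvg_id].
exact: (cvg_comp _ (fun wt : V * R => Phi f wt.1 wt.2) c (@Phi_continuous2 f cf (w, t))).
Qed.

(** Tube lemma: around each [(w, t)] joint continuity gives a product neighbourhood on which [Phi]
    stays within e/2 of its value there, and compactness of [0,1] makes the neighbourhood of [w]
    independent of [t]. *)
Lemma Phi_unif (f : V -> R) (w : V) (e : R) : continuous f -> 0 < e ->
  \forall w' \near w, forall t, 0 <= t <= 1 -> `|Phi f w t - Phi f w' t| < e.
Proof.
move=> cf e0; have e2 : 0 < e / 2 by rewrite divr_gt0.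
have /compact_near_coveringP K : compact `[(0:R), 1] by exact: segment_compact.
have := K V (nbhs w) (fun w' t => `|Phi f w t - Phi f w' t| < e) (nbhs_filter w).
move=> H; have {}H : \forall w' \near w, `[(0:R), 1] `<=` (fun t => `|Phi f w t - Phi f w' t| < e).
  apply: H => t _.
  have := @Phi_continuous2 f cf (w, t).
  move=> /(@cvgrPdist_lt _ _ _ _ (nbhs_filter (w, t))) /(_ _ e2) [[U W] /= [wU tW] UW].
  exists (W, U) => //= -[t' w'] [/= Wt' Uw'].
  have h1 := UW (w', t') (conj Uw' Wt').
  have h2 := UW (w, t') (conj (nbhs_singleton wU) Wt').
  move: h1 h2 => /=; move: (Phi f w t) (Phi f w' t') (Phi f w t') => a b c h1 h2.
  have -> : c - b = (a - b) - (a - c) by ring.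
  by have := ler_normB (a - b) (a - c); lra.
near=> w'; move=> t t01.
have h : `[(0:R), 1] `<=` (fun t => `|Phi f w t - Phi f w' t| < e) by near: w'; exact: H.
by apply: h; rewrite /= in_itv.
Unshelve. all: by end_near. Qed.

Lemma linint_continuous f : continuous f -> continuous (linint f).
Proof.
move=> cf w; apply/(@cvgrPdist_le _ _ _ _ (nbhs_filter w)) => e e0.
have H := Phi_unif w cf e0.
near=> w'; have Hw : forall t, 0 <= t <= 1 -> `|Phi f w t - Phi f w' t| < e by near: w'.
rewrite -int01B; [|exact: Phi_continuous..].
apply: int01_norm_le => [t|t /Hw /ltW //].
by apply: cvgB; exact: Phi_continuous.
Unshelve. all: by end_near. Qed.

End LinearFamily.

(** * Integrals along a family of linear maps: differentiation under the integral *)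

Section LinearIntegralDerivative.
Variable R : realType.
Local Notation V := 'rV[R]_2.
Local Notation mu := (@lebesgue_measure R).

Lemma is_derive_of_line (f : V -> R) (w v : V) (l : R) :
  is_derive (0 : R) 1 (fun s : R => f (w + s *: v)) l -> is_derive w v f l.
Proof.
have E : (fun h : R => h^-1 *: (((fun s : R => f (w + s *: v)) \o shift 0) (h *: 1) - f (w + 0 *: v)))
  = (fun h => h^-1 *: ((f \o shift w) (h *: v) - f w)).
  by apply/funext => h /=; rewrite [h *: 1]mulr1 scale0r !addr0 [h *: v + w]addrC.
by case; rewrite /derivable /derive E => h1 h2; split.
Qed.

Lemma norm_perturb (a b c e : R) : `|a - b| < 2^-1 -> `|c - e| < 2^-1 ->
  `|b + e| <= `|a + c| + 1.
Proof.
move=> h0 h1; have -> : b + e = (a + c) - ((a - b) + (c - e)) by ring.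
have := ler_normB (a + c) ((a - b) + (c - e)); have := ler_normD (a - b) (c - e).
by lra.
Qed.

Lemma is_derive_affine (a b t : R) : is_derive t 1 (fun s : R => a + s * b) b.
Proof.
have h := is_deriveD (is_derive_cst a t (1 : R)) (is_deriveZ b (is_derive_id t (1 : R))).
have -> : (fun s : R => a + s * b) = cst a + b \*: (id : R -> R).
  by apply/funext => s; rewrite mulrC.
by apply: is_derive_eq h _; rewrite add0r [b *: 1]mulr1.
Qed.

Variables p A B C D : R -> R.
Hypotheses (cp : continuous p) (cA : continuous A) (cB : continuous B)
  (cC : continuous C) (cD : continuous D).

Local Notation I p := (linint p A B C D).
Let A_ (i : 'I_2) : R -> R := if i == 0 then A else B.
Let C_ (i : 'I_2) : R -> R := if i == 0 then C else D.

Lemma mulfun_continuous (F G : R -> R) :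
  continuous F -> continuous G -> continuous (fun t => F t * G t).
Proof. by move=> cF cG t; apply: cvgM; [exact: cF | exact: cG]. Qed.

Lemma is_derive_linint (f : V -> R) (w : V) (i : 'I_2) : smooth f ->
  is_derive w 'e_i (I p f)
    (I (fun t => p t * A_ i t) (partial 0 f) w + I (fun t => p t * C_ i t) (partial 1 f) w).
Proof.
move=> sf.
have cAi : continuous (A_ i) by rewrite /A_; case: ifP.
have cCi : continuous (C_ i) by rewrite /C_; case: ifP.
have cf := smooth_continuous sf.
have c0 := smooth_continuous (smooth_partial 0 sf).
have c1 := smooth_continuous (smooth_partial 1 sf).
pose q0 t := p t * A_ i t; pose q1 t := p t * C_ i t.
have cq0 : continuous q0 by exact: mulfun_continuous.
have cq1 : continuous q1 by exact: mulfun_continuous.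
pose Psi (w : V) t := q0 t * partial 0 f (linfam A B C D w t) + q1 t * partial 1 f (linfam A B C D w t).
have dPhi (s t : R) : is_derive s 1 (fun s : R => p t * f (linfam A B C D (w + s *: 'e_i) t))
    (Psi (w + s *: 'e_i) t).
  have Epath (s' : R) : linfam A B C D (w + s' *: 'e_i) t =
      pt ((A t * w 0 0 + B t * w 0 1) + s' * A_ i t) ((C t * w 0 0 + D t * w 0 1) + s' * C_ i t).
    apply: rV2P; rewrite /linfam ?pt0 ?pt1 /A_ /C_ !mxE;
    by have [->|->] := ord2P i; rewrite /=; ring.
  have := is_deriveZ (p t) (is_derive_curve (t := s) sf
    (is_derive_affine (A t * w 0 0 + B t * w 0 1) (A_ i t) s)
    (is_derive_affine (C t * w 0 0 + D t * w 0 1) (C_ i t) s)).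
  move=> h; have -> : (fun s : R => p t * f (linfam A B C D (w + s *: 'e_i) t)) =
    p t \*: (fun s' => f (pt ((A t * w 0 0 + B t * w 0 1) + s' * A_ i t) ((C t * w 0 0 + D t * w 0 1) + s' * C_ i t))).
    by apply/funext => s'; rewrite Epath.
  apply: is_derive_eq h _; rewrite -Epath /Psi /q0 /q1 /GRing.scale /=; ring.
have cPsi w' : continuous (Psi w').
  by move=> t; apply: cvgD; apply: Phi_continuous.
apply: is_derive_of_line.
(* The dominating function required for differentiating under the integral: each of the two summands
   of [Psi] moves by less than 1/2 near [w], whence the bound [|Psi w t| + 1]. *)
have [d d0 Hd] : exists2 d : R, 0 < d & forall s, -d < s < d -> forall t, 0 <= t <= 1 ->
     `|Psi (w + s *: 'e_i) t| <= `|Psi w t| + 1.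
  have h2 : 0 < (2^-1 : R) by rewrite invr_gt0.
  have U0 := Phi_unif cq0 cA cB cC cD w c0 h2.
  have U1 := Phi_unif cq1 cA cB cC cD w c1 h2.
  have : \forall w' \near w, forall t, 0 <= t <= 1 -> `|Psi w' t| <= `|Psi w t| + 1.
    apply: filterS2 U0 U1 => w' h0 h1 t t01.
    move: (h0 t t01) (h1 t t01); rewrite /Psi.
    move: (q0 t * _) (q0 t * _) (q1 t * _) (q1 t * _) => a b c e ha hc.
    exact: norm_perturb.
  move=> /nbhs_ballP[d /= d0 Hd]; exists d => // s sd t t01; apply: Hd => //.
  rewrite -ball_normE /= opprD addrA subrr add0r normrN normrZ.
  have n1 : `|'e_i : V| <= 1.
    rewrite [leLHS]mx_normrE; apply/bigmax_leP; split => // -[a b] _ /=.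
    by rewrite !mxE; case: (_ && _); rewrite ?normr1 ?normr0.
  apply: le_lt_trans (_ : `|s| < d); last by rewrite ltr_norml.
  by rewrite -[leRHS]mulr1 ler_wpM2l.
pose ff (s t : R) : R := p t * f (linfam A B C D (w + s *: 'e_i) t).
have E1 s t : partial1of2 ff s t = Psi (w + s *: 'e_i) t.
  by rewrite partial1of2E (@derive_val _ _ _ _ _ _ _ (dPhi s t)).
have [m01 cff intG] : [/\ measurable `[(0:R), 1], forall s, mu.-integrable `[0,1] (EFin \o ff s)
   & mu.-integrable `[0, 1] (EFin \o (fun t => `|Psi w t| + 1))].
  split => // [s|]; apply: continuous_integrable01; first exact: Phi_continuous.
  by move=> t; apply: cvgD; [apply: cvg_norm; exact: cPsi | exact: cvg_cst].
have Ia : `]-d, d[%classic (0 : R) by rewrite /= in_itv /= oppr_lt0 d0.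
have dff x y : `]-d, d[%classic x -> `[0, 1]%classic y -> derivable (ff ^~ y) x 1.
  by move=> _ _; exact: (@ex_derive _ _ _ _ _ _ _ (dPhi x y)).
have G0 y : 0 <= `|Psi w y| + 1 by rewrite addr_ge0.
have ub x y : `]-d, d[%classic x -> `[0, 1]%classic y -> `|partial1of2 ff x y| <= `|Psi w y| + 1.
  by rewrite /= !in_itv /= => xd y01; rewrite E1 Hd.
have h1 := @derivable_under_integral _ _ _ mu ff _ m01 0 (- d) d Ia (fun x _ => cff x) dff _ G0 intG ub.
have h2 := @differentiation_under_integral _ _ _ mu ff _ m01 0 (- d) d Ia (fun x _ => cff x) dff _ G0 intG ub.
split; first exact: h1.
rewrite -derive1E; apply: etrans h2 _.
rewrite /linint -int01D; [|exact: Phi_continuous..].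
by congr int01; apply/funext => t; rewrite E1 scale0r addr0.
Qed.

End LinearIntegralDerivative.

(** * The commutative ring of smooth functions on the plane *)

Section SmoothRing.
Variable R : realType.
Local Notation V := 'rV[R]_2.
Implicit Types (f g : V -> R).

(* Every member is continuous and derivable, with partial derivatives in the closure
   again; hence all members are smooth. *)
Inductive smooth_closure : (V -> R) -> Prop :=
| smooth_closure_base f : smooth f -> smooth_closure f
| smooth_closure_cst (c : R) : smooth_closure (cst c)
| smooth_closure_coord i : smooth_closure (fun w => w 0 i)
| smooth_closureD f g : smooth_closure f -> smooth_closure g -> smooth_closure (f + g)
| smooth_closureM f g : smooth_closure f -> smooth_closure g -> smooth_closure (f * g)
| smooth_closureV f : (forall w, f w != 0) -> smooth_closure f ->
    smooth_closure (fun w => (f w)^-1)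
| smooth_closure_linint p A B C D f : continuous p -> continuous A -> continuous B ->
    continuous C -> continuous D -> smooth f -> smooth_closure (linint p A B C D f).

Lemma smooth_closure_smooth f : smooth_closure f -> smooth f.
Proof.
suff H f' : smooth_closure f' -> continuous f' /\
     forall i, smooth_closure (partial i f') /\ forall x, derivable f' x 'e_i.
  exact: smooth_stable H f.
elim=> {f'}.
- move=> f' sf; split; first exact: smooth_continuous.
  move=> i; split; last by move=> x; exact: smooth_derivable.
  exact/smooth_closure_base/smooth_partial.
- move=> c; split=> [x|i]; first exact: cst_continuous.
  split=> [|x]; last exact: derivable_cst.
  have -> : partial i (cst c : V -> R) = cst 0.
    by apply/funext => x; exact: derive_cst.
  exact: smooth_closure_cst.
- move=> j; split=> [x|i]; first exact: coord_continuous.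
  split=> [|x]; last exact: (@ex_derive _ _ _ _ _ _ _ (is_derive_coord j x _)).
  have -> : partial i (fun w : V => w 0 j : R) = cst (('e_i : V) 0 j).
    by apply/funext => x; exact: (@derive_val _ _ _ _ _ _ _ (is_derive_coord j x _)).
  exact: smooth_closure_cst.
- move=> f' g' sf [cf df] sg [cg dg]; split=> [x|i].
    by apply: continuousD; [exact: cf | exact: cg].
  have [pf df'] := df i; have [pg dg'] := dg i.
  split=> [|x]; last exact: derivableD.
  have -> : partial i (f' + g') = partial i f' + partial i g'.
    by apply/funext => x; rewrite /partial deriveD.
  exact: smooth_closureD.
- move=> f' g' sf [cf df] sg [cg dg]; split=> [x|i].
    by apply: continuousM; [exact: cf | exact: cg].
  have [pf df'] := df i; have [pg dg'] := dg i.
  split=> [|x]; last exact: derivableM.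
  have -> : partial i (f' * g') = f' * partial i g' + g' * partial i f'.
    by apply/funext => x; rewrite /partial deriveM.
  by apply: smooth_closureD; apply: smooth_closureM.
- move=> f' f0 sf [cf df]; split=> [x|i].
    by apply: continuousV => //; exact: cf.
  have [pf df'] := df i.
  split=> [|x]; last exact: derivableV.
  have -> : partial i (fun w => (f' w)^-1) =
     cst (-1) * ((fun w => (f' w)^-1) * (fun w => (f' w)^-1) * partial i f').
    apply/funext => x; rewrite /partial deriveV //.
    transitivity (-1 * ((f' x)^-1 * (f' x)^-1 * 'D_'e_i f' x)); last by [].
    by rewrite mulN1r -mulNr -expr2 exprVn.
  have sV := smooth_closureV f0 sf.
  by apply: smooth_closureM (smooth_closure_cst _) _; do ! apply: smooth_closureM.
- move=> p A B C D f' cp cA cB cC cD sf; split=> [|i].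
    by apply: linint_continuous => //; exact: smooth_continuous.
  have dI x := is_derive_linint cp cA cB cC cD x i sf.
  split=> [|x]; last exact: (@ex_derive _ _ _ _ _ _ _ (dI x)).
  rewrite (_ : partial i _ = linint (fun t => p t * (if i == 0 then A else B) t) A B C D (partial 0 f')
    + linint (fun t => p t * (if i == 0 then C else D) t) A B C D (partial 1 f')); last first.
    by apply/funext => x; exact: (@derive_val _ _ _ _ _ _ _ (dI x)).
  have cAB : continuous (if i == 0 then A else B) by case: ifP.
  have cCD : continuous (if i == 0 then C else D) by case: ifP.
  by apply: smooth_closureD; apply: smooth_closure_linint => //;
    (exact: mulfun_continuous || exact: smooth_partial).
Qed.

Definition smooth_fun : {pred V -> R} := fun f => `[< smooth f >].

Lemma smooth_funP f : reflect (smooth f) (f \in smooth_fun).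
Proof. exact: asboolP. Qed.

Lemma smooth_cst (c : R) : smooth (cst c : V -> R).
Proof. exact/smooth_closure_smooth/smooth_closure_cst. Qed.

Lemma smooth_coord i : smooth (fun w : V => w 0 i : R).
Proof. exact/smooth_closure_smooth/smooth_closure_coord. Qed.

Lemma smooth_fun_subring : subring_closed smooth_fun.
Proof.
split=> [|f g /smooth_funP sf /smooth_funP sg|f g /smooth_funP sf /smooth_funP sg];
  apply/smooth_funP.
- exact: smooth_cst.
- have := smooth_lin (-1) sg sf; rewrite scaleN1r addrC //.
- by apply/smooth_closure_smooth/smooth_closureM; exact: smooth_closure_base.
Qed.

HB.instance Definition _ := GRing.isSubringClosed.Build (V -> R) smooth_fun smooth_fun_subring.

(** Bundling makes products and sums of smooth functions ring operations: once the derivatives are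
    expanded by the Leibniz rule, identities between differential expressions are left to [ring]. *)
Definition SF : Type := {f : V -> R | f \in smooth_fun}.

HB.instance Definition _ := SubChoice.on SF.
HB.instance Definition _ := [SubChoice_isSubComNzRing of SF by <:].

End SmoothRing.

(** * Evaluation, partial derivatives and the basic functions of the ring *)

Section SmoothRingTheory.
Variable R : realType.
Local Notation V := 'rV[R]_2.
Local Notation SF := (SF R).
Implicit Types (f g h : SF) (w : V) (i : 'I_2).

Definition ev f w : R := (val f : V -> R) w.

Definition mkSF (F : V -> R) (sF : smooth F) : SF := Sub F (introT (smooth_funP F) sF).

Lemma ev_mk F sF w : ev (@mkSF F sF) w = F w. Proof. by []. Qed.

Lemma ev_smooth f : smooth (ev f). Proof. exact: elimT (smooth_funP _) (valP f). Qed.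

Lemma SFext f g : (forall w, ev f w = ev g w) -> f = g.
Proof. by move=> fg; apply: val_inj; apply/funext. Qed.

Lemma ev_continuous f : continuous (ev f).
Proof. exact/smooth_continuous/ev_smooth. Qed.

Lemma evD f g w : ev (f + g) w = ev f w + ev g w. Proof. by []. Qed.
Lemma evM f g w : ev (f * g) w = ev f w * ev g w. Proof. by []. Qed.
Lemma evN f w : ev (- f) w = - ev f w. Proof. by []. Qed.
Lemma ev0 w : ev 0 w = 0. Proof. by []. Qed.
Lemma ev1 w : ev 1 w = 1. Proof. by []. Qed.
Lemma evMn f n w : ev (f *+ n) w = ev f w *+ n.
Proof. by elim: n => // n IH; rewrite !mulrS evD IH. Qed.

Definition sc (c : R) : SF := mkSF (smooth_cst c).
Definition coord_x : SF := mkSF (smooth_coord R 0).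
Definition coord_y : SF := mkSF (smooth_coord R 1).
Local Notation xx := coord_x.
Local Notation yy := coord_y.

Lemma ev_sc c w : ev (sc c) w = c. Proof. by []. Qed.
Lemma ev_xx w : ev xx w = w 0 0. Proof. by []. Qed.
Lemma ev_yy w : ev yy w = w 0 1. Proof. by []. Qed.

Definition evE := (evD, evM, evN, ev0, ev1, evMn, ev_sc, ev_xx, ev_yy).

Lemma sc0 : sc 0 = 0. Proof. exact: SFext. Qed.
Lemma sc1 : sc 1 = 1. Proof. exact: SFext. Qed.

Definition dd i f : SF := mkSF (smooth_partial i (ev_smooth f)).

Lemma ev_dd i f w : ev (dd i f) w = partial i (ev f) w. Proof. by []. Qed.

Lemma ddD i f g : dd i (f + g) = dd i f + dd i g.
Proof.
by apply: SFext => w; rewrite evD !ev_dd /partial deriveD //;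
  exact/smooth_derivable/ev_smooth.
Qed.

Lemma ddM i f g : dd i (f * g) = f * dd i g + g * dd i f.
Proof.
by apply: SFext => w; rewrite evD !evM !ev_dd /partial deriveM //;
  exact/smooth_derivable/ev_smooth.
Qed.

Lemma dd_sc i c : dd i (sc c) = 0.
Proof. by apply: SFext => w; rewrite ev_dd ev0; exact: (derive_cst c w). Qed.

Lemma dd0 i : dd i 0 = 0. Proof. by rewrite -[X in dd i X]sc0 dd_sc. Qed.
Lemma dd1 i : dd i 1 = 0. Proof. by rewrite -[X in dd i X]sc1 dd_sc. Qed.

Lemma ddN i f : dd i (- f) = - dd i f.
Proof. by apply/eqP; rewrite -addr_eq0 -ddD addrC subrr dd0. Qed.

Lemma ddMn i f n : dd i (f *+ n) = dd i f *+ n.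
Proof. by elim: n => [|n IH]; rewrite ?dd0 // !mulrS ddD IH. Qed.

Lemma dd_xx i : dd i xx = (i == 0)%:R.
Proof.
apply: SFext => w; rewrite ev_dd /partial.
rewrite (@derive_val _ _ _ _ _ _ _ (is_derive_coord 0 w _)) mxE eqxx /=.
by have [->|->] := ord2P i; rewrite ?ev1 ?ev0.
Qed.

Lemma dd_yy i : dd i yy = (i == 1)%:R.
Proof.
apply: SFext => w; rewrite ev_dd /partial.
rewrite (@derive_val _ _ _ _ _ _ _ (is_derive_coord 1 w _)) mxE eqxx /=.
by have [->|->] := ord2P i; rewrite ?ev1 ?ev0.
Qed.

Lemma ddC f : dd 1 (dd 0 f) = dd 0 (dd 1 f).
Proof. by apply: SFext => w; rewrite !ev_dd; exact/schwarz/ev_smooth. Qed.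

Definition sqnorm : SF := xx * xx + yy * yy.
Local Notation r2 := sqnorm.

Lemma ev_r2 w : ev r2 w = w 0 0 ^+ 2 + w 0 1 ^+ 2. Proof. by []. Qed.

Lemma one_r2_neq0 w : ev (1 + r2) w != 0.
Proof.
by rewrite evD ev1 ev_r2 gt_eqF // ltr_wpDr // addr_ge0 // sqr_ge0.
Qed.

Lemma smooth_phi : smooth (fun w => (ev (1 + r2) w)^-1).
Proof.
apply/smooth_closure_smooth/(smooth_closureV one_r2_neq0).
exact/smooth_closure_base/ev_smooth.
Qed.

(** A circle invariant function that extends smoothly over infinity: in the other chart it reads
    [1 - phi]. Explicit cocycles are built from it, and its square turns bivectors into
    functions. *)
Definition inv_sqnorm1 : SF := mkSF smooth_phi.
Local Notation phi := inv_sqnorm1.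

Lemma ev_phi w : ev phi w = (1 + (w 0 0 ^+ 2 + w 0 1 ^+ 2))^-1. Proof. by []. Qed.

Lemma phiK : phi * (1 + r2) = 1.
Proof. by apply: SFext => w; rewrite evM /inv_sqnorm1 ev_mk mulVf // one_r2_neq0. Qed.

(** The Euler field, which generates dilations as [th] generates rotations. *)
Definition Ed f : SF := xx * dd 0 f + yy * dd 1 f.
Definition th f : SF := xx * dd 1 f - yy * dd 0 f.

Lemma ddE0 : (dd 0 xx = 1) * (dd 0 yy = 0) * (dd 1 xx = 0) * (dd 1 yy = 1).
Proof. by rewrite !dd_xx !dd_yy. Qed.

Definition ddE := (ddD, ddN, ddM, ddMn, dd_sc, dd0, dd1, ddE0).

Lemma dd_phi i : dd i phi = - (phi * phi * dd i r2).
Proof.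
have h : phi * dd i (1 + r2) + (1 + r2) * dd i phi = 0 by rewrite -ddM phiK dd1.
rewrite ddD dd1 add0r in h.
have -> : dd i phi = phi * ((1 + r2) * dd i phi) by rewrite mulrA phiK mul1r.
have -> : (1 + r2) * dd i phi = - (phi * dd i r2).
  by apply/eqP; rewrite -addr_eq0 addrC h.
ring.
Qed.

End SmoothRingTheory.

(** * Integral operators on the ring: dilation, stretch and circle averages *)

Section Operators.
Variable R : realType.
Local Notation V := 'rV[R]_2.
Local Notation SF := (SF R).
Local Notation xx := (coord_x R).
Local Notation yy := (coord_y R).
Local Notation r2 := (sqnorm R).
Implicit Types (f g h : SF) (w : V) (i : 'I_2).

Record family := Family {
  fp : R -> R; fA : R -> R; fB : R -> R; fC : R -> R; fD : R -> R;
  fp_cont : continuous fp; fA_cont : continuous fA; fB_cont : continuous fB;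
  fC_cont : continuous fC; fD_cont : continuous fD }.

Arguments fp_cont : clear implicits.
Arguments fA_cont : clear implicits.
Arguments fB_cont : clear implicits.
Arguments fC_cont : clear implicits.
Arguments fD_cont : clear implicits.

Definition fapp (T : family) w (t : R) : V := linfam (fA T) (fB T) (fC T) (fD T) w t.

Lemma smooth_linint (T : family) f :
  smooth (linint (fp T) (fA T) (fB T) (fC T) (fD T) (ev f)).
Proof.
apply/smooth_closure_smooth/smooth_closure_linint; last exact: ev_smooth.
all: by case: T.
Qed.

Definition linI (T : family) f : SF := mkSF (smooth_linint T f).

Lemma ev_linI T f w : ev (linI T f) w = int01 (fun t => fp T t * ev f (fapp T w t)).
Proof. by []. Qed.

Lemma fam_continuous T (p : R -> R) f w : continuous p ->
  continuous (fun t => p t * ev f (fapp T w t)).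
Proof.
by move=> cp; apply: Phi_continuous => //; (exact: ev_continuous || case: T).
Qed.

Lemma int01_lin4 (a b : R) (F1 F2 F3 F4 : R -> R) :
  continuous F1 -> continuous F2 -> continuous F3 -> continuous F4 ->
  a * (int01 F1 + int01 F2) + b * (int01 F3 + int01 F4) =
  int01 (fun t => a * (F1 t + F2 t) + b * (F3 t + F4 t)).
Proof.
have ccD (F G : R -> R) : continuous F -> continuous G -> continuous (fun t => F t + G t).
  by move=> cF cG t; apply: cvgD; [exact: cF | exact: cG].
have ccZ c (F : R -> R) : continuous F -> continuous (fun t => c * F t).
  by move=> cF; apply: mulfun_continuous; [exact: cst_continuous | exact: cF].
move=> c1 c2 c3 c4; have c12 := ccD _ _ c1 c2; have c34 := ccD _ _ c3 c4.
by rewrite (int01D (ccZ a _ c12) (ccZ b _ c34)) (int01Z a c12) (int01Z b c34) int01D // int01D.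
Qed.

(** The direction (v0, v1) is carried along by M(t). Taking as direction the value at [w] of a
    linear field shows that the operator commutes with this field whenever all the M(t) do: every
    M(t) commutes with the Euler field, rotations and dilations also with the rotation field. *)
Lemma linI_dir T f w v0 v1 :
  v0 * ev (dd 0 (linI T f)) w + v1 * ev (dd 1 (linI T f)) w =
  int01 (fun t => fp T t * ((fA T t * v0 + fB T t * v1) * ev (dd 0 f) (fapp T w t)
                          + (fC T t * v0 + fD T t * v1) * ev (dd 1 f) (fapp T w t))).
Proof.
have c0 := fp_cont T; have c1 := fA_cont T; have c2 := fB_cont T.
have c3 := fC_cont T; have c4 := fD_cont T.
have E i : ev (dd i (linI T f)) w =
    int01 (fun t => (fp T t * (if i == 0 then fA T else fB T) t) * ev (dd 0 f) (fapp T w t)) +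
    int01 (fun t => (fp T t * (if i == 0 then fC T else fD T) t) * ev (dd 1 f) (fapp T w t)).
  exact: (@derive_val _ _ _ _ _ _ _ (is_derive_linint c0 c1 c2 c3 c4 w i (ev_smooth f))).
have cc (q : R -> R) : continuous q -> forall i, continuous (fun t => fp T t * q t * ev (dd i f) (fapp T w t)).
  by move=> cq i; apply: fam_continuous; exact: mulfun_continuous.
rewrite (E 0) (E 1) (@int01_lin4 _ _ _ _ _ _ (cc _ c1 0) (cc _ c3 1) (cc _ c2 0) (cc _ c4 1)).
by congr int01; apply/funext => t; ring.
Qed.

Lemma linI_Ed T f : Ed (linI T f) = linI T (Ed f).
Proof.
apply: SFext => w; rewrite ev_linI {1}/Ed evD !evM linI_dir.
by congr int01; apply/funext => t; rewrite /Ed !evE /fapp /linfam pt0 pt1; ring.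
Qed.

Lemma evB f g w : ev (f - g) w = ev f w - ev g w. Proof. by []. Qed.

Definition dilation : family.
Proof.
refine (@Family id id (cst 0) (cst 0) id _ _ _ _ _); try exact: cst_continuous;
  by move=> t; exact: cvg_id.
Defined.

Definition Jop := linI dilation.

(** Contracts the plane horizontally onto the axis x = 0; it yields the quotient in a division by
    [x]. *)
Definition hstretch : family.
Proof.
refine (@Family (cst 1) id (cst 0) (cst 0) (cst 1) _ _ _ _ _); try exact: cst_continuous.
by move=> t; exact: cvg_id.
Defined.

Definition ang (e t : R) : R := e * (pi *+ 2) * t.

Lemma is_derive_ang e (t : R) : is_derive t 1 (ang e) (e * (pi *+ 2)).
Proof.
apply: is_derive_eq (is_deriveZ (e * (pi *+ 2)) (is_derive_id t (1 : R))) _.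
by rewrite [_ *: 1]mulr1.
Qed.

Lemma ang_continuous e : continuous (ang e).
Proof. by move=> t; apply: cvgM; [exact: cvg_cst | exact: cvg_id]. Qed.

Lemma cos_ang_continuous e : continuous (fun t => cos (ang e t)).
Proof. move=> t; exact: continuous_comp (@ang_continuous e t) (@continuous_cos R _). Qed.
Lemma sin_ang_continuous e : continuous (fun t => sin (ang e t)).
Proof. move=> t; exact: continuous_comp (@ang_continuous e t) (@continuous_sin R _). Qed.
Lemma Nsin_ang_continuous e : continuous (fun t => - sin (ang e t)).
Proof. by move=> t; apply: cvgN; exact: sin_ang_continuous. Qed.

Definition rotation (e : R) (p : R -> R) (cp : continuous p) : family :=
  Family cp (@cos_ang_continuous e) (@Nsin_ang_continuous e)
    (@sin_ang_continuous e) (@cos_ang_continuous e).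

Definition rot (s : R) w : V :=
  pt (cos s * w 0 0 - sin s * w 0 1) (sin s * w 0 0 + cos s * w 0 1).

Lemma fapp_rotation e p (cp : continuous p) w t : fapp (rotation e cp) w t = rot (ang e t) w.
Proof. by rewrite /fapp /linfam /= /rot mulNr. Qed.

Lemma linI_th e p (cp : continuous p) f :
  th (linI (rotation e cp) f) = linI (rotation e cp) (th f).
Proof.
apply: SFext => w; rewrite ev_linI {1}/th evD evN !evM -mulNr addrC linI_dir.
congr int01; apply/funext => t; rewrite /th !evE !fapp_rotation /rot pt0 pt1 /=.
by ring.
Qed.

Lemma is_derive_rot f w (s : R) :
  is_derive s 1 (fun s : R => ev f (rot s w)) (ev (th f) (rot s w)).
Proof.
have dx : is_derive s 1 (fun s : R => cos s * w 0 0 - sin s * w 0 1)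
   (- sin s * w 0 0 - cos s * w 0 1).
  have h := is_deriveB (is_deriveZ (w 0 0) (is_derive_cos s)) (is_deriveZ (w 0 1) (is_derive_sin s)).
  rewrite (_ : (fun s : R => _) = w 0 0 \*: cos - w 0 1 \*: sin); last first.
    by apply/funext => r; rewrite mulrC [sin r * _]mulrC.
  by apply: is_derive_eq h _; rewrite /GRing.scale /=; ring.
have dy : is_derive s 1 (fun s : R => sin s * w 0 0 + cos s * w 0 1)
   (cos s * w 0 0 - sin s * w 0 1).
  have h := is_deriveD (is_deriveZ (w 0 0) (is_derive_sin s)) (is_deriveZ (w 0 1) (is_derive_cos s)).
  rewrite (_ : (fun s : R => _) = w 0 0 \*: sin + w 0 1 \*: cos); last first.
    by apply/funext => r; rewrite mulrC [cos r * _]mulrC.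
  by apply: is_derive_eq h _; rewrite /GRing.scale /=; ring.
apply: is_derive_eq (is_derive_curve (ev_smooth f) dx dy) _.
by rewrite /th !evE /rot !pt0 !pt1 !ev_dd; ring.
Qed.

Lemma is_derive_rot_ang e f w (t : R) :
  is_derive t 1 (fun t : R => ev f (rot (ang e t) w))
    (e * (pi *+ 2) * ev (th f) (rot (ang e t) w)).
Proof.
apply: is_derive_eq (is_derive1_comp (is_derive_rot f w (ang e t)) (is_derive_ang e t)) _.
exact: mulrC.
Qed.

Lemma one_continuous : continuous (cst 1 : R -> R). Proof. exact: cst_continuous. Qed.
(* [Mop e] averages over the circle action; [Lop e] inverts [th] on functions of zero
   average. The sign [e] is the direction of rotation: inversion reverses it, so the
   two charts use opposite signs. *)
Definition Mop e := linI (rotation e one_continuous).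
Definition Lop e := linI (rotation e (@ang_continuous e)).

Lemma ev_Mop e f w : ev (Mop e f) w = int01 (fun t => ev f (rot (ang e t) w)).
Proof.
by rewrite ev_linI; congr int01; apply/funext => t; rewrite fapp_rotation /= mul1r.
Qed.

Lemma ev_Lop e f w : ev (Lop e f) w = int01 (fun t => ang e t * ev f (rot (ang e t) w)).
Proof. by rewrite ev_linI; congr int01; apply/funext => t; rewrite fapp_rotation. Qed.

Lemma ev_rot_continuous e f w : continuous (fun t => ev f (rot (ang e t) w)).
Proof.
move=> t; apply: differentiable_continuous; apply/derivable1_diffP.
exact: (@ex_derive _ _ _ _ _ _ _ (is_derive_rot_ang e f w t)).
Qed.

Definition sign1 (e : R) : Prop := e = 1 \/ e = - 1.

Lemma rot0 w : rot 0 w = w.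
Proof. by apply: rV2P; rewrite ?pt0 ?pt1 cos0 sin0; ring. Qed.

Lemma rot_ang1 e w : sign1 e -> rot (ang e 1) w = w.
Proof.
move=> [->|->]; rewrite /rot /ang ?mulN1r ?mul1r mulr1 ?cosN ?sinN cos2pi sin2pi;
by apply: rV2P; rewrite ?pt0 ?pt1; ring.
Qed.

(** Up to the nonzero factor [e * (pi *+ 2)] the integrand is the derivative of a function of [t]
    that returns to its initial value after a full turn. *)
Lemma th_Mop e f : sign1 e -> th (Mop e f) = 0.
Proof.
move=> he; have e0 : e * (pi *+ 2) != 0.
  have p0 : (pi *+ 2 : R) != 0 by rewrite mulrn_eq0 /= gt_eqF // pi_gt0.
  by apply: mulf_neq0 => //; case: he => ->; rewrite ?oppr_eq0 oner_eq0.
rewrite linI_th -/(Mop e _); apply: SFext => w; rewrite ev_Mop ev0.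
apply: (mulfI e0); rewrite mulr0 -int01Z; last exact: ev_rot_continuous.
apply: etrans (int01_FTC (F := fun t => ev f (rot (ang e t) w)) _ (is_derive_rot_ang e f w)) _.
  by apply: mulfun_continuous; [exact: cst_continuous | exact: ev_rot_continuous].
by rewrite rot_ang1 // /ang mulr0 rot0 subrr.
Qed.

Lemma Mop_th e f : sign1 e -> Mop e (th f) = 0.
Proof. by move=> he; rewrite /Mop -linI_th; exact: th_Mop. Qed.

(** Integration by parts: [t * ev f (rot (ang e t) w)] has as derivative the sum of the integrands
    of [Lop e (th f)] and [Mop e f], and its increment over a full turn is f(w). The weight
    [ang e t] contains the speed of the rotation for this reason. *)
Lemma th_Lop e f : sign1 e -> th (Lop e f) = f - Mop e f.
Proof.
move=> he; rewrite linI_th -/(Lop e _); apply: SFext => w; rewrite evB.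
apply/eqP; rewrite eq_sym subr_eq eq_sym ev_Lop ev_Mop; apply/eqP.
rewrite -int01D; [|exact: mulfun_continuous (@ang_continuous e) (@ev_rot_continuous _ _ _)
  |exact: ev_rot_continuous].
have dF (t : R) : is_derive t 1 (fun t : R => t * ev f (rot (ang e t) w))
    (ang e t * ev (th f) (rot (ang e t) w) + ev f (rot (ang e t) w)).
  apply: is_derive_eq (is_deriveM (is_derive_id t (1 : R)) (is_derive_rot_ang e f w t)) _.
  by rewrite /ang /GRing.scale /=; ring.
apply: etrans (int01_FTC (F := fun t => t * ev f (rot (ang e t) w)) _ dF) _.
  move=> t; apply: cvgD; last exact: ev_rot_continuous.
  exact: mulfun_continuous (@ang_continuous e) (@ev_rot_continuous _ _ _) _.
by rewrite rot_ang1 // mul1r mul0r subr0.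
Qed.

End Operators.

(** * Division by [x] and by |w|^2, circle invariant functions, and the radial equation *)

Section RadialCalculus.
Variable R : realType.
Local Notation V := 'rV[R]_2.
Local Notation SF := (SF R).
Local Notation xx := (coord_x R).
Local Notation yy := (coord_y R).
Local Notation r2 := (sqnorm R).
Implicit Types (f g h k l m : SF) (w : V) (i : 'I_2).

Lemma is_derive_ray f w (t : R) : is_derive t 1 (fun t : R => ev f (t *: w))
  (w 0 0 * ev (dd 0 f) (t *: w) + w 0 1 * ev (dd 1 f) (t *: w)).
Proof.
have E (s : R) : pt (0 + s * w 0 0) (0 + s * w 0 1) = s *: w.
  by apply: rV2P; rewrite ?pt0 ?pt1 mxE add0r.
have h := is_derive_curve (t := t) (ev_smooth f) (is_derive_affine 0 (w 0 0) t)
  (is_derive_affine 0 (w 0 1) t).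
rewrite (_ : (fun t => ev f (t *: w)) = fun s => ev f (pt (0 + s * w 0 0) (0 + s * w 0 1))); last first.
  by apply/funext => s; rewrite E.
by apply: is_derive_eq h _; rewrite E !ev_dd mulrC [_ * w 0 1]mulrC.
Qed.

Lemma ray_continuous f w : continuous (fun t : R => ev f (t *: w)).
Proof.
move=> t; apply: differentiable_continuous; apply/derivable1_diffP.
exact: (@ex_derive _ _ _ _ _ _ _ (is_derive_ray f w t)).
Qed.

Lemma ev_dense f w (v : V) : (forall t : R, 0 < t -> ev f (w + t *: v) = 0) -> ev f w = 0.
Proof.
move=> H.
have c : {for (0 : R), continuous (fun t : R => ev f (w + t *: v))}.
  have cl : {for (0 : R), continuous (fun t : R => w + t *: v)}.
    apply: cvgD; first exact: cvg_cst.
    by apply: cvgZr_tmp; exact: cvg_id.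
  exact: continuous_comp cl (@ev_continuous _ f _).
have /cvg_at_right_filter c1 : ev f (w + t *: v) @[t --> (0 : R)] --> ev f (w + 0 *: v) by exact: c.
rewrite scale0r addr0 in c1.
have c2 : ev f (w + t *: v) @[t --> (0 : R)^'+] --> (0 : R).
  have e : {near (0 : R)^'+, (fun=> 0 : R) =1 (fun t : R => ev f (w + t *: v))}.
    by apply: filterS (nbhs_right_gt (0 : R)) => t t0; rewrite H.
  exact: cvg_trans (near_eq_cvg e) (cvg_cst (0 : R)).
exact: (cvg_unique _ c1 c2).
Qed.

Lemma r2_eq0 w : (ev r2 w == 0) = (w == 0).
Proof.
rewrite ev_r2 paddr_eq0 ?sqr_ge0 // !sqrf_eq0.
apply/idP/eqP => [/andP[/eqP h0 /eqP h1]|->]; last by rewrite !mxE eqxx.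
by apply: rV2P; rewrite ?h0 ?h1 mxE.
Qed.

Lemma dense_neq0 f : (forall w, w != 0 -> ev f w = 0) -> f = 0.
Proof.
move=> H; apply: SFext => w; rewrite ev0.
have [->|] := eqVneq w 0; last exact: H.
apply: (@ev_dense f 0 'e_0) => t t0; apply: H; rewrite add0r scaler_eq0 negb_or gt_eqF //=.
apply/eqP => /(congr1 (fun w : V => w 0 0)); rewrite !mxE /= => /eqP.
by rewrite oner_eq0.
Qed.

(** The ring has zero divisors, but [r2], like [xx] below, is nonzero on a dense set, and can be
    cancelled by continuity. *)
Lemma r2_cancel f : r2 * f = 0 -> f = 0.
Proof.
move=> H; apply: dense_neq0 => w w0.
have : ev (r2 * f) w = 0 by rewrite H.
by rewrite evM => /eqP; rewrite mulf_eq0 r2_eq0 (negPf w0) => /eqP.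
Qed.

Lemma xx_cancel f : xx * f = 0 -> f = 0.
Proof.
move=> H.
have nz w : w 0 0 != 0 -> ev f w = 0.
  move=> w0; have : ev (xx * f) w = 0 by rewrite H.
  by rewrite evM ev_xx => /eqP; rewrite mulf_eq0 (negPf w0) => /eqP.
apply: SFext => w; rewrite ev0; have [w0|] := eqVneq (w 0 0) 0; last exact: nz.
apply: (@ev_dense f w 'e_0) => t t0; apply: nz.
by rewrite !mxE w0 /= add0r mulr1 gt_eqF.
Qed.

Lemma xxI f g : xx * f = xx * g -> f = g.
Proof.
by move=> H; apply/eqP; rewrite -subr_eq0; apply/eqP/xx_cancel; rewrite mulrBr H subrr.
Qed.

Lemma fapp_dilation w t : fapp (dilation R) w t = t *: w.
Proof. by apply: rV2P; rewrite /fapp /linfam ?pt0 ?pt1 mxE /=; ring. Qed.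

Lemma ev_Jop f w : ev (Jop f) w = int01 (fun t => t * ev f (t *: w)).
Proof. by rewrite ev_linI; congr int01; apply/funext => t; rewrite fapp_dilation. Qed.

Lemma id_continuous : continuous (fun t : R => t). Proof. by move=> t; exact: cvg_id. Qed.

Lemma mul_ray_continuous f w : continuous (fun t : R => t * ev f (t *: w)).
Proof. by apply: mulfun_continuous; [exact: id_continuous | exact: ray_continuous]. Qed.

(* [Jop f] is the integral of [t f(t w)] over [0,1], i.e. [t^2 f(t w)] is a primitive. *)
Lemma Jop_eq f : Jop f *+ 2 + Ed (Jop f) = f.
Proof.
rewrite /Jop linI_Ed -/(Jop _); apply: SFext => w; rewrite evD evMn !ev_Jop.
rewrite -mulr_natl -int01Z; last exact: mul_ray_continuous.
rewrite -int01D; last exact: mul_ray_continuous; last first.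
  by apply: mulfun_continuous; [exact: cst_continuous | exact: mul_ray_continuous].
have dF (t : R) : is_derive t 1 (fun t : R => t * (t * ev f (t *: w)))
   (2 * (t * ev f (t *: w)) + t * ev (Ed f) (t *: w)).
  have h := is_deriveM (is_derive_id t (1 : R)) (is_deriveM (is_derive_id t (1 : R)) (is_derive_ray f w t)).
  apply: is_derive_eq h _.
  transitivity (t * (t * (w 0 0 * ev (dd 0 f) (t *: w) + w 0 1 * ev (dd 1 f) (t *: w))
    + ev f (t *: w) * 1) + t * ev f (t *: w) * 1); first by [].
  by rewrite /Ed !evE !mxE; ring.
apply: etrans (int01_FTC (F := fun t => t * (t * ev f (t *: w))) _ dF) _.
  move=> t; apply: cvgD; last exact: mul_ray_continuous.
  exact: mulfun_continuous (@cst_continuous _ _ (2 : R)) (@mul_ray_continuous f w) _.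
by rewrite !mul1r scale1r mul0r subr0.
Qed.

Lemma th_Jop f : th (Jop f) = Jop (th f).
Proof.
apply: SFext => w; rewrite ev_Jop {1}/th evD evN !evM -mulNr addrC linI_dir.
congr int01; apply/funext => t; rewrite !fapp_dilation /th !evE !mxE /=; ring.
Qed.

Lemma fapp_hstretch w t : fapp (hstretch R) w t = pt (t * w 0 0) (w 0 1).
Proof. by apply: rV2P; rewrite /fapp /linfam ?pt0 ?pt1 /=; ring. Qed.

(** Hadamard's lemma: the quotient is the integral of [dd 0 f] along the horizontal segment from the
    axis x = 0 to [w]. *)
Lemma hadamard f : (forall y, ev f (pt 0 y) = 0) -> exists m, f = xx * m.
Proof.
move=> f0; exists (linI (hstretch R) (dd 0 f)); apply: SFext => w.
have cI := @fam_continuous _ (hstretch R) (fp (hstretch R)) (dd 0 f) w (@fp_cont _ (hstretch R)).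
rewrite evM ev_xx ev_linI -(int01Z _ cI).
have dF (t : R) : is_derive t 1 (fun t : R => ev f (pt (0 + t * w 0 0) (w 0 1 + t * 0)))
    (w 0 0 * (fp (hstretch R) t * ev (dd 0 f) (fapp (hstretch R) w t))).
  have h := is_derive_curve (t := t) (ev_smooth f) (is_derive_affine 0 (w 0 0) t) (is_derive_affine (w 0 1) 0 t).
  apply: is_derive_eq h _.
  by rewrite fapp_hstretch add0r !mulr0 !addr0 !ev_dd /= mul1r mulrC.
apply: esym; apply: etrans (int01_FTC _ dF) _.
  by apply: mulfun_continuous; [exact: cst_continuous | exact: cI].
by rewrite !mul0r !mulr0 !addr0 f0 subr0 mul1r add0r ptE.
Qed.

(** The derivative along the ray through [w] at time [c] is [Ed f] at [c *: w] divided by [c]. The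
    mean value theorem on [0,1] only uses an interior [c], where the division is legitimate. *)
Lemma Ed_eq0 f : Ed f = 0 -> f = sc (ev f 0).
Proof.
move=> Ef; apply: SFext => w; rewrite ev_sc.
have [|c] := @MVT _ (fun t : R => ev f (t *: w)) _ 0 1 ltr01 (fun t _ => is_derive_ray f w t).
  exact/continuous_subspaceT/ray_continuous.
rewrite in_itv /= => /andP[c0 _]; rewrite scale1r scale0r subr0 mulr1.
set D := (X in _ = X); suff -> : D = 0 by move/eqP; rewrite subr_eq0 => /eqP.
have : ev (Ed f) (c *: w) = 0 by rewrite Ef.
rewrite /Ed !evE !mxE => h; apply: (mulfI (lt0r_neq0 c0)); rewrite mulr0 -h /D; ring.
Qed.

Lemma th_eq0_rot f w s : th f = 0 -> ev f (rot s w) = ev f w.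
Proof.
move=> tf; rewrite -[in RHS](rot0 w).
apply: (@is_derive_0_is_cst _ (fun s => ev f (rot s w))) => t.
by apply: is_derive_eq (is_derive_rot f w t) _; rewrite tf.
Qed.

Lemma polar w : exists s, rot s (pt (Num.sqrt (ev r2 w)) 0) = w.
Proof.
have [->|w0] := eqVneq w 0.
  exists 0; rewrite rot0; apply: rV2P; rewrite ?pt0 ?pt1 !mxE //.
  by rewrite ev_r2 !mxE expr0n addr0 sqrtr0.
set q := Num.sqrt _.
have r0 : 0 < ev r2 w by rewrite lt_def r2_eq0 w0 ev_r2 addr_ge0 // sqr_ge0.
have q0 : 0 < q by rewrite sqrtr_gt0.
have qq : q ^+ 2 = w 0 0 ^+ 2 + w 0 1 ^+ 2 by rewrite /q sqr_sqrtr ?ltW // ev_r2.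
have c1 : -1 <= w 0 0 / q <= 1.
  rewrite -ler_norml normrM normfV (gtr0_norm q0) ler_pdivrMr // mul1r.
  rewrite -[leRHS](gtr0_norm q0) -ler_sqr ?nnegrE // !real_normK ?num_real // qq.
  by rewrite lerDl sqr_ge0.
have cK : cos (acos (w 0 0 / q)) = w 0 0 / q by rewrite acosK // in_itv.
have sK : sin (acos (w 0 0 / q)) ^+ 2 = (w 0 1 / q) ^+ 2.
  have -> : sin (acos (w 0 0 / q)) ^+ 2 = 1 - (w 0 0 / q) ^+ 2.
    by rewrite -(cos2Dsin2 (acos (w 0 0 / q))) cK [_ ^+ 2 + _]addrC addrK.
  rewrite !expr_div_n qq.
  have : w 0 0 ^+ 2 + w 0 1 ^+ 2 != 0 by rewrite -qq expf_neq0 // gt_eqF.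
  by move=> h; field.
(* The cosine determines the angle up to sign, and the sign is read off the second coordinate. *)
have [s [cs ss]] : exists s, cos s = w 0 0 / q /\ sin s = w 0 1 / q.
  move/eqP: sK; rewrite eqf_sqr => /orP[/eqP h|/eqP h].
    by exists (acos (w 0 0 / q)).
  by exists (- acos (w 0 0 / q)); rewrite cosN sinN h opprK.
exists s; rewrite /rot cs ss; apply: rV2P; rewrite !(pt0, pt1) mulr0 ?subr0 ?addr0 divfK // gt_eqF //.
Qed.

Lemma radial f w : th f = 0 -> ev f w = ev f (pt (Num.sqrt (ev r2 w)) 0).
Proof. by move=> tf; have [s {1}<-] := polar w; rewrite th_eq0_rot. Qed.

(** On the axis x = 0 invariance reads [y * dd 0 f = 0], so Hadamard's lemma gives [dd 0 f = x * m];
    invariance again gives [dd 1 f = y * m]. Hence the derivative of f(t w) in [t] is |w|^2 t m(t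
    w), and integrating yields [f = r2 * Jop m]. *)
Lemma div_r2 f : th f = 0 -> ev f 0 = 0 -> exists k, f = r2 * k /\ th k = 0.
Proof.
move=> tf f0.
have [m Em] : exists m, dd 0 f = xx * m.
  apply: hadamard => y.
  have H z : z != 0 -> ev (dd 0 f) (pt 0 z) = 0.
    move=> z0; have : ev (th f) (pt 0 z) = 0 by rewrite tf.
    by rewrite /th !evE pt0 pt1 mul0r add0r => /eqP; rewrite oppr_eq0 mulf_eq0 (negPf z0) => /eqP.
  have [->|] := eqVneq y 0; last exact: H.
  apply: (@ev_dense _ _ 'e_1) => t t0.
  rewrite (_ : _ + _ = pt 0 t); first by apply: H; rewrite gt_eqF.
  by apply: rV2P; rewrite !mxE /=; ring.
have Em' : dd 1 f = yy * m.
  apply: xxI; apply/eqP; rewrite -subr_eq0 -tf /th Em; apply/eqP; ring.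
exists (Jop m); have fJ : f = r2 * Jop m.
  apply: SFext => w; rewrite evM ev_Jop -int01Z; last exact: mul_ray_continuous.
  have dF (t : R) : is_derive t 1 (fun t : R => ev f (t *: w)) (ev r2 w * (t * ev m (t *: w))).
    apply: is_derive_eq (is_derive_ray f w t) _.
    by rewrite Em Em' ev_r2 !evE !mxE; ring.
  apply: esym; apply: etrans (int01_FTC _ dF) _.
    by apply: mulfun_continuous; [exact: cst_continuous | exact: mul_ray_continuous].
  by rewrite scale1r scale0r f0 subr0.
split=> //; apply: r2_cancel; rewrite -[RHS]tf [in RHS]fJ /th /sqnorm !ddE; ring.
Qed.

(** Writing [l = r2 * k], one has [Ed (r2 * J) = r2 * (J *+ 2 + Ed J)], so the equation reduces to
    the one solved by [J = Jop k]. *)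
Lemma radial_primitive l : th l = 0 -> ev l 0 = 0 -> exists h, Ed h = l /\ th h = 0.
Proof.
move=> tl l0; have [k [-> tk]] := div_r2 tl l0.
have J0 : Jop 0 = 0 :> SF.
  apply: SFext => w; rewrite ev_Jop ev0 -[RHS](int01_cst 0).
  by congr int01; apply/funext => t; rewrite ev0 mulr0.
have tJ : th (Jop k) = 0 by rewrite th_Jop tk J0.
exists (r2 * Jop k); split.
  rewrite -[in RHS](Jop_eq k) /Ed /sqnorm !ddE; ring.
transitivity (r2 * th (Jop k)); last by rewrite tJ mulr0.
by rewrite /th /sqnorm !ddE; ring.
Qed.

End RadialCalculus.

(** * Behaviour of functions and operators under the change of charts *)

Section Inversion.
Variable R : realType.
Local Notation V := 'rV[R]_2.
Local Notation SF := (SF R).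
Local Notation xx := (coord_x R).
Local Notation yy := (coord_y R).
Local Notation r2 := (sqnorm R).
Implicit Types (f g h k l m : SF) (w : V) (i : 'I_2).

Definition inv w : V := pt (w 0 0 / ev r2 w) (- w 0 1 / ev r2 w).

Lemma neq0_sqr w : w != 0 -> w 0 0 ^+ 2 + w 0 1 ^+ 2 != 0.
Proof. by rewrite -r2_eq0. Qed.

Lemma r2_inv w : w != 0 -> ev r2 (inv w) = (ev r2 w)^-1.
Proof. by move=> /neq0_sqr w0; rewrite /inv !ev_r2 pt0 pt1; field. Qed.

Lemma inv_neq0 w : w != 0 -> inv w != 0.
Proof. by move=> w0; rewrite -r2_eq0 r2_inv // invr_eq0 r2_eq0. Qed.

Lemma invK w : w != 0 -> inv (inv w) = w.
Proof.
move=> w0; have n0 := neq0_sqr w0.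
by apply: rV2P; rewrite /inv r2_inv // ev_r2 !(pt0, pt1); field.
Qed.

Lemma r2_rot s w : ev r2 (rot s w) = ev r2 w.
Proof.
rewrite !ev_r2 /rot pt0 pt1; have := cos2Dsin2 s.
set c := cos s; set d := sin s => h.
transitivity ((c ^+ 2 + d ^+ 2) * (w 0 0 ^+ 2 + w 0 1 ^+ 2)); first by ring.
by rewrite h mul1r.
Qed.

Lemma rot_neq0 s w : w != 0 -> rot s w != 0.
Proof. by rewrite -!r2_eq0 r2_rot. Qed.

Lemma inv_rot s w : inv (rot s w) = rot (- s) (inv w).
Proof.
by apply: rV2P; rewrite /inv r2_rot /rot cosN sinN !(pt0, pt1); ring.
Qed.

Lemma inv_scale a w : a != 0 -> w != 0 -> inv (a *: w) = a^-1 *: inv w.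
Proof.
move=> a0 w0; have n0 := neq0_sqr w0.
have e : ev r2 (a *: w) = a ^+ 2 * ev r2 w by rewrite !ev_r2 !mxE; ring.
by apply: rV2P; rewrite !mxE /= e ev_r2; field; rewrite n0 a0.
Qed.

(* Chart expressions [f0], [f1] of a function which is multiplied by [c] under [inv]. *)
Definition glued (c : R) f0 f1 : Prop :=
  forall w, w != 0 -> ev f1 (inv w) = c * ev f0 w.

Lemma is_derive_expM (a t : R) : is_derive t 1 (fun t : R => expR (a * t)) (a * expR (a * t)).
Proof.
have da : is_derive t 1 (fun t : R => a * t) a.
  by apply: is_derive_eq (is_deriveZ a (is_derive_id t (1 : R))) _; rewrite [_ *: 1]mulr1.
apply: is_derive_eq (is_derive1_comp (is_derive_expR (a * t)) da) _.
exact: mulrC.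
Qed.

Lemma is_derive_exp_ray f w (a t : R) :
  is_derive t 1 (fun t : R => ev f (expR (a * t) *: w)) (a * ev (Ed f) (expR (a * t) *: w)).
Proof.
apply: is_derive_eq (is_derive1_comp (is_derive_ray f w _) (is_derive_expM a t)) _.
by rewrite /Ed !evE !mxE; ring.
Qed.

(** Inversion conjugates the flow of dilations, parametrised by exp(t), to its inverse; the sign
    appears on comparing derivatives at time 0. The rotation flow is treated alike in [glued_th]. *)
Lemma glued_Ed c f0 f1 : glued c f0 f1 -> glued (- c) (Ed f0) (Ed f1).
Proof.
move=> H w w0.
have E : (fun t : R => ev f1 (expR (-1 * t) *: inv w)) = c \*: (fun t : R => ev f0 (expR (1 * t) *: w)).
  apply/funext => t; transitivity (c * ev f0 (expR (1 * t) *: w)); last by [].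
  rewrite mul1r mulN1r expRN; have e0 : expR t != 0 by rewrite gt_eqF // expR_gt0.
  by rewrite -inv_scale // H // scaler_eq0 negb_or e0.
have d1 := is_derive_exp_ray f1 (inv w) (-1) 0.
have d0 := is_deriveZ c (is_derive_exp_ray f0 w 1 0).
rewrite E in d1; have := @derive_val _ _ _ _ _ _ _ d1.
rewrite (@derive_val _ _ _ _ _ _ _ d0) !mulr0 expR0 !scale1r => h.
have -> : ev (Ed f1) (inv w) = - (-1 * ev (Ed f1) (inv w)) by ring.
by rewrite -h /GRing.scale /=; ring.
Qed.

Lemma glued_th c f0 f1 : glued c f0 f1 -> glued (- c) (th f0) (th f1).
Proof.
move=> H w w0.
have E : (fun t : R => ev f1 (rot (- t) (inv w))) = c \*: (fun t : R => ev f0 (rot t w)).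
  by apply/funext => t; transitivity (c * ev f0 (rot t w)) => //; rewrite -inv_rot H // rot_neq0.
have d1 := is_derive1_comp (is_derive_rot f1 (inv w) (- 0)) (is_deriveNid (0 : R) (1 : R)).
have d0 := is_deriveZ c (is_derive_rot f0 w 0).
rewrite [X in is_derive _ _ X _]E in d1; have := @derive_val _ _ _ _ _ _ _ d1.
rewrite (@derive_val _ _ _ _ _ _ _ d0) oppr0 !rot0 => h.
have -> : ev (th f1) (inv w) = - (ev (th f1) (inv w) * -1) by ring.
by rewrite -h /GRing.scale /=; ring.
Qed.

Lemma angN (e t : R) : ang (- e) t = - ang e t. Proof. by rewrite /ang !mulNr. Qed.

Lemma glued_Mop c f0 f1 : glued c f0 f1 -> glued c (Mop 1 f0) (Mop (-1) f1).
Proof.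
move=> H w w0; rewrite !ev_Mop -int01Z; last exact: ev_rot_continuous.
congr int01; apply/funext => t.
by rewrite angN -inv_rot H // rot_neq0.
Qed.

(** The weight [ang] is odd in the direction of rotation, which produces the sign absent from
    [glued_Mop]. *)
Lemma glued_Lop c f0 f1 : glued c f0 f1 -> glued (- c) (Lop 1 f0) (Lop (-1) f1).
Proof.
move=> H w w0; rewrite !ev_Lop -int01Z; last first.
  exact: mulfun_continuous (@ang_continuous _ _) (@ev_rot_continuous _ _ _ _).
congr int01; apply/funext => t.
by rewrite angN -inv_rot H ?rot_neq0 //; ring.
Qed.

Lemma Mop_r2 e f : Mop e (r2 * f) = r2 * Mop e f.
Proof.
apply: SFext => w; rewrite evM !ev_Mop -int01Z; last exact: ev_rot_continuous.
by congr int01; apply/funext => t; rewrite evM r2_rot.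
Qed.

Lemma Mop_Ed e f : Ed (Mop e f) = Mop e (Ed f). Proof. exact: linI_Ed. Qed.

Lemma ev_Mop0 e f : ev (Mop e f) 0 = ev f 0.
Proof.
rewrite ev_Mop -[RHS]int01_cst; congr int01; apply/funext => t; congr (ev f _).
by apply: rV2P; rewrite /rot ?pt0 ?pt1 !mxE !mulr0 ?subr0 ?addr0.
Qed.

Lemma glued_primitive l0 l1 : glued (-1) l0 l1 -> th l0 = 0 -> th l1 = 0 ->
  ev l0 0 = 0 -> ev l1 0 = 0 ->
  exists h0 h1, [/\ glued 1 h0 h1, Ed h0 = l0, Ed h1 = l1, th h0 = 0 & th h1 = 0].
Proof.
move=> Hl t0 t1 z0 z1.
have [h0 [E0 T0]] := radial_primitive t0 z0; have [h1 [E1 T1]] := radial_primitive t1 z1.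
(* This point is fixed by [inv]. As [h0] and [h1] are circle invariant, comparing them along the
   positive real axis, in logarithmic time, compares them on all of C^*. *)
pose e : V := 'e_0.
have e0 : e != 0.
  by apply/eqP => /(congr1 (fun w : V => w 0 0)); rewrite !mxE /= => /eqP; rewrite oner_eq0.
have ie : inv e = e by apply: rV2P; rewrite /inv ev_r2 ?pt0 ?pt1 !mxE /=; field.
pose chi (t : R) := ev h1 (expR (-1 * t) *: e) - ev h0 (expR (1 * t) *: e).
have dchi (t : R) : is_derive t 1 chi 0.
  apply: is_derive_eq (is_deriveB (is_derive_exp_ray h1 e (-1) t) (is_derive_exp_ray h0 e 1 t)) _.
  have et : expR t != 0 by rewrite gt_eqF // expR_gt0.
  have -> : ev (Ed h1) (expR (-1 * t) *: e) = - ev (Ed h0) (expR (1 * t) *: e); last by ring.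
  rewrite E0 E1 mul1r mulN1r expRN -{1}ie -inv_scale // Hl ?mulN1r //.
  by rewrite scaler_eq0 negb_or et.
have cst_chi t : chi t = chi 0 by exact: is_derive_0_is_cst.
(* The constant discrepancy is absorbed in one chart; neither [Ed] nor [th] sees it. *)
exists (h0 + sc (chi 0)), h1; split => //.
- move=> w w0.
  have r0 : 0 < ev r2 w by rewrite lt_def r2_eq0 w0 ev_r2 addr_ge0 // sqr_ge0.
  have s0 : 0 < Num.sqrt (ev r2 w) by rewrite sqrtr_gt0.
  rewrite evD ev_sc (radial _ T0) (radial _ T1) r2_inv // sqrtrV ?ltW //.
  rewrite -(cst_chi (ln (Num.sqrt (ev r2 w)))) /chi !mulN1r !mul1r expRN lnK //.
  have pe (s : R) : pt s 0 = s *: e by apply: rV2P; rewrite ?pt0 ?pt1 !mxE /=; ring.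
  by rewrite !pe; ring.
- by rewrite -E0 /Ed !ddE; ring.
- by rewrite -[RHS]T0 /th !ddE; ring.
Qed.

End Inversion.

Ltac gen_ev := repeat match goal with |- context [@ev ?R ?f ?w] => move: (@ev R f w) => ? end.
Ltac ev_ring := gen_ev; ring.

(** * Fields in the two charts, and exactness in degree one *)

Section Charts.
Variable R : realType.
Local Notation V := 'rV[R]_2.
Local Notation SF := (SF R).
Local Notation xx := (coord_x R).
Local Notation yy := (coord_y R).
Local Notation r2 := (sqnorm R).
Local Notation phi := (inv_sqnorm1 R).
Implicit Types (a b f g h k l m u : SF) (w : V) (i : 'I_2).

(** Inner products with the Euler field and the rotation field. In these components the Jacobian of
    w |-> 1/w becomes diagonal. *)
Definition rho a b : SF := xx * a + yy * b.
Definition tau a b : SF := xx * b - yy * a.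
Definition dv a b : SF := dd 0 a + dd 1 b.
Definition curl a b : SF := dd 0 b - dd 1 a.
Definition lap f : SF := dd 0 (dd 0 f) + dd 1 (dd 1 f).
Definition diff1 a b : SF := rho a b *+ 2 - r2 * dv a b.
Definition ham0 f : SF := - (r2 * dd 1 f).
Definition ham1 f : SF := r2 * dd 0 f.

Lemma diff1_ham f : diff1 (ham0 f) (ham1 f) = 0.
Proof. by rewrite /diff1 /rho /dv /ham0 /ham1 /sqnorm !ddE ddC; ring. Qed.

Lemma diff1D a b a' b' : diff1 (a + a') (b + b') = diff1 a b + diff1 a' b'.
Proof. by rewrite /diff1 /rho /dv !ddE; ring. Qed.

Lemma ev_origin : (ev xx 0 = 0) * (ev yy 0 = 0) * (ev r2 0 = 0).
Proof. by rewrite ev_r2 ev_xx ev_yy !mxE expr0n addr0. Qed.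

(** A Hamiltonian field vanishes to second order at the origin because of the factor [r2]; hence the
    degree 1 invariants, this one and the curl below, are zero on coboundaries. *)
Lemma ev_dv_ham f : ev (dv (ham0 f) (ham1 f)) 0 = 0.
Proof.
by rewrite /dv /ham0 /ham1 /sqnorm !ddE !(evD, evM, evN, evMn, ev0, ev1, ev_origin); ev_ring.
Qed.

Lemma ev_curl_ham f : ev (curl (ham0 f) (ham1 f)) 0 = 0.
Proof.
by rewrite /curl /ham0 /ham1 /sqnorm !ddE !(evD, evM, evN, evMn, ev0, ev1, ev_origin); ev_ring.
Qed.

Lemma ev_diff1 a b : ev (diff1 a b) 0 = 0.
Proof.
by rewrite /diff1 /rho /sqnorm !(evD, evM, evN, evMn, ev0, ev1, ev_origin); ev_ring.
Qed.

(** At the origin the Laplacians of [rho a b *+ 2] and of [r2 * dv a b] are both four times the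
    divergence. *)
Lemma ev_lap_diff1 a b : ev (lap (diff1 a b)) 0 = 0.
Proof.
(* The divergence is kept opaque so that its own derivatives are not expanded; they are multiplied
   by functions vanishing at the origin. *)
have [D ED] : exists D, D = dv a b by exists (dv a b).
rewrite /lap /diff1 /rho -ED.
rewrite /sqnorm !ddE !(evD, evM, evN, evMn, ev0, ev1, ev_origin) ED /dv evD; ev_ring.
Qed.

Lemma ham_eq0 f : ham0 f = 0 -> ham1 f = 0 -> f = sc (ev f 0).
Proof.
move=> /eqP; rewrite oppr_eq0 => /eqP /r2_cancel h1 /r2_cancel h0.
by apply: Ed_eq0; rewrite /Ed h0 h1 !mulr0 addr0.
Qed.

(** The divergence in polar coordinates, cleared of denominators. *)
Lemma Ed_rho a b : Ed (rho a b) + th (tau a b) = r2 * dv a b.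
Proof. by rewrite /Ed /th /rho /tau /dv /sqnorm !ddE; ring. Qed.

(** On the axis x = 0 the hypothesis reads [y * b = 0], so Hadamard's lemma divides [b] by [x];
    cancelling [x] in the hypothesis then determines [a]. *)
Lemma tangential a b : rho a b = 0 -> exists l, a = - (yy * l) /\ b = xx * l.
Proof.
move=> ab.
have [l bl] : exists l, b = xx * l.
  apply: hadamard => y.
  have H z : z != 0 -> ev b (pt 0 z) = 0.
    move=> z0; have : ev (rho a b) (pt 0 z) = 0 by rewrite ab.
    by rewrite /rho !evE pt0 pt1 mul0r add0r => /eqP; rewrite mulf_eq0 (negPf z0) => /eqP.
  have [->|] := eqVneq y 0; last exact: H.
  apply: (@ev_dense _ _ _ 'e_1) => t t0.
  rewrite (_ : _ + _ = pt 0 t); first by apply: H; rewrite gt_eqF.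
  by apply: rV2P; rewrite !mxE /=; ring.
exists l; split=> //; apply/eqP; rewrite -addr_eq0; apply/eqP/xx_cancel.
by rewrite -ab /rho bl; ring.
Qed.

(* The push-forward of [(a0, b0)] by [inv] is [(a1, b1)], in radial and angular
   components: both [x d/dx + y d/dy] and [x d/dy - y d/dx] change sign under [inv]. *)
Definition gluedV a0 b0 a1 b1 : Prop := forall w, w != 0 ->
  ev (rho a1 b1) (inv w) = - ev (rho a0 b0) w / ev r2 w ^+ 2 /\
  ev (tau a1 b1) (inv w) = - ev (tau a0 b0) w / ev r2 w ^+ 2.

Lemma gluedVD a0 b0 a1 b1 a0' b0' a1' b1' :
  gluedV a0 b0 a1 b1 -> gluedV a0' b0' a1' b1' ->
  gluedV (a0 + a0') (b0 + b0') (a1 + a1') (b1 + b1').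
Proof.
move=> H H' w w0; have [r t] := H w w0; have [r' t'] := H' w w0.
have rD a b a' b' v : ev (rho (a + a') (b + b')) v = ev (rho a b) v + ev (rho a' b') v.
  by rewrite /rho !(evD, evM); ev_ring.
have tD a b a' b' v : ev (tau (a + a') (b + b')) v = ev (tau a b) v + ev (tau a' b') v.
  by rewrite /tau !(evD, evM, evN); ev_ring.
by rewrite !rD !tD r t r' t'; split; ev_ring.
Qed.

Lemma rho_ham f : rho (ham0 f) (ham1 f) = - (r2 * th f).
Proof. by rewrite /rho /ham0 /ham1 /th; ring. Qed.

Lemma tau_ham f : tau (ham0 f) (ham1 f) = r2 * Ed f.
Proof. by rewrite /tau /ham0 /ham1 /Ed; ring. Qed.

Lemma gluedV_ham f0 f1 : glued 1 f0 f1 ->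
  gluedV (ham0 f0) (ham1 f0) (ham0 f1) (ham1 f1).
Proof.
move=> H w w0; rewrite !rho_ham !tau_ham !evN !evM r2_inv //.
have n0 : ev r2 w != 0 by rewrite r2_eq0.
by rewrite (glued_Ed H) // (glued_th H) //; split; field.
Qed.

Lemma halfK : sc 2^-1 *+ 2 = 1 :> SF.
Proof. by apply: SFext => w; rewrite evMn ev_sc ev1; field. Qed.

Lemma glued_eq0 c f1 : glued c 0 f1 -> f1 = 0.
Proof.
move=> H; apply: dense_neq0 => w w0.
by rewrite -(invK w0) H ?inv_neq0 // ev0 mulr0.
Qed.

(* Subtracting the Hamiltonian field of [Lop (div / 2)] makes the field tangent to the
   circles around the origin, i.e. [l (x d/dy - y d/dx)] with [l] radial and [l(0) = 0];
   it is then the Hamiltonian field of a radial primitive of [l]. *)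
Lemma exact1 a0 b0 a1 b1 : gluedV a0 b0 a1 b1 ->
  diff1 a0 b0 = 0 -> diff1 a1 b1 = 0 ->
  ev (dv a0 b0) 0 = 0 -> ev (curl a0 b0) 0 = 0 -> ev (curl a1 b1) 0 = 0 ->
  exists f0 f1, [/\ glued 1 f0 f1, a0 = ham0 f0, b0 = ham1 f0, a1 = ham0 f1 & b1 = ham1 f1].
Proof.
move=> gV d0 d1 dv0 cu0 cu1.
pose D a b : SF := sc 2^-1 * dv a b.
have DE a b : dv a b = D a b *+ 2 by rewrite /D -mulrnAl halfK mul1r.
have two_cancel f : f *+ 2 = 0 -> f = 0.
  by move=> h; rewrite -[f]mul1r -halfK mulrnAl -mulrnAr h mulr0.
have rhoD a b : diff1 a b = 0 -> rho a b = r2 * D a b.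
  rewrite /diff1 DE => h; apply/eqP; rewrite -subr_eq0; apply/eqP/two_cancel.
  by rewrite -h; ring.
have gD : glued (-1) (D a0 b0) (D a1 b1).
  move=> w w0; have [r _] := gV w w0; have n0 : ev r2 w != 0 by rewrite r2_eq0.
  move: r; rewrite !rhoD // !(evM r2) r2_inv // => r.
  by rewrite -[LHS](mulVKf n0) r; field.
(* With [rho = r2 * D], the polar formula reads [r2 * (D *+ 2) = Ed (r2 * D) + th tau], and the
   terms without derivatives of [D] cancel. *)
have r2ED a b : diff1 a b = 0 -> r2 * Ed (D a b) = th (- tau a b).
  move=> h; have := Ed_rho a b; rewrite (rhoD _ _ h) DE => e.
  have -> : th (- tau a b) = - th (tau a b) by rewrite /th !ddE; ring.
  have -> : th (tau a b) = r2 * (D a b *+ 2) - Ed (r2 * D a b) by rewrite -e; ring.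
  by rewrite /Ed /sqnorm !ddE; ring.
have s1 : sign1 (1 : R) by left.
have sN1 : sign1 (-1 : R) by right.
(* Averaging kills the [th]-derivative on the right of [r2ED], so the average of [D] is a constant,
   namely its value at the origin. *)
have M0 : Mop 1 (D a0 b0) = 0.
  have : Ed (Mop 1 (D a0 b0)) = 0.
    by apply: r2_cancel; rewrite Mop_Ed -Mop_r2 r2ED // Mop_th.
  by move/Ed_eq0 ->; rewrite ev_Mop0 /D evM dv0 mulr0 sc0.
(* Averages are compatible with the gluing, so the vanishing passes to the other chart; this is why
   the divergence is tested at one origin only. *)
have M1 : Mop (-1) (D a1 b1) = 0.
  by have := glued_Mop gD; rewrite M0; exact: glued_eq0.
pose u0 := Lop 1 (D a0 b0); pose u1 := Lop (-1) (D a1 b1).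
have gu : glued 1 u0 u1 by have := glued_Lop gD; rewrite opprK.
have tu0 : th u0 = D a0 b0 by rewrite /u0 th_Lop // M0 subr0.
have tu1 : th u1 = D a1 b1 by rewrite /u1 th_Lop // M1 subr0.
have gV' := gluedVD gV (gluedV_ham gu).
have step a b u : diff1 a b = 0 -> th u = D a b -> ev (curl a b) 0 = 0 ->
    exists l, [/\ a + ham0 u = - (yy * l), b + ham1 u = xx * l, th l = 0 & ev l 0 = 0].
  move=> h tu cu.
  have rho0 : rho (a + ham0 u) (b + ham1 u) = 0.
    transitivity (rho a b + rho (ham0 u) (ham1 u)); first by rewrite /rho; ring.
    by rewrite rho_ham tu (rhoD _ _ h) subrr.
  have [l [la lb]] := tangential rho0.
  (* The modified field is still closed and has no radial component, so its divergence, which is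
     [th l], vanishes. *)
  have tl : th l = 0.
    have : diff1 (a + ham0 u) (b + ham1 u) = 0 by rewrite diff1D h diff1_ham addr0.
    rewrite /diff1 rho0 mul0rn sub0r => /eqP; rewrite oppr_eq0 => /eqP /r2_cancel <-.
    by rewrite la lb /dv /th !ddE; ring.
  exists l; split => //.
  (* The curl of the field (- y l, x l) at the origin is twice l(0). *)
  have : ev (curl (a + ham0 u) (b + ham1 u)) 0 = 0.
    have -> : curl (a + ham0 u) (b + ham1 u) = curl a b + curl (ham0 u) (ham1 u).
      by rewrite /curl !ddE; ring.
    by rewrite evD cu ev_curl_ham addr0.
  rewrite la lb /curl !ddE !(evD, evM, evN, evMn, ev0, ev1, ev_origin).
  by gen_ev; lra.
have [l0 [la0 lb0 tl0 z0]] := step _ _ _ d0 tu0 cu0.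
have [l1 [la1 lb1 tl1 z1]] := step _ _ _ d1 tu1 cu1.
have gl : glued (-1) l0 l1.
  move=> w w0; have [_ t] := gV' w w0; have n0 : ev r2 w != 0 by rewrite r2_eq0.
  have tl l : tau (- (yy * l)) (xx * l) = r2 * l by rewrite /tau /sqnorm; ring.
  move: t; rewrite la0 lb0 la1 lb1 !tl !(evM r2) r2_inv // => t.
  by rewrite -[LHS](mulVKf n0) t; field.
have [h0 [h1 [gh E0 E1 T0 T1]]] := glued_primitive gl tl0 tl1 z0 z1.
have hamh h l : Ed h = l -> th h = 0 -> - (yy * l) = ham0 h /\ xx * l = ham1 h.
  move=> <- t; split.
    transitivity (ham0 h + xx * th h); last by rewrite t mulr0 addr0.
    by rewrite /ham0 /Ed /th /sqnorm; ring.
  transitivity (ham1 h + yy * th h); last by rewrite t mulr0 addr0.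
  by rewrite /ham1 /Ed /th /sqnorm; ring.
have [ha0 hb0] := hamh _ _ E0 T0; have [ha1 hb1] := hamh _ _ E1 T1.
have fin0 a u h l : a + ham0 u = - (yy * l) -> - (yy * l) = ham0 h -> a = ham0 (h - u).
  move=> e1 e2; have -> : ham0 (h - u) = ham0 h - ham0 u by rewrite /ham0 !ddE; ring.
  by rewrite -e2 -e1 addrK.
have fin1 b u h l : b + ham1 u = xx * l -> xx * l = ham1 h -> b = ham1 (h - u).
  move=> e1 e2; have -> : ham1 (h - u) = ham1 h - ham1 u by rewrite /ham1 !ddE; ring.
  by rewrite -e2 -e1 addrK.
exists (h0 - u0), (h1 - u1); split.
- by move=> w w0; rewrite !evB gh // gu //; ev_ring.
- exact: fin0 la0 ha0.
- exact: fin1 lb0 hb0.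
- exact: fin0 la1 ha1.
- exact: fin1 lb1 hb1.
Qed.

End Charts.

(** * Exactness in degree two *)

Section Bivectors.
Variable R : realType.
Local Notation V := 'rV[R]_2.
Local Notation SF := (SF R).
Local Notation xx := (coord_x R).
Local Notation yy := (coord_y R).
Local Notation r2 := (sqnorm R).
Local Notation phi := (inv_sqnorm1 R).
Implicit Types (a b f g h k l m u P : SF) (w : V) (i : 'I_2).

Local Notation q := (1 + r2).

Lemma phi_inv w : w != 0 -> ev phi (inv w) = ev r2 w * ev phi w.
Proof.
move=> w0; have n0 : ev r2 w != 0 by rewrite r2_eq0.
have n1 : 1 + ev r2 w != 0 by have := one_r2_neq0 w; rewrite evD ev1.
have p v : ev phi v = (1 + ev r2 v)^-1 by [].
rewrite !p r2_inv //; move: (ev r2 w) n0 n1 => r n0 n1; field.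
by rewrite n0 n1.
Qed.

Lemma q_inv w : w != 0 -> ev q (inv w) = ev q w / ev r2 w.
Proof.
move=> w0; have n0 : ev r2 w != 0 by rewrite r2_eq0.
have e v : ev q v = 1 + ev r2 v by [].
by rewrite !e r2_inv //; move: (ev r2 w) n0 => r n0; field.
Qed.

(* With [G = (1 + |w|^2)^2 P] this is [(G_y, - G_x)] plus twice the Hamiltonian field of
   [(1 + |w|^2) P]; the second term, which is closed, makes the field extend to
   infinity. *)
Definition fieldA P : SF := dd 1 (q * q * P) - (r2 * dd 1 (q * P)) *+ 2.
Definition fieldB P : SF := - dd 0 (q * q * P) + (r2 * dd 0 (q * P)) *+ 2.

(** The field (G_y, - G_x) is divergence free with [rho] equal to [th G], and [q] is circle
    invariant; the Hamiltonian part contributes zero. *)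
Lemma diff1_field P : diff1 (fieldA P) (fieldB P) = (q * q * th P) *+ 2.
Proof.
rewrite /diff1 /rho /dv /fieldA /fieldB /th /sqnorm !ddE ?ddC.
move: (dd 0 (dd 1 P)) (dd 0 (dd 0 P)) (dd 1 (dd 1 P)) (dd 0 P) (dd 1 P) => *; ring.
Qed.

(** Here [q * (q - r2 *+ 2) = 1 - r2 * r2]. Under inversion this factor is multiplied by
    [- r2 ^- 2], as the gluing of fields requires; this dictates the coefficient 2 of the
    Hamiltonian correction. *)
Lemma rho_field P : rho (fieldA P) (fieldB P) = (1 - r2 * r2) * th P.
Proof.
rewrite /rho /fieldA /fieldB /th /sqnorm !ddE.
move: (dd 0 P) (dd 1 P) => *; ring.
Qed.

Lemma tau_field P : tau (fieldA P) (fieldB P) = - ((r2 * P) *+ 4 + (1 - r2 * r2) * Ed P).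
Proof.
rewrite /tau /fieldA /fieldB /Ed /sqnorm !ddE.
move: (dd 0 P) (dd 1 P) => *; ring.
Qed.

Lemma gluedV_field P0 P1 : glued (-1) P0 P1 ->
  gluedV (fieldA P0) (fieldB P0) (fieldA P1) (fieldB P1).
Proof.
move=> H w w0; have n0 : ev r2 w != 0 by rewrite r2_eq0.
have e1 P v : ev ((1 - r2 * r2) * P) v = (1 - ev r2 v * ev r2 v) * ev P v.
  by rewrite (evM (1 - r2 * r2)) (evB 1) ev1 (evM r2 r2).
have e2 P v : ev (- ((r2 * P) *+ 4 + (1 - r2 * r2) * Ed P)) v =
    - ((ev r2 v * ev P v) *+ 4 + (1 - ev r2 v * ev r2 v) * ev (Ed P) v).
  by rewrite (evN (_ + _)) (evD (_ *+ 4)) evMn e1 (evM r2 P).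
rewrite !rho_field !tau_field !e1 !e2 r2_inv //.
rewrite (glued_Ed H) // (glued_th H) // H //.
move: (ev P0 w) (ev (Ed P0) w) (ev (th P0) w) (ev r2 w) n0 => p e t r n0.
by split; field.
Qed.

(** The factor is the Jacobian determinant of w |-> 1/w, equal to |w|^-4. *)
Definition gluedB g0 g1 : Prop :=
  forall w, w != 0 -> ev g1 (inv w) = ev g0 w / ev r2 w ^+ 2.

Lemma gluedB_r2 k0 k1 : gluedB (r2 * k0) (r2 * k1) -> glued 1 k0 k1.
Proof.
move=> H w w0; have n0 : ev r2 w != 0 by rewrite r2_eq0.
move: (H w w0); rewrite !(evM r2) r2_inv // => e.
rewrite -[LHS](mulVKf n0) e; move: (ev k0 w) (ev r2 w) n0 => p r n0; field.
exact: n0.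
Qed.

Lemma lapD f h : lap (f + h) = lap f + lap h.
Proof. by rewrite /lap !ddE; ring. Qed.

Lemma ev_lap_r2 k : ev (lap (r2 * k)) 0 = ev k 0 *+ 4.
Proof.
rewrite /lap /sqnorm !ddE !(evD, evM, evN, evMn, ev0, ev1, ev_origin).
by ev_ring.
Qed.

(* After dividing by [(1 + |w|^2)^2] a bivector becomes a function on the sphere; its
   part of zero circle average is a coboundary by [diff1_field], and what remains is
   radial and vanishes to fourth order, hence is the differential of a radial field. *)
Lemma exact2 g0 g1 : gluedB g0 g1 -> ev g0 0 = 0 -> ev g1 0 = 0 ->
  ev (lap g0) 0 = 0 -> ev (lap g1) 0 = 0 ->
  exists a0 b0 a1 b1, [/\ gluedV a0 b0 a1 b1, g0 = diff1 a0 b0 & g1 = diff1 a1 b1].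
Proof.
move=> gB z0 z1 Z0 Z1.
(* The factor 1/2 compensates the doubling in [diff1_field]. *)
pose ga g : SF := sc 2^-1 * (phi * phi * g).
have gaK g : (q * q * ga g) *+ 2 = g.
  transitivity ((sc 2^-1 *+ 2) * (phi * q) * (phi * q) * g); first by rewrite /ga; ring.
  by rewrite halfK phiK !mul1r.
have gg : glued 1 (ga g0) (ga g1).
  move=> w w0; have n0 : ev r2 w != 0 by rewrite r2_eq0.
  rewrite /ga !(evM (sc _)) !ev_sc !(evM (phi * phi)) !(evM phi) phi_inv // gB //.
  move: (ev g0 w) (ev phi w) (ev r2 w) n0 => p e r n0; field.
  exact: n0.
have s1 : sign1 (1 : R) by left.
have sN1 : sign1 (-1 : R) by right.
pose P0 := Lop 1 (ga g0); pose P1 := Lop (-1) (ga g1).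
have gP : glued (-1) P0 P1 := glued_Lop gg.
pose mm e g : SF := (q * q * Mop e (ga g)) *+ 2.
have dec e g : sign1 e -> g = diff1 (fieldA (Lop e (ga g))) (fieldB (Lop e (ga g))) + mm e g.
  by move=> se; rewrite diff1_field th_Lop // -[LHS]gaK /mm; ring.
have step e g : sign1 e -> ev g 0 = 0 -> ev (lap g) 0 = 0 ->
    exists k, [/\ mm e g = r2 * k, th k = 0 & ev k 0 = 0].
  move=> se zg Zg.
  have tm : th (mm e g) = 0.
    transitivity ((q * q * th (Mop e (ga g))) *+ 2).
      by rewrite /mm /th /sqnorm !ddE; ring.
    by rewrite th_Mop // mulr0 mul0rn.
  have m0 : ev (mm e g) 0 = 0.
    by move: zg; rewrite {1}(dec e g) // evD ev_diff1 add0r.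
  have [k [mk tk]] := div_r2 tm m0; exists k; split => //.
  (* The coboundary part does not contribute, and the Laplacian of [r2 * k] at the origin is 4
     k(0). *)
  have : ev (lap g) 0 = ev (lap (diff1 (fieldA (Lop e (ga g))) (fieldB (Lop e (ga g))))) 0 + ev (lap (mm e g)) 0.
    by rewrite -(evD (lap _)) -lapD; congr (ev (lap _) 0); exact: dec.
  rewrite Zg ev_lap_diff1 add0r mk ev_lap_r2 => /esym /eqP; rewrite mulrn_eq0 /= => /eqP.
  exact.
have [k0 [mk0 tk0 kz0]] := step 1 g0 s1 z0 Z0.
have [k1 [mk1 tk1 kz1]] := step (-1) g1 sN1 z1 Z1.
have gk : glued 1 k0 k1.
  apply: gluedB_r2; rewrite -mk0 -mk1 => w w0; have n0 : ev r2 w != 0 by rewrite r2_eq0.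
  rewrite /mm !evMn !(evM (q * q)) !(evM q) !q_inv // (glued_Mop gg) //.
  move: (ev q w) (ev (Mop 1 _) w) (ev r2 w) n0 => p e r n0; field.
  exact: n0.
(* The Euler field multiplied by [h] has differential [- (r2 * Ed h)]. As the Euler field changes
   sign in the other chart, the equations are [Ed h0 = - k0] and [Ed h1 = k1], with data of the
   parity that [glued_primitive] takes. *)
have gl : glued (-1) (- k0) k1 by move=> w w0; rewrite gk // evN; ev_ring.
have tN : th (- k0) = 0 by rewrite -[RHS]oppr0 -[in RHS]tk0 /th !ddE; ring.
have zN : ev (- k0) 0 = 0 by rewrite evN kz0 oppr0.
have [h0 [h1 [gh E0 E1 T0 T1]]] := glued_primitive gl tN tk1 zN kz1.
have gY : gluedV (xx * h0) (yy * h0) (- (xx * h1)) (- (yy * h1)).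
  move=> w w0; have n0 : ev r2 w != 0 by rewrite r2_eq0.
  have -> : rho (xx * h0) (yy * h0) = r2 * h0 by rewrite /rho /sqnorm; ring.
  have -> : rho (- (xx * h1)) (- (yy * h1)) = - (r2 * h1) by rewrite /rho /sqnorm; ring.
  have -> : tau (xx * h0) (yy * h0) = 0 by rewrite /tau; ring.
  have -> : tau (- (xx * h1)) (- (yy * h1)) = 0 by rewrite /tau; ring.
  rewrite evN !(evM r2) r2_inv // gh // !ev0.
  by move: (ev h0 w) (ev r2 w) n0 => p r n0; split; field.
exists (fieldA P0 + xx * h0), (fieldB P0 + yy * h0), (fieldA P1 - xx * h1), (fieldB P1 - yy * h1).
split; first exact: gluedVD (gluedV_field gP) gY.
- rewrite diff1D {1}(dec 1 g0) // mk0; congr (_ + _).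
  transitivity (- (r2 * Ed h0)); first by rewrite E0; ring.
  by rewrite /diff1 /rho /dv /Ed /sqnorm !ddE; ring.
- rewrite diff1D {1}(dec (-1) g1) // mk1; congr (_ + _).
  transitivity (r2 * Ed h1); first by rewrite E1.
  by rewrite /diff1 /rho /dv /Ed /sqnorm !ddE; ring.
Qed.

End Bivectors.

(** * Multivectors on the plane in components *)

Section Tensors.
Variable R : realType.
Local Notation V := 'rV[R]_2.
Local Notation SF := (SF R).
Local Notation xx := (coord_x R).
Local Notation yy := (coord_y R).
Local Notation r2 := (sqnorm R).
Local Notation eps := (eps R).
Implicit Types (a b f g h k l m u : SF) (w : V) (i : 'I_2).

Definition T0 f : tensor R 2 := fun K => if K is [::] then ev f else 0.
Definition T1 a b : tensor R 2 := fun K =>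
  if K is [:: i] then ev (if i == 0 then a else b) else 0.
Definition T2 g : tensor R 2 := fun K =>
  if K is [:: i; j] then ev (sc (eps i j) * g) else 0.

Lemma affine_PiE : @affine_Pi R = T2 r2.
Proof. by apply/funext => -[|a [|b [|c K]]]; apply/funext. Qed.

Lemma permute0 (T : Type) (s : 'S_(size (@nil T))) : permute s = [::].
Proof. by apply: size0nil; rewrite size_map size_enum_ord. Qed.

Lemma permute1 (T : Type) (a : T) (s : 'S_(size [:: a])) : permute s = [:: a].
Proof.
rewrite /permute /= enum_ordSl /= (_ : enum 'I_0 = [::]) /=; last first.
  by apply/size0nil; rewrite size_enum_ord.
by congr [:: _]; case: (s _) => -[].
Qed.

Lemma permute2 (T : Type) (a b : T) (s : 'S_2) :
  permute (s : 'S_(size [:: a; b])) = [:: tnth [tuple a; b] (s 0); tnth [tuple a; b] (s 1)].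
Proof.
rewrite /permute /= enum_ordSl /= enum_ordSl /= (_ : enum 'I_0 = [::]) /=; last first.
  by apply/size0nil; rewrite size_enum_ord.
congr [:: _; _]; first by congr (tnth _ (s _)); apply: val_inj.
by congr (tnth _ (s _)); apply: val_inj.
Qed.

Lemma S1_unique (s : 'S_1) : s = 1%g.
Proof. by apply/permP => i; rewrite perm1 (ord1 (s i)) (ord1 i). Qed.

Lemma S0_unique (s : 'S_0) : s = 1%g.
Proof. by apply/permP => -[]. Qed.

Lemma sum_S1 (F : 'S_1 -> R) : \sum_s F s = F 1%g.
Proof.
rewrite (bigD1 (1%g : 'S_1)) //= big1 ?addr0 // => s.
by rewrite (S1_unique s) eqxx.
Qed.

Lemma sum_S2 (F : 'S_2 -> R) : \sum_s F s = F 1%g + F (tperm 0 1).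
Proof.
have n : tperm 0 1 != 1%g :> 'S_2.
  by apply/eqP => /permP /(_ 0); rewrite tpermL perm1.
rewrite (bigD1 (1%g : 'S_2)) //= (bigD1 (tperm 0 1)) //= big1 ?addr0 // => s.
by case: (perm_ord2 s) => ->; rewrite eqxx ?andbF.
Qed.

Lemma multivector_T0 f : multivector 0 (T0 f).
Proof.
split=> [[|a K]|[|a K] s x|[|a K]] //.
- by rewrite permute0 (S0_unique s) odd_perm1 mul1r.
- have Z L : size L != 0%N -> T0 f L x = 0 by case: L.
  by rewrite !Z ?mulr0 // size_map size_enum_ord.
- exact: ev_smooth.
- exact: smooth0.
Qed.

Lemma multivector_T1 a b : multivector 1 (T1 a b).
Proof.
split=> [[|i [|j K]]|K s x|[|i [|j K]]] //; try exact: smooth0; last exact: ev_smooth.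
have [K1|K1] := eqVneq (size K) 1%N; last first.
  have Z L : size L != 1%N -> T1 a b L x = 0 by case: L => [|? [|? ?]].
  by rewrite !Z ?mulr0 // size_map size_enum_ord.
case: K K1 s => [|i [|j K]] //= _ s.
by rewrite permute1 (S1_unique s) odd_perm1 mul1r.
Qed.

Lemma multivector_T2 g : multivector 2 (T2 g).
Proof.
split=> [[|i [|j [|k K]]]|K s x|[|i [|j [|k K]]]] //; try exact: smooth0; last exact: ev_smooth.
have [K2|K2] := eqVneq (size K) 2%N; last first.
  have Z L : size L != 2%N -> T2 g L x = 0 by case: L => [|? [|? [|? ?]]].
  by rewrite !Z ?mulr0 // size_map size_enum_ord.
case: K K2 s => [|i [|j [|k K]]] //= _ s.
rewrite permute2; case: (perm_ord2 s) => ->.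
  by rewrite !perm1 odd_perm1 expr0 mul1r.
rewrite tpermL tpermR odd_tperm /= expr1 mulN1r !(evM (sc _)) !ev_sc -mulNr; congr (_ * _).
by rewrite /Defs.eps opprB.
Qed.

Lemma multivector0E (P : tensor R 2) : multivector 0 P -> exists f, P = T0 f.
Proof.
move=> [P0 _ Ps]; exists (mkSF (Ps [::])); apply/funext => -[|a K]; apply/funext => w //.
by rewrite P0.
Qed.

Lemma multivector1E (P : tensor R 2) : multivector 1 P -> exists a b, P = T1 a b.
Proof.
move=> [P0 _ Ps]; exists (mkSF (Ps [:: 0])), (mkSF (Ps [:: 1])).
apply/funext => -[|i [|j K]]; apply/funext => w; try by rewrite P0.
by have [->|->] := ord2P i.
Qed.

Lemma multivector2E (P : tensor R 2) : multivector 2 P -> exists g, P = T2 g.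
Proof.
move=> [P0 Pa Ps]; exists (mkSF (Ps [:: 0; 1])).
have sw i j w : P [:: j; i] w = - P [:: i; j] w.
  have := Pa [:: i; j] (tperm 0 1 : 'S_2) w.
  by rewrite permute2 tpermL tpermR odd_tperm /= expr1 mulN1r.
apply/funext => -[|i [|j [|k K]]]; apply/funext => w; try by rewrite P0.
rewrite /T2 (evM (sc _)) ev_sc ev_mk /Defs.eps.
have [->|->] := ord2P i; have [->|->] := ord2P j; rewrite /= ?subr0 ?subrr ?sub0r ?mul0r ?mul1r ?mulN1r //.
- by have := sw 0 0 w; lra.
- by have := sw 1 1 w; lra.
Qed.

(** More than two indices repeat one; exchanging the two equal entries fixes the index list and
    changes the sign of the component. *)
Lemma multivector_eq0 n (P : tensor R 2) : (2 < n)%N -> multivector n P -> P = 0.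
Proof.
move=> n2 [P0 Pa _]; apply/funext => K; apply/funext => w.
have [Kn|Kn] := eqVneq (size K) n; last by rewrite P0.
have : ~~ injectiveb (tnth (in_tuple K)).
  by apply/negP => /injectiveP /leq_card; rewrite !card_ord Kn leqNgt n2.
move=> /injectivePn [p [q pq e]].
have := Pa K (tperm p q) w; rewrite odd_tperm pq expr1 mulN1r.
have -> : permute (tperm p q) = K.
  rewrite -[RHS](map_tnth_enum (in_tuple K)); apply: eq_map => i.
  by case: tpermP => [->|->|] //; rewrite -e.
transitivity (0 : R) => //; lra.
Qed.

End Tensors.

(** * Schouten brackets and tensor transformation laws in components *)

Section ProjectiveCharts.
Variable R : realType.
Local Notation V := 'rV[R]_2.
Local Notation SF := (SF R).
Local Notation xx := (coord_x R).
Local Notation yy := (coord_y R).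
Local Notation r2 := (sqnorm R).
Local Notation eps := (eps R).
Implicit Types (a b f g h k l m u : SF) (w : V) (i j : 'I_2).

Lemma partial_ev i f w : partial i (ev f) w = ev (dd i f) w. Proof. by []. Qed.

Lemma sum_I2 (F : 'I_2 -> R) : \sum_i F i = F 0 + F 1.
Proof.
by rewrite !big_ord_recl big_ord0 addr0; congr (F _ + F _); apply: val_inj.
Qed.

Lemma epsE : (eps 0 0 = 0) * (eps 0 1 = 1) * (eps 1 0 = -1) * (eps 1 1 = 0).
Proof. by rewrite /Defs.eps /= !subrr subr0 sub0r. Qed.

Lemma factE : ((0`! * 2`!)%N = 2%N) * ((0`! * 1`!)%N = 1%N) * ((1`! * 1`!)%N = 1%N).
Proof. by []. Qed.

Lemma schouten_T0 f : schouten 0 2 (T0 f) (T2 r2) = T1 (ham0 f) (ham1 f).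
Proof.
apply/funext => -[|i [|j K]]; apply/funext => w; rewrite /schouten //=.
rewrite !sum_S1 !permute1 odd_perm1 !sum_I2 /= !partial_ev.
have -> : (0 : V -> R) w = 0 by [].
have ham0E : ev (ham0 f) w = - (ev r2 w * ev (dd 1 f) w).
  by rewrite /ham0 evN (evM r2).
have ham1E : ev (ham1 f) w = ev r2 w * ev (dd 0 f) w by rewrite /ham1 (evM r2).
have [->|->] := ord2P i; rewrite /= !(evM (sc _)) !ev_sc !epsE ?ham0E ?ham1E !factE !expr0;
  move: (partial 0 0 w) (partial 1 0 w) => *;
  move: (ev r2 w) (ev (dd 0 f) w) (ev (dd 1 f) w) => r p q; by field.
Qed.

Lemma schouten12E (P Q : tensor R 2) i j w : schouten 1 2 P Q [:: i; j] w =
  2^-1 * ((P [:: 0] w * partial 0 (Q [:: i; j]) w + P [:: 1] w * partial 1 (Q [:: i; j]) w)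
        - (P [:: 0] w * partial 0 (Q [:: j; i]) w + P [:: 1] w * partial 1 (Q [:: j; i]) w))
  - ((Q [:: 0; j] w * partial 0 (P [:: i]) w + Q [:: 1; j] w * partial 1 (P [:: i]) w)
   - (Q [:: 0; i] w * partial 0 (P [:: j]) w + Q [:: 1; i] w * partial 1 (P [:: j]) w)).
Proof.
have p1 : permute (1%g : 'S_(size [:: i; j])) = [:: i; j].
  by rewrite (permute2 i j 1%g) !perm1.
have pt : permute (tperm 0 1 : 'S_(size [:: i; j])) = [:: j; i].
  by rewrite (permute2 i j (tperm 0 1)) tpermL tpermR.
rewrite /schouten /= !sum_S2 !p1 !pt odd_perm1 odd_tperm /= !sum_I2 !factE expr0 !expr1.
rewrite invr1.
repeat match goal with |- context [partial ?c ?f w] => move: (partial c f w) => ? end.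
repeat match goal with |- context [P ?c w] => move: (P c w) => ? end.
repeat match goal with |- context [Q ?c w] => move: (Q c w) => ? end.
ring.
Qed.

(** The Lie derivative of the bivector h d/dx /\ d/dy along the field (a, b). *)
Lemma schouten_T1 a b h :
  schouten 1 2 (T1 a b) (T2 h) = T2 (a * dd 0 h + b * dd 1 h - h * dv a b).
Proof.
apply/funext => -[|i [|j [|l K]]]; apply/funext => w.
- by rewrite /schouten.
- by rewrite /schouten.
2: by rewrite /schouten.
have eT (c : R) g : ev (sc c * g) w = c * ev g w by rewrite evM ev_sc.
have ddr (v : 'I_2) (c : R) : partial v (ev (sc c * h)) w = c * ev (dd v h) w.
  by rewrite partial_ev ddM dd_sc mulr0 addr0 eT.
rewrite schouten12E /T2 /T1 !ddr !eT.
have -> : ev (a * dd 0 h + b * dd 1 h - h * dv a b) w = ev a w * ev (dd 0 h) w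
    + ev b w * ev (dd 1 h) w - ev h w * (ev (dd 0 a) w + ev (dd 1 b) w).
  by rewrite evB evD !evM /dv evD.
have [->|->] := ord2P i; have [->|->] := ord2P j;
  rewrite !epsE [0 == 0]/= [1 == 0]/= !partial_ev;
  repeat match goal with |- context [ev ?f w] => move: (ev f w) => ? end; by field.
Qed.

Lemma diff1E a b : a * dd 0 r2 + b * dd 1 r2 - r2 * dv a b = diff1 a b.
Proof. by rewrite /diff1 /rho /sqnorm !ddE; ring. Qed.

Lemma schouten_T2 g : schouten 2 2 (T2 g) (T2 r2) = 0.
Proof.
apply/funext => K; apply/funext => x; rewrite /schouten; case: eqP => // -[K3].
have [p [q [pq Kpq]]] := pigeon3 K3.
rewrite (@permute_tperm0 R _ _ p q (fun L => \sum_(u < 2) T2 g (u :: take 1 L) x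
   * partial u (T2 r2 (drop 1 L)) x)) //.
rewrite (@permute_tperm0 R _ _ p q (fun L => \sum_(u < 2) T2 r2 (u :: drop 2 L) x
   * partial u (T2 g (take 2 L)) x)) //.
by rewrite !mulr0 addr0.
Qed.

Lemma transition_id i : transition i i = (id : V -> V).
Proof.
apply/funext => y; rewrite /transition /=; apply/rowP => k.
rewrite quotient_mapE !homogE !eqxx !rev_ord2.
by have [->|->] := ord2P k; rewrite /=; field.
Qed.

Lemma transition_inv i j : i != j -> transition i j = (@inv R).
Proof.
move=> ij; have ji : (j == i) = false by rewrite eq_sym (negPf ij).
have ri : rev_ord j = i.
  by apply: val_inj; move: i j ij {ji} => [[|[|]]//= ?] [[|[|]]//= ?].
apply/funext => y; rewrite /transition /=; apply/rowP => k.
rewrite quotient_mapE !homogE ri !eqxx ji /inv ev_r2.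
by have [->|->] := ord2P k; rewrite ?pt0 ?pt1 /=; congr (_ / _); ring.
Qed.

Lemma zcoord_homog i j w : (zcoord j (homog i w) != 0) = (i == j) || (w != 0).
Proof.
rewrite /zcoord !homogE [i == j]eq_sym; have [_|_] := eqVneq j i.
  by rewrite eq_complex /= oner_eq0.
by rewrite eq_complex /= -r2_eq0 ev_r2 paddr_eq0 ?sqr_ge0 // !sqrf_eq0.
Qed.

Lemma partial_id i j w : partial i (fun y : V => (id y) 0 j) w = (j == i)%:R.
Proof.
by rewrite /partial (@derive_val _ _ _ _ _ _ _ (is_derive_coord j w _)) mxE eqxx.
Qed.

(* Jacobian matrix of [w |-> 1 / w]. *)
Definition Jinv w (k c : 'I_2) : R :=
  let r := ev r2 w in
  if k == 0 then
    if c == 0 then (w 0 1 ^+ 2 - w 0 0 ^+ 2) / r ^+ 2 else - (2 * w 0 0 * w 0 1) / r ^+ 2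
  else if c == 0 then (2 * w 0 0 * w 0 1) / r ^+ 2 else (w 0 1 ^+ 2 - w 0 0 ^+ 2) / r ^+ 2.

Lemma partial_inv (c k : 'I_2) w : w != 0 -> partial c (fun y => inv y 0 k) w = Jinv w k c.
Proof.
move=> /neq0_sqr n0.
have -> : (fun y : V => inv y 0 k) = fun y : V => ((-1) ^+ k * y 0 k) / (y 0 0 ^+ 2 + y 0 1 ^+ 2) :> R.
  apply/funext => y; rewrite /inv ev_r2; have [->|->] := ord2P k;
  by rewrite ?pt0 ?pt1 /= ?mul1r ?expr1 ?mulN1r.
rewrite partial_frac1 // /Jinv ev_r2.
by have [->|->] := ord2P k; have [->|->] := ord2P c; rewrite /=; field.
Qed.

Section Related.
Variables (F : V -> V) (w : V) (J : 'I_2 -> 'I_2 -> R).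
Hypothesis HJ : forall k c : 'I_2, partial c (fun y => F y 0 k) w = J k c.

Lemma sum_tuple0 (G : 0.-tuple 'I_2 -> R) : \sum_b G b = G [tuple].
Proof.
rewrite (bigD1 [tuple]) //= big1 ?addr0 // => b /eqP nb.
by case: nb; exact: tuple0.
Qed.

Lemma sum_tuple1 (G : 1.-tuple 'I_2 -> R) : \sum_b G b = \sum_i G [tuple i].
Proof.
rewrite (reindex (fun i : 'I_2 => [tuple i])) //=.
exists (fun t : 1.-tuple 'I_2 => tnth t 0) => [i _|b _] //=.
by apply: val_inj; case: b => [[|a [|b s]] h].
Qed.

Lemma related_T0 f g : related F (T0 f) (T0 g) w <-> ev g (F w) = ev f w.
Proof.
split=> [/(_ [::])|H [|c K]]; rewrite /= ?sum_tuple0 ?big_ord0 ?mul1r //.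
by rewrite big1 // => -[[|d L] //= e] _; rewrite mulr0.
Qed.

Lemma related_T1 a b a' b' : related F (T1 a b) (T1 a' b') w <->
  (ev a' (F w) = J 0 0 * ev a w + J 0 1 * ev b w) /\
  (ev b' (F w) = J 1 0 * ev a w + J 1 1 * ev b w).
Proof.
have E (c : 'I_2) : \sum_(t : (size [:: c]).-tuple 'I_2) (\prod_(l < size [:: c])
    partial (tnth t l) (fun y => F y 0 (tnth (in_tuple [:: c]) l)) w) * T1 a b t w
    = J c 0 * ev a w + J c 1 * ev b w.
  rewrite sum_tuple1 sum_I2 !big_ord_recl !big_ord0 !mulr1 /= /tnth /=.
  by rewrite !HJ.
split=> [H|[H0 H1] [|c [|d K]]].
- by have := H [:: 0]; have := H [:: 1]; rewrite !E.
- by rewrite /= sum_tuple0 mulr0.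
- by rewrite E; have [->|->] := ord2P c.
- by rewrite big1 // => -[[|x [|y s]] //= e] _; rewrite mulr0.
Qed.

Lemma related_T2 g g' : related F (T2 g) (T2 g') w <->
  ev g' (F w) = (J 0 0 * J 1 1 - J 0 1 * J 1 0) * ev g w.
Proof.
have E (c d : 'I_2) : \sum_(t : (size [:: c; d]).-tuple 'I_2) (\prod_(l < size [:: c; d])
    partial (tnth t l) (fun y => F y 0 (tnth (in_tuple [:: c; d]) l)) w) * T2 g t w
    = eps c d * ((J 0 0 * J 1 1 - J 0 1 * J 1 0) * ev g w).
  rewrite sum_tuple2 !sum_I2 !big_ord_recl !big_ord0 !mulr1 /= /tnth /= !HJ.
  rewrite !(evM (sc _)) !ev_sc !epsE; move: (ev g w) => r.
  by have [->|->] := ord2P c; have [->|->] := ord2P d; rewrite !epsE; ring.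
split=> [H|H [|c [|d [|e K]]]].
- by have := H [:: 0; 1]; rewrite E /= (evM (sc _)) ev_sc epsE !mul1r.
- by rewrite /= sum_tuple0 mulr0.
- by rewrite big1 // => -[[|x [|y s]] //= e'] _; rewrite mulr0.
- by rewrite E /= (evM (sc _)) ev_sc H.
- by rewrite big1 // => -[[|x [|y [|z s]]] //= e'] _; rewrite mulr0.
Qed.

End Related.

End ProjectiveCharts.

(** * Multivectors on the projective line as glued pairs of chart expressions *)

Section GlobalMultivectors.
Variable R : realType.
Local Notation V := 'rV[R]_2.
Local Notation SF := (SF R).
Local Notation r2 := (sqnorm R).
Implicit Types (a b f g h u : SF) (w : V) (i j : 'I_2).

Definition W0 f0 f1 : cp1_tensor R := fun j => T0 (if j == 0 then f0 else f1).
Definition W1 a0 b0 a1 b1 : cp1_tensor R := fun j => if j == 0 then T1 a0 b0 else T1 a1 b1.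
Definition W2 g0 g1 : cp1_tensor R := fun j => T2 (if j == 0 then g0 else g1).

Lemma cp1_multivector_mk n (W : cp1_tensor R) : (forall j, multivector n (W j)) ->
  (forall w, w != 0 -> related (@inv R) (W 0) (W 1) w) ->
  (forall w, w != 0 -> related (@inv R) (W 1) (W 0) w) ->
  (forall j w, related id (W j) (W j) w) -> cp1_multivector n W.
Proof.
move=> mW h01 h10 hid; split=> // i j w; rewrite zcoord_homog.
have [<- _|ij /= w0] := eqVneq i j; first by rewrite transition_id.
rewrite transition_inv //.
by have [ei|ei] := ord2P i; have [ej|ej] := ord2P j; move: ij; rewrite ei ej ?eqxx // => _;
  [exact: h01 | exact: h10].
Qed.

Lemma cp1_multivector_inv n (W : cp1_tensor R) : cp1_multivector n W ->
  forall w, w != 0 -> related (@inv R) (W 0) (W 1) w.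
Proof.
move=> [_ h] w w0; have := h 0 1 w; rewrite zcoord_homog w0 => /(_ isT).
by rewrite transition_inv.
Qed.

Lemma glued_sym f0 f1 : glued 1 f0 f1 -> glued 1 f1 f0.
Proof. by move=> H w w0; rewrite -{2}(invK w0) H ?inv_neq0 // !mul1r. Qed.

Lemma cp1_multivector0P (W : cp1_tensor R) : cp1_multivector 0 W <->
  exists f0 f1, W = W0 f0 f1 /\ glued 1 f0 f1.
Proof.
split=> [mW|[f0 [f1 [-> gf]]]].
  have [f0 e0] := multivector0E (mW.1 0); have [f1 e1] := multivector0E (mW.1 1).
  exists f0, f1; split.
    by apply/funext => j; have [->|->] := ord2P j.
  move=> w w0; have := cp1_multivector_inv mW w0.
  by rewrite e0 e1 => /related_T0 ->; rewrite mul1r.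
apply: cp1_multivector_mk => [j|w w0|w w0|j w]; first exact: multivector_T0.
- by apply/related_T0; rewrite /= gf // mul1r.
- by apply/related_T0; rewrite /= (glued_sym gf) // mul1r.
- by apply/related_T0.
Qed.

Lemma gluedB_sym g0 g1 : gluedB g0 g1 -> gluedB g1 g0.
Proof.
move=> H w w0; have n0 : ev r2 w != 0 by rewrite r2_eq0.
have := H _ (inv_neq0 w0); rewrite invK // r2_inv // => ->.
move: (ev g0 (inv w)) (ev r2 w) n0 => p r n0; field.
exact: n0.
Qed.

Lemma det_Jinv w : w != 0 ->
  Jinv w 0 0 * Jinv w 1 1 - Jinv w 0 1 * Jinv w 1 0 = (ev r2 w ^+ 2)^-1.
Proof. by move=> /neq0_sqr n0; rewrite /Jinv /= ev_r2; field. Qed.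

Lemma cp1_multivector2P (W : cp1_tensor R) : cp1_multivector 2 W <->
  exists g0 g1, W = W2 g0 g1 /\ gluedB g0 g1.
Proof.
split=> [mW|[g0 [g1 [-> gB]]]].
  have [g0 e0] := multivector2E (mW.1 0); have [g1 e1] := multivector2E (mW.1 1).
  exists g0, g1; split.
    by apply/funext => j; have [->|->] := ord2P j.
  move=> w w0; have := cp1_multivector_inv mW w0; rewrite e0 e1.
  move=> /(related_T2 (J := Jinv w)) -> => [|k c]; last exact: partial_inv.
  by rewrite det_Jinv // mulrC.
apply: cp1_multivector_mk => [j|w w0|w w0|j w]; first exact: multivector_T2.
- apply/(related_T2 (J := Jinv w)) => [k c|]; first exact: partial_inv.
  by rewrite /= gB // det_Jinv // mulrC.
- apply/(related_T2 (J := Jinv w)) => [k c|]; first exact: partial_inv.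
  by rewrite /= (gluedB_sym gB) // det_Jinv // mulrC.
- apply/(related_T2 (J := fun k c => (k == c)%:R)) => [k c|]; first exact: partial_id.
  by rewrite /= mulr1 mulr0 subr0 mul1r.
Qed.

(** The second pair of equations is the first multiplied by the matrix with rows (x/r, - y/r) and
    (y/r, x/r). Its determinant is 1/r, and the inverse, with rows (x, y) and (- y, x), recovers a'
    and b'. *)
Lemma polar_components (x y a b a' b' : R) : let r := x ^+ 2 + y ^+ 2 in r != 0 ->
  (a' = (y ^+ 2 - x ^+ 2) / r ^+ 2 * a + - (2 * x * y) / r ^+ 2 * b /\
   b' = (2 * x * y) / r ^+ 2 * a + (y ^+ 2 - x ^+ 2) / r ^+ 2 * b) <->
  (x / r * a' + - y / r * b' = - (x * a + y * b) / r ^+ 2 /\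
   x / r * b' - - y / r * a' = - (x * b - y * a) / r ^+ 2).
Proof.
move=> r r0; split=> [[-> ->]|[e1 e2]]; first by rewrite /r; split; field.
have A : a' = x * (x / r * a' + - y / r * b') + y * (x / r * b' - - y / r * a').
  by rewrite /r; field.
have B : b' = - y * (x / r * a' + - y / r * b') + x * (x / r * b' - - y / r * a').
  by rewrite /r; field.
by split; [rewrite A | rewrite B]; rewrite e1 e2 /r; field.
Qed.

Lemma gluedV_components a0 b0 a1 b1 w : w != 0 ->
  (ev a1 (inv w) = Jinv w 0 0 * ev a0 w + Jinv w 0 1 * ev b0 w) /\
  (ev b1 (inv w) = Jinv w 1 0 * ev a0 w + Jinv w 1 1 * ev b0 w) <->
  (ev (rho a1 b1) (inv w) = - ev (rho a0 b0) w / ev r2 w ^+ 2 /\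
   ev (tau a1 b1) (inv w) = - ev (tau a0 b0) w / ev r2 w ^+ 2).
Proof.
move=> /neq0_sqr w0.
have rE a b v : ev (rho a b) v = v 0 0 * ev a v + v 0 1 * ev b v by [].
have tE a b v : ev (tau a b) v = v 0 0 * ev b v - v 0 1 * ev a v by [].
rewrite !rE !tE /Jinv [0 == 0]/= [1 == 0]/= {3 4 7 8}/inv !pt0 !pt1 !ev_r2.
exact: polar_components.
Qed.

Lemma gluedV_sym a0 b0 a1 b1 : gluedV a0 b0 a1 b1 -> gluedV a1 b1 a0 b0.
Proof.
move=> H w w0; have n0 : ev r2 w != 0 by rewrite r2_eq0.
have := H _ (inv_neq0 w0); rewrite invK // r2_inv // => -[-> ->].
move: (ev (rho a0 b0) (inv w)) (ev (tau a0 b0) (inv w)) (ev r2 w) n0 => p q r n0.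
by split; field.
Qed.

Lemma cp1_multivector1P (W : cp1_tensor R) : cp1_multivector 1 W <->
  exists a0 b0 a1 b1, W = W1 a0 b0 a1 b1 /\ gluedV a0 b0 a1 b1.
Proof.
split=> [mW|[a0 [b0 [a1 [b1 [-> gV]]]]]].
  have [a0 [b0 e0]] := multivector1E (mW.1 0); have [a1 [b1 e1]] := multivector1E (mW.1 1).
  exists a0, b0, a1, b1; split.
    by apply/funext => j; have [->|->] := ord2P j.
  move=> w w0; have := cp1_multivector_inv mW w0; rewrite e0 e1.
  move=> /(related_T1 (J := Jinv w)) H; apply/gluedV_components => //.
  by apply: H => k c; exact: partial_inv.
apply: cp1_multivector_mk => [j|w w0|w w0|j w].
- by have [->|->] := ord2P j; exact: multivector_T1.
- apply/(related_T1 (J := Jinv w)) => [k c|]; first exact: partial_inv.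
  by apply/gluedV_components => //; exact: gV.
- apply/(related_T1 (J := Jinv w)) => [k c|]; first exact: partial_inv.
  by apply/gluedV_components => //; exact: gluedV_sym gV _ w0.
- rewrite /W1; case: ifP => _;
    (apply/(related_T1 (J := fun k c => (k == c)%:R)) => [k c|]; first exact: partial_id);
    by rewrite /= !mul1r !mul0r addr0 add0r.
Qed.

End GlobalMultivectors.

(** * Cohomology spaces identified through a surjective linear map with known kernel *)

Section QuotientIsomorphism.
Local Open Scope quotient_scope.
Variables (R : pzRingType) (U : lmodType R) (B : zmodClosed U).
Variable BZ : GRing.scaler_closed B.
Variables (n : nat) (G : {linear U -> 'rV[R]_n}).
Hypothesis kerG : forall v, G v = 0 <-> v \in B.
Hypothesis surjG : forall r, exists v, G v = r.
Local Notation Q := (lquot BZ).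

Definition lquot_map (q : Q) : 'rV[R]_n := G (repr (q : Quotient.quot B)).

Lemma lquot_map_pi (v : U) : lquot_map (\pi_(Quotient.quot B) v) = G v.
Proof.
apply/eqP; rewrite -subr_eq0 /lquot_map -linearB; apply/eqP/kerG.
by rewrite Quotient.idealrBE reprK.
Qed.

Lemma lquot_map_linear : linear lquot_map.
Proof.
move=> a p q; have [u ->] := lquotW p; have [v ->] := lquotW q.
rewrite !lquot_map_pi -linearP.
have -> : a *: (\pi_(Quotient.quot B) u : Q) + (\pi_(Quotient.quot B) v : Q)
    = \pi_(Quotient.quot B) (a *: u + v) :> Q.
  by rewrite Quotient.pi_add; congr (_ + _); exact: lquot_scale_pi.
exact: lquot_map_pi.
Qed.

HB.instance Definition _ := GRing.isLinear.Build R Q 'rV[R]_n _ lquot_map lquot_map_linear.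

Lemma lquot_isom : isom_Rn Q n.
Proof.
exists lquot_map.
have [s sK] := choice surjG.
exists (fun r => \pi_(Quotient.quot B) (s r) : Q) => [q|r].
  have [u ->] := lquotW q; rewrite /= lquot_map_pi.
  apply/eqP; rewrite -Quotient.idealrBE; apply/kerG.
  by rewrite linearB sK subrr.
by rewrite /= lquot_map_pi sK.
Qed.

End QuotientIsomorphism.

Lemma coboundaryP (R : realType) (P : cp1_tensor R) k (W : cocycles P k) :
  W \in @coboundary R P k <->
  (if k is l.+1 then exists2 Y, cp1_multivector l Y & val W = poisson_diff P l Y
   else val W = 0).
Proof.
case: k W => [|l] W; split.
- by move=> /asboolP ->.
- by move=> W0; apply/asboolP/val_inj.
- by move=> /asboolP.
- by move=> h; apply/asboolP.
Qed.

Section CohomologyIsomorphism.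
Variables (R : realType) (P : cp1_tensor R) (k n : nat) (F : cp1_tensor R -> 'rV[R]_n).
Hypothesis F_lin : forall a W W', cp1_multivector k W -> cp1_multivector k W' ->
  F (a *: W + W') = a *: F W + F W'.
Hypothesis F_ker : forall W, cp1_multivector k W -> poisson_diff P k W = 0 ->
  F W = 0 <-> (if k is l.+1 then exists2 Y, cp1_multivector l Y & W = poisson_diff P l Y
               else W = 0).
Hypothesis F_surj : forall r, exists2 W, W \in cocycle P k & F W = r.

Let G (W : cocycles P k) : 'rV[R]_n := F (val W).

Lemma cocycle_functional_linear : linear G.
Proof.
move=> a W W'; rewrite /G linearP.
by case: W W' => W /= /asboolP[mW _] [W' /= /asboolP[mW' _]]; exact: F_lin.
Qed.

HB.instance Definition _ := GRing.isLinear.Build R (cocycles P k) 'rV[R]_n _ G cocycle_functional_linear.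

(** [F] is defined on all tensor fields, but linearity is asked only on multivectors, since
    functionals given by derivatives at a point are linear only where these derivatives exist; the
    kernel condition concerns cocycles. *)
Lemma cohomology_isom : isom_Rn (poisson_cohomology P k) n.
Proof.
apply: (@lquot_isom R (cocycles P k) (@coboundary R P k) (@coboundaryZ R P k) n G).
  move=> W; have [mW dW] := asboolP _ (valP W).
  by apply: iff_trans (F_ker mW dW) _; apply: iff_sym; exact: coboundaryP.
by move=> r; have [W cW <-] := F_surj r; exists (exist _ W cW).
Qed.

End CohomologyIsomorphism.

(** * Cohomology in degrees zero and one *)

Section Degrees.
Variable R : realType.
Local Notation V := 'rV[R]_2.
Local Notation SF := (SF R).
Local Notation xx := (coord_x R).
Local Notation yy := (coord_y R).
Local Notation r2 := (sqnorm R).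
Local Notation phi := (inv_sqnorm1 R).
Implicit Types (a b f g h u q : SF) (w : V) (i j : 'I_2).

Definition chart_Pi : cp1_tensor R := fun=> T2 r2.

Lemma coinducedE (P : cp1_tensor R) : coinduced P -> P = chart_Pi.
Proof.
move=> cP; apply: (coinduced_unique cP); rewrite /chart_Pi -affine_PiE.
split; last exact: quotient_map_related.
split; last by apply/funext => j; apply: schouten_affine_Pi.
split=> [j|i j w]; first exact: multivector_affine_Pi.
exact: transition_related.
Qed.

Lemma diff_W0 f0 f1 :
  poisson_diff chart_Pi 0 (W0 f0 f1) = W1 (ham0 f0) (ham1 f0) (ham0 f1) (ham1 f1).
Proof.
by apply/funext => j; rewrite /poisson_diff /cp1_schouten schouten_T0 /W1; case: ifP.
Qed.

Lemma diff_W1 a0 b0 a1 b1 :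
  poisson_diff chart_Pi 1 (W1 a0 b0 a1 b1) = W2 (diff1 a0 b0) (diff1 a1 b1).
Proof.
apply/funext => j; rewrite /poisson_diff /cp1_schouten /W1 /W2.
by case: ifP; rewrite schouten_T1 diff1E.
Qed.

Lemma diff_W2 g0 g1 : poisson_diff chart_Pi 2 (W2 g0 g1) = 0.
Proof. by apply/funext => j; exact: schouten_T2. Qed.

Lemma T2_01 g : T2 g [:: 0; 1] = ev g.
Proof. by rewrite /T2 epsE sc1 mul1r. Qed.

Lemma W1_inj a0 b0 a1 b1 a0' b0' a1' b1' : W1 a0 b0 a1 b1 = W1 a0' b0' a1' b1' ->
  [/\ a0 = a0', b0 = b0', a1 = a1' & b1 = b1'].
Proof.
move=> E; have e j i w : W1 a0 b0 a1 b1 j [:: i] w = W1 a0' b0' a1' b1' j [:: i] w by rewrite E.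
split; apply: SFext => w; [exact: (e 0 0)|exact: (e 0 1)|exact: (e 1 0)|exact: (e 1 1)].
Qed.

Lemma W2_inj g0 g1 g0' g1' : W2 g0 g1 = W2 g0' g1' -> g0 = g0' /\ g1 = g1'.
Proof.
move=> E; have e j w : W2 g0 g1 j [:: 0; 1] w = W2 g0' g1' j [:: 0; 1] w by rewrite E.
by split; apply: SFext => w; [have := e 0 w | have := e 1 w]; rewrite /W2 !T2_01.
Qed.

Lemma W1_0 : W1 0 0 0 0 = 0 :> cp1_tensor R.
Proof.
apply/funext => j; apply/funext => -[|i [|l K]]; apply/funext => w; rewrite /W1; case: ifP => // _;
by rewrite /T1 /=; case: ifP.
Qed.

Lemma W2_0 : W2 0 0 = 0 :> cp1_tensor R.
Proof.
apply/funext => j; apply/funext => -[|i [|l [|l' K]]]; apply/funext => w; rewrite /W2 //=.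
by rewrite (evM (sc _)) if_same ev0 mulr0.
Qed.

Lemma W0_0 : W0 0 0 = 0 :> cp1_tensor R.
Proof.
by apply/funext => j; apply/funext => -[|i K]; apply/funext => w; rewrite /W0 ?if_same.
Qed.

Lemma cohomology0 : isom_Rn (poisson_cohomology chart_Pi 0) 1.
Proof.
apply: (@cohomology_isom R chart_Pi 0 1 (fun W => \row_(i < 1) W 0 [::] 0)).
- by move=> a W W' _ _; apply/rowP => i; rewrite !mxE.
- move=> W mW dW.
  have [f0 [f1 [eW gf]]] := iffLR (cp1_multivector0P W) mW.
  split=> [F0|->]; last by apply/rowP => i; rewrite !mxE.
  have z0 : ev f0 0 = 0.
    by have := congr1 (fun r : 'rV[R]_1 => r 0 0) F0; rewrite !mxE eW.
  move: dW; rewrite eW diff_W0 -W1_0 => /W1_inj [h0 h1 _ _].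
  have f00 : f0 = 0 by rewrite (ham_eq0 h0 h1) z0 sc0.
  have f10 : f1 = 0 by move: gf; rewrite f00; exact: glued_eq0.
  rewrite f00 f10 W1_0.
  exact: W0_0.
- move=> r; have hsc c : ham0 (sc c : SF) = 0 /\ ham1 (sc c : SF) = 0.
    by rewrite /ham0 /ham1 !dd_sc mulr0 oppr0.
  exists (W0 (sc (r 0 0)) (sc (r 0 0))).
    apply/asboolP; split.
      by apply/cp1_multivector0P; exists (sc (r 0 0)), (sc (r 0 0)); split => // w w0; rewrite !ev_sc mul1r.
    by rewrite diff_W0 !(hsc _).1 !(hsc _).2 W1_0.
  by apply/rowP => i; rewrite !mxE (ord1 i).
Qed.

Definition obstruction1 (W : cp1_tensor R) : 'rV[R]_3 := \row_(i < 3)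
  [:: partial 0 (W 0 [:: 0]) 0 + partial 1 (W 0 [:: 1]) 0;
      partial 0 (W 0 [:: 1]) 0 - partial 1 (W 0 [:: 0]) 0;
      partial 0 (W 1 [:: 1]) 0 - partial 1 (W 1 [:: 0]) 0]`_i.

Lemma obstruction1_W1 a0 b0 a1 b1 : obstruction1 (W1 a0 b0 a1 b1) =
  \row_(i < 3) [:: ev (dv a0 b0) 0; ev (curl a0 b0) 0; ev (curl a1 b1) 0]`_i.
Proof. by []. Qed.

Lemma row_nth_eq0 n (s : seq R) : size s = n ->
  (\row_(i < n) s`_i = 0) <-> (forall m : nat, (m < n)%N -> s`_m = 0).
Proof.
move=> sn; split=> [h i lt|h]; last by apply/rowP => i; rewrite !mxE; exact: h (ltn_ord i).
by have := congr1 (fun r : 'rV[R]_n => r 0 (Ordinal lt)) h; rewrite !mxE.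
Qed.

Lemma obstruction1_lin c (W W' : cp1_tensor R) : cp1_multivector 1 W -> cp1_multivector 1 W' ->
  obstruction1 (c *: W + W') = c *: obstruction1 W + obstruction1 W'.
Proof.
move=> [mW _] [mW' _]; apply/rowP => i; rewrite !mxE.
have L j k l : partial l ((c *: W + W') j [:: k]) 0 = c * partial l (W j [:: k]) 0 + partial l (W' j [:: k]) 0.
  by have [_ _ s1] := mW j; have [_ _ s2] := mW' j; exact: partial_lin.
rewrite !L; case: i => -[|[|[|]]] //= _; ring.
Qed.

(* The field [c (x d/dx + y d/dy) + q (x d/dy - y d/dx)]. *)
Definition rotA (c : R) q : SF := sc c * xx - yy * q.
Definition rotB (c : R) q : SF := sc c * yy + xx * q.

Lemma rho_rot c q : rho (rotA c q) (rotB c q) = sc c * r2.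
Proof. by rewrite /rho /rotA /rotB /sqnorm; ring. Qed.

Lemma tau_rot c q : tau (rotA c q) (rotB c q) = r2 * q.
Proof. by rewrite /tau /rotA /rotB /sqnorm; ring. Qed.

Lemma dv_rot c q : th q = 0 -> dv (rotA c q) (rotB c q) = sc c *+ 2.
Proof.
move=> tq; transitivity (sc c *+ 2 + th q); last by rewrite tq addr0.
by rewrite /dv /th /rotA /rotB !ddE; ring.
Qed.

Lemma curl_rot c q : ev (curl (rotA c q) (rotB c q)) 0 = ev q 0 *+ 2.
Proof.
have -> : curl (rotA c q) (rotB c q) = q *+ 2 + Ed q.
  by rewrite /curl /Ed /rotA /rotB !ddE; ring.
by rewrite (evD (q *+ 2)) evMn /Ed evD !evM !ev_origin !mul0r !addr0.
Qed.

Lemma th_phi : th phi = 0.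
Proof. by rewrite /th !dd_phi /sqnorm !ddE; ring. Qed.

Lemma ev_phi0 : ev phi 0 = 1.
Proof. by rewrite ev_phi !mxE expr0n !addr0 invr1. Qed.

Lemma gluedV_rot c q0 q1 : glued 1 q0 q1 ->
  gluedV (rotA c q0) (rotB c q0) (rotA (- c) (- q1)) (rotB (- c) (- q1)).
Proof.
move=> H w w0; have n0 : ev r2 w != 0 by rewrite r2_eq0.
rewrite !rho_rot !tau_rot !(evM (sc _)) !(evM r2) evN !ev_sc r2_inv // H //.
move: (ev q0 w) (ev r2 w) n0 => p r n0; split; field; exact: n0.
Qed.

Lemma phi_r2 : 1 - phi = r2 * phi.
Proof. by rewrite -phiK; ring. Qed.

Lemma cohomology1 : isom_Rn (poisson_cohomology chart_Pi 1) 3.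
Proof.
apply: (@cohomology_isom R chart_Pi 1 3 obstruction1); first exact: obstruction1_lin.
- move=> W mW dW.
  have [a0 [b0 [a1 [b1 [eW gV]]]]] := iffLR (cp1_multivector1P W) mW.
  split=> [F0|[Y mY ->]].
    move: F0; rewrite eW obstruction1_W1 => /row_nth_eq0 => /(_ erefl) F0.
    move: dW; rewrite eW diff_W1 -W2_0 => /W2_inj [d0 d1].
    have [f0 [f1 [gf -> -> -> ->]]] := exact1 gV d0 d1 (F0 0 isT) (F0 1 isT) (F0 2 isT).
    exists (W0 f0 f1); last by rewrite diff_W0.
    by apply/cp1_multivector0P; exists f0, f1.
  have [f0 [f1 [-> gf]]] := iffLR (cp1_multivector0P Y) mY.
  rewrite diff_W0 obstruction1_W1 ev_dv_ham !ev_curl_ham; apply/row_nth_eq0 => //.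
  by move=> -[|[|[|]]].
- move=> r; pose v n (lt : (n < 3)%N) := r 0 (Ordinal lt).
  (* The constants solve the three equations div = 2 al, curl = 2 (be + ga) in the first chart and
     curl = - 2 be in the second, where [phi] is 1 at the origin and hence [1 - phi] is 0. The pair
     [q0], [q1] glues because inversion exchanges [phi] and [1 - phi]. *)
  pose al := v 0%N isT / 2; pose be := - v 2%N isT / 2.
  pose ga := (v 1%N isT + v 2%N isT) / 2.
  pose q0 : SF := sc be + sc ga * phi; pose q1 : SF := sc be + sc ga * (1 - phi).
  have t0 : th q0 = 0.
    transitivity (sc ga * th phi); last by rewrite th_phi mulr0.
    by rewrite /th /q0 !ddE; ring.
  have t1 : th (- q1) = 0.
    transitivity (sc ga * th phi); last by rewrite th_phi mulr0.
    by rewrite /th /q1 !ddE; ring.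
  have gq : glued 1 q0 q1.
    move=> w w0; rewrite /q0 /q1 !(evD (sc _)) !(evM (sc _)) (evB 1) ev1 !ev_sc phi_inv //.
    have -> : ev r2 w * ev phi w = 1 - ev phi w by rewrite -(evM r2) -phi_r2 (evB 1) ev1.
    by ev_ring.
  have co c q : th q = 0 -> diff1 (rotA c q) (rotB c q) = 0.
    by move=> tq; rewrite /diff1 rho_rot dv_rot //; ring.
  exists (W1 (rotA al q0) (rotB al q0) (rotA (- al) (- q1)) (rotB (- al) (- q1))).
    apply/asboolP; split; last by rewrite diff_W1 !co // W2_0.
    apply/cp1_multivector1P; do 4 eexists; split; first by [].
    exact: gluedV_rot.
  rewrite obstruction1_W1 dv_rot // !curl_rot evMn ev_sc evN /q0 /q1 !(evD (sc _)) !(evM (sc _)) (evB 1) ev1 !ev_sc ev_phi0.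
  have vE n (lt : (n < 3)%N) : r 0 (Ordinal lt) = v n lt by [].
  have irr n (lt lt' : (n < 3)%N) : v n lt = v n lt' by congr (r 0 _); apply: val_inj.
  apply/rowP => -[[|[|[|]]] //= lt]; rewrite !mxE vE (irr _ lt isT) /= /al /be /ga;
  move: (v 0%N isT) (v 1%N isT) (v 2%N isT) => v0 v1 v2; by field.
Qed.

End Degrees.

(** * Cohomology in degrees two and above, and the conclusion *)

Section HigherDegrees.
Variable R : realType.
Local Notation V := 'rV[R]_2.
Local Notation SF := (SF R).
Local Notation r2 := (sqnorm R).
Local Notation phi := (inv_sqnorm1 R).
Local Notation chart_Pi := (@chart_Pi R).
Implicit Types (a b f g h u q : SF) (w : V) (i j : 'I_2).

Definition obstruction2 (W : cp1_tensor R) : 'rV[R]_4 := \row_(i < 4)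
  [:: W 0 [:: 0; 1] 0; W 1 [:: 0; 1] 0;
      partial 0 (partial 0 (W 0 [:: 0; 1])) 0 + partial 1 (partial 1 (W 0 [:: 0; 1])) 0;
      partial 0 (partial 0 (W 1 [:: 0; 1])) 0 + partial 1 (partial 1 (W 1 [:: 0; 1])) 0]`_i.

Lemma obstruction2_W2 g0 g1 : obstruction2 (W2 g0 g1) =
  \row_(i < 4) [:: ev g0 0; ev g1 0; ev (lap g0) 0; ev (lap g1) 0]`_i.
Proof.
have e0 : W2 g0 g1 0 [:: 0; 1] = ev g0 by exact: T2_01.
have e1 : W2 g0 g1 1 [:: 0; 1] = ev g1 by exact: T2_01.
by rewrite /obstruction2 e0 e1.
Qed.

Lemma row4_lin (c x y z t x' y' z' t' x'' y'' z'' t'' : R) :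
  x'' = c * x + x' -> y'' = c * y + y' -> z'' = c * z + z' -> t'' = c * t + t' ->
  \row_(i < 4) [:: x''; y''; z''; t'']`_i =
  c *: \row_(i < 4) [:: x; y; z; t]`_i + \row_(i < 4) [:: x'; y'; z'; t']`_i.
Proof.
move=> -> -> -> ->.
by apply/rowP => -[[|[|[|[|]]]] //= lt]; rewrite !mxE.
Qed.

Lemma lin_add (c x y x' y' x'' y'' : R) : x'' = c * x + x' -> y'' = c * y + y' ->
  x'' + y'' = c * (x + y) + (x' + y').
Proof. by move=> -> ->; ring. Qed.

Lemma obstruction2_lin c (W W' : cp1_tensor R) : cp1_multivector 2 W -> cp1_multivector 2 W' ->
  obstruction2 (c *: W + W') = c *: obstruction2 W + obstruction2 W'.
Proof.
move=> [mW _] [mW' _].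
have L j l : partial l (partial l ((c *: W + W') j [:: 0; 1])) 0 =
    c * partial l (partial l (W j [:: 0; 1])) 0 + partial l (partial l (W' j [:: 0; 1])) 0.
  have [_ _ s1] := mW j; have [_ _ s2] := mW' j.
  rewrite -(partial_lin c _ _ (smooth_partial l (s1 [:: 0; 1])) (smooth_partial l (s2 [:: 0; 1]))).
  by congr (partial l _ 0); apply/funext => w; exact: partial_lin.
exact: row4_lin erefl erefl (lin_add (L 0 0) (L 0 1)) (lin_add (L 1 0) (L 1 1)).
Qed.

(** A four-parameter family stable under the change of charts: with the Jacobian factor,
    [r2 |-> 1 / r2] and [phi |-> r2 * phi] reverse the list of coefficients. [A] and [B] are the
    value and a quarter of the Laplacian at the origin of this chart, [D] and [C] those at the other
    origin. *)
Definition bivector (A B C D : R) : SF :=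
  sc A + r2 * (sc B * phi + r2 * (sc C * phi + sc D)).

Lemma gluedB_bivector A B C D : gluedB (bivector A B C D) (bivector D C B A).
Proof.
have E A' B' C' D' v : ev (bivector A' B' C' D') v =
    A' + ev r2 v * (B' * ev phi v + ev r2 v * (C' * ev phi v + D')) by [].
move=> w w0; have n0 : ev r2 w != 0 by rewrite r2_eq0.
rewrite !E phi_inv // r2_inv //.
move: (ev phi w) (ev r2 w) n0 => p r n0; field; exact: n0.
Qed.

Lemma ev_bivector A B C D : ev (bivector A B C D) 0 = A.
Proof.
rewrite /bivector (evD (sc A)) (evM r2) ev_sc; have -> : ev r2 0 = 0 by rewrite ev_origin.
by rewrite mul0r addr0.
Qed.

Lemma ev_lap_bivector A B C D : ev (lap (bivector A B C D)) 0 = B *+ 4.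
Proof.
have lsc : lap (sc A : SF) = 0 by rewrite /lap !dd_sc !dd0 addr0.
rewrite /bivector lapD lsc add0r ev_lap_r2 (evD (sc B * _)) (evM (sc B)) (evM r2) ev_sc ev_phi0.
have -> : ev r2 0 = 0 by rewrite ev_origin.
by rewrite mul0r addr0 mulr1.
Qed.

Lemma cohomology2 : isom_Rn (poisson_cohomology chart_Pi 2) 4.
Proof.
apply: (@cohomology_isom R chart_Pi 2 4 obstruction2); first exact: obstruction2_lin.
- move=> W mW _.
  have [g0 [g1 [-> gB]]] := iffLR (cp1_multivector2P W) mW.
  split=> [F0|[Y mY ->]].
    move: F0; rewrite obstruction2_W2 => /row_nth_eq0 => /(_ erefl) F0.
    have [a0 [b0 [a1 [b1 [gV -> ->]]]]] := exact2 gB (F0 0%N isT) (F0 1%N isT) (F0 2%N isT) (F0 3%N isT).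
    exists (W1 a0 b0 a1 b1); last by rewrite diff_W1.
    by apply/cp1_multivector1P; exists a0, b0, a1, b1.
  have [a0 [b0 [a1 [b1 [-> gV]]]]] := iffLR (cp1_multivector1P Y) mY.
  rewrite diff_W1 obstruction2_W2 !ev_diff1 !ev_lap_diff1; apply/row_nth_eq0 => //.
  by move=> -[|[|[|[|]]]].
- move=> r; pose v n (lt : (n < 4)%N) := r 0 (Ordinal lt).
  pose A := v 0%N isT; pose D := v 1%N isT; pose B := v 2%N isT / 4; pose C := v 3%N isT / 4.
  exists (W2 (bivector A B C D) (bivector D C B A)).
    apply/asboolP; split; last exact: diff_W2.
    apply/cp1_multivector2P; do 2 eexists; split; first by [].
    exact: gluedB_bivector.
  rewrite obstruction2_W2 !ev_bivector !ev_lap_bivector.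
  have vE n (lt : (n < 4)%N) : r 0 (Ordinal lt) = v n lt by [].
  have irr n (lt lt' : (n < 4)%N) : v n lt = v n lt' by congr (r 0 _); apply: val_inj.
  apply/rowP => -[[|[|[|[|]]]] //= lt]; rewrite !mxE vE (irr _ lt isT) /= /A /B /C /D;
  move: (v 0%N isT) (v 1%N isT) (v 2%N isT) (v 3%N isT) => v0 v1 v2 v3; by field.
Qed.

Lemma cohomology_gt2 n : (2 < n)%N -> isom_Rn (poisson_cohomology chart_Pi n) 0.
Proof.
move=> n2; apply: (@cohomology_isom R chart_Pi n 0 (fun=> 0)).
- by move=> a W W' _ _; rewrite scaler0 addr0.
- move=> W [mW _] _; have -> : W = 0.
    by apply/funext => j; exact: multivector_eq0 n2 (mW j).
  split=> // _; case: n n2 {mW} => // n _; exists 0; first exact: cp1_multivector0.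
  by rewrite poisson_diff0.
- move=> r; exists 0; last by apply/rowP => -[].
  by apply/asboolP; split; [exact: cp1_multivector0 | exact: poisson_diff0].
Qed.

End HigherDegrees.

Theorem theorem6p2 (R : realType) (PiSigma : cp1_tensor R) :
  coinduced PiSigma ->
  [/\ (forall k : nat, exists n : nat,
         isom_Rn (poisson_cohomology PiSigma k) n)
      /\ (exists N : nat, forall k : nat, (N <= k)%N ->
            isom_Rn (poisson_cohomology PiSigma k) 0),
      isom_Rn (poisson_cohomology PiSigma 0) 1,
      isom_Rn (poisson_cohomology PiSigma 1) 3
    & isom_Rn (poisson_cohomology PiSigma 2) 4].
Proof.
move=> /coinducedE ->; split.
- split; last by exists 3%N => k k3; exact: cohomology_gt2.
  case=> [|[|[|k]]].
  + by exists 1%N; exact: cohomology0.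
  + by exists 3%N; exact: cohomology1.
  + by exists 4%N; exact: cohomology2.
  + by exists 0%N; exact: cohomology_gt2.
- exact: cohomology0.
- exact: cohomology1.
- exact: cohomology2.
Qed.
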